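(* Let $N\geqslant 1$ and $k_0\geqslant 2$ be integers. For $i=1,\dots,N$ let $n_i\geqslant 1$ be an integer, $w_i>0$ a real number, and $p_i,\overline q_i\in(0,1)$ with $$\overline q_i\geqslant \frac{1}{n_i^{k_0}},\qquad 0<p_i\leqslant\frac12,\qquad \overline q_i\leqslant\frac1{30}.$$ Let $S_i$ have the Markov binomial distribution with parameters $p_i,\ q_i=1-p_i,\ \overline p_i=1-\overline q_i,\ \overline q_i,\ n_i$, let $H_{in}=\mathcal L(w_iS_i)$ be the distribution of $w_iS_i$, and let $D_{in}$ be the signed compound Poisson measure $$D_{in}=\exp\Bigl\{\Bigl(\frac{\gamma_i(\overline q_i-p_i)}{q_i+\overline q_i}+n_i\gamma_i\Bigr)Y_i-n_i\Bigl(\frac{q_i\overline q_i^{\,2}}{(q_i+\overline q_i)^2}\Bigl(p_i+\frac{q_i}{q_i+\overline q_i}\Bigr)+\frac{\gamma_i^2}{2}\Bigr)Y_i^2\Bigr\}.$$ Then $$\Bigl|\prod_{i=1}^N H_{in}-\prod_{i=1}^N D_{in}\Bigr|_K\leqslant C(N,k_0)\,\frac{\max_i w_i}{\min_i w_i}\cdot\frac{\sum_{i=1}^N\overline q_i(p_i+\overline q_i)}{\sqrt{\sum_{k=1}^N\max(n_k\overline q_k,1)}},$$ where $C(N,k_0)$ is a positive constant depending only on $N$ and $k_0$.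
   Context: Markov binomial distribution: let $\xi_{i0}=0,\xi_{i1},\xi_{i2},\dots$ be a Markov chain on $\{0,1\}$ started at $0$ with transition probabilities, for $k\geqslant 1$, $$P(\xi_{ik}=1\mid\xi_{i,k-1}=1)=p_i,\quad P(\xi_{ik}=0\mid\xi_{i,k-1}=1)=q_i,\quad P(\xi_{ik}=1\mid\xi_{i,k-1}=0)=\overline q_i,\quad P(\xi_{ik}=0\mid\xi_{i,k-1}=0)=\overline p_i,$$ with $p_i+q_i=\overline q_i+\overline p_i=1$ and $p_i,\overline q_i\in(0,1)$. The distribution of $S_i=\xi_{i1}+\cdots+\xi_{in_i}$ is the Markov binomial distribution with parameters $p_i,q_i,\overline p_i,\overline q_i,n_i$. Set $\gamma_i=\dfrac{q_i\overline q_i}{q_i+\overline q_i}$, and let $Y_i$ be the finite signed measure on $\mathbb R$ with Fourier–Stieltjes transform $\widehat Y_i(t)=\dfrac{q_i e^{\mathrm{i}w_it}}{1-p_ie^{\mathrm{i}w_it}}-1$ (here $\mathrm i$ in the exponent is the imaginary unit). Products and powers of measures are in the convolution sense; $M^0=I$ is the unit mass at $0$ and $\exp\{M\}=\sum_{k=0}^\infty M^k/k!$ for a finite signed measure $M$. $|M|_K=\sup_{x\in\mathbb R}|M((-\infty,x])|$ is the Kolmogorov norm. (If $S_1,\dots,S_N$ are independent, $\prod_{i=1}^N H_{in}$ is the distribution of $w_1S_1+\cdots+w_NS_N$.) *)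

(* Defs.v *)
From HB Require Import structures.
From mathcomp Require Import all_boot all_order all_algebra.
From mathcomp Require Import all_classical all_reals all_analysis.
From mathcomp Require Import measurable_realfun complex ring lra.

Set Implicit Arguments.
Unset Strict Implicit.
Unset Printing Implicit Defensive.

Import Order.TTheory GRing.Theory Num.Theory.
Import numFieldNormedType.Exports.

Local Open Scope classical_set_scope.
Local Open Scope ring_scope.
Local Open Scope complex_scope.

(* A charge is finite-valued on measurable sets, so this is exactly the type of
   finite signed Borel measures on the real line. *)
Definition smeasure (R : realType) := {charge set (measurableTypeR R) -> \bar R}.

Section jordan.
Context (R : realType).
Implicit Type M : smeasure R.

Lemma hahn_ex M : exists PN, hahn_decomposition M PN.1 PN.2.
Proof. by have [P [N PN]] := Hahn_decomposition M; exists (P, N). Qed.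

(* The Hahn decomposition is unique up to null sets, so the Jordan parts do not
   depend on the one that is chosen. *)
Definition jpos M : {finite_measure set (measurableTypeR R) -> \bar R} :=
  jordan_pos (projT2 (cid (hahn_ex M))).
Definition jneg M : {finite_measure set (measurableTypeR R) -> \bar R} :=
  jordan_neg (projT2 (cid (hahn_ex M))).

Lemma jposB M A : measurable A -> M A = (jpos M A - jneg M A)%E.
Proof.
by move=> mA; rewrite (jordan_decomp (projT2 (cid (hahn_ex M))))// /cadd/= cscaleN1.
Qed.

End jordan.

Section finite_convolution.
Context (R : realType).
Variables (m n : {finite_measure set (measurableTypeR R) -> \bar R}).

Let add2 := fun z : measurableTypeR R * measurableTypeR R => z.1 + z.2 : measurableTypeR R.

Let madd2 : measurable_fun setT add2.
Proof. exact: (measurable_funD measurable_fst measurable_snd). Qed.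

Definition fconv : set (measurableTypeR R) -> \bar R := pushforward (m \x n)%E add2.

Let fconv0 : fconv set0 = 0%E.
Proof. by rewrite /fconv /pushforward preimage_set0 measure0. Qed.

Lemma fconv_leT A : measurable A -> (fconv A <= (m \x n)%E setT)%E.
Proof.
move=> mA; rewrite /fconv /pushforward.
have mB : measurable (add2 @^-1` A) by rewrite -[X in measurable X]setTI; exact: madd2.
by apply: le_measure; rewrite ?inE.
Qed.

Let fconvfin A : measurable A -> fconv A \is a fin_num.
Proof.
move=> mA; rewrite ge0_fin_numE; last exact: measure_ge0.
apply: (le_lt_trans (fconv_leT mA)); rewrite -setXTT product_measure1E//.
by rewrite ltey_eq fin_numM// fin_num_measure.
Qed.

Let fconvsa : semi_sigma_additive fconv.
Proof.
move=> F mF tF mUF; rewrite /fconv/pushforward preimage_bigcup.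
apply: measure_semi_sigma_additive.
- by move=> k; rewrite -[X in measurable X]setTI; exact: madd2.
- apply/trivIsetP => /= i j _ _ ij; rewrite -preimage_setI.
  by move/trivIsetP : tF => /(_ _ _ _ _ ij) ->//; rewrite preimage_set0.
- by rewrite -preimage_bigcup -[X in measurable X]setTI; exact: madd2.
Qed.

HB.instance Definition _ := isCharge.Build _ _ _ fconv fconv0 fconvfin fconvsa.
End finite_convolution.

Section smeasure_ops.
Context (R : realType).
Implicit Types M L : smeasure R.

Definition unit_mass : smeasure R :=
  charge_of_finite_measure (\d_ (0 : measurableTypeR R)).
Definition sadd M L : smeasure R := cadd M L.
Definition sscale (a : R) M : smeasure R := cscale a M.
Definition ssub M L : smeasure R := sadd M (copp L).
(* Bilinear extension of [fconv] through M = M+ - M- and L = L+ - L-. *)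
Definition sconv M L : smeasure R :=
  ssub (sadd (fconv (jpos M) (jpos L)) (fconv (jneg M) (jneg L)))
       (sadd (fconv (jpos M) (jneg L)) (fconv (jneg M) (jpos L))).
Definition spow M (k : nat) : smeasure R := iter k (sconv M) unit_mass.
Definition sprod N (M : 'I_N -> smeasure R) : smeasure R :=
  \big[sconv/unit_mass]_(i < N) M i.

End smeasure_ops.

Section tannery.
Context (R : realType).
Implicit Types (b u v : nat -> R).

Lemma cvg_dominated b u : cvgn (series b) -> (forall k, `|u k| <= b k) ->
  cvgn (series u).
Proof.
move=> cb ub; apply: (@normed_cvg _ R^o).
apply: (series_le_cvg _ _ _ cb) => k; rewrite ?normr_ge0//; last exact: ub.
by rewrite (le_trans (normr_ge0 (u k))).
Qed.

Lemma dominated_tail b u K : cvgn (series b) -> (forall k, `|u k| <= b k) ->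
  `|limn (series u) - series u K| <= limn (series b) - series b K.
Proof.
move=> cb ub; have cu := cvg_dominated cb ub.
have cn : (fun n => `|series u n - series u K|) @ \oo -->
    `|limn (series u) - series u K|.
  by apply: cvg_norm; apply: cvgB => //; exact: cvg_cst.
rewrite -(cvg_lim _ cn)//.
have cbK : (fun n => series b n - series b K) @ \oo -->
    limn (series b) - series b K.
  by apply: cvgB => //; exact: cvg_cst.
rewrite -(cvg_lim _ cbK)//.
apply: ler_lim; [by apply/cvg_ex; eexists; exact: cn|
                 by apply/cvg_ex; eexists; exact: cbK|].
near=> n; have Kn : (K <= n)%N by near: n; exact: nbhs_infty_ge.
rewrite !sub_series_geq//.
by apply: le_trans (ler_norm_sum _ _ _) _; exact: ler_sum.
Unshelve. all: by end_near. Qed.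

Lemma tannery b (u : nat -> nat -> R) v : cvgn (series b) ->
  (forall n k, `|u n k| <= b k) -> (forall k, `|v k| <= b k) ->
  (forall k, u n k @[n --> \oo] --> v k) ->
  limn (series (u n)) @[n --> \oo] --> limn (series v).
Proof.
move=> cb ub vb uv; apply/cvgrPdist_le => e e0.
have e3 : 0 < e / 3%:R by rewrite divr_gt0.
have /cvgrPdist_le/(_ _ e3)[K _ /(_ K (leqnn K)) /= hK] : series b @ \oo --> limn (series b) by [].
have sK : series (u n) K @[n --> \oo] --> series v K.
  rewrite /series/=; apply: cvg_big => //; exact: add_continuous.
near=> n.
have h1 := dominated_tail K cb vb; have h2 := dominated_tail K cb (ub n).
have h3 : `|series v K - series (u n) K| <= e / 3%:R.
  by near: n; move/cvgrPdist_le : sK => /(_ _ e3).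
rewrite (_ : limn _ - _ = (limn (series v) - series v K) +
  (series v K - series (u n) K) - (limn (series (u n)) - series (u n) K)); last first.
  by ring.
have hK' := le_trans (ler_norm _) hK.
apply: le_trans (ler_normB _ _) _.
rewrite [leRHS](_ : e = e / 3%:R + e / 3%:R + e / 3%:R); last first.
  by lra.
apply: lerD; last exact: le_trans hK'.
apply: le_trans (ler_normD _ _) _; apply: lerD => //; exact: le_trans hK'.
Unshelve. all: by end_near. Qed.

End tannery.

Section expm.
Context (R : realType).
Implicit Types M L : smeasure R.

Let tv M : R := fine (jpos M setT) + fine (jneg M setT).

Let le_tot (m : {finite_measure set (measurableTypeR R) -> \bar R}) A :
  measurable A -> fine (m A) <= fine (m setT).
Proof.
by move=> mA; rewrite fine_le ?fin_num_measure// le_measure ?inE.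
Qed.

Let tv_ge0 M : 0 <= tv M. Proof. by rewrite addr_ge0 ?fine_ge0. Qed.

Let sm_tv M A : measurable A -> `|fine (M A)| <= tv M.
Proof.
move=> mA; rewrite jposB// fineB ?fin_num_measure//.
by rewrite (le_trans (ler_normB _ _))// lerD// ger0_norm ?fine_ge0// le_tot.
Qed.

Let tv_le M c : (forall A, measurable A -> `|fine (M A)| <= c) -> tv M <= c + c.
Proof.
move=> Mc; rewrite /tv; apply: lerD.
- rewrite /jpos; case: cid => -[P N]/= PN; rewrite jordan_posE cjordan_posE.
  rewrite /crestr0 mem_set//= /crestr setTI.
  by apply: (le_trans (ler_norm _)); apply: Mc; case: PN => -[].
- rewrite /jneg; case: cid => -[P N]/= PN; rewrite jordan_negE cjordan_negE.
  rewrite /crestr0 mem_set//= /crestr setTI.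
  rewrite fineN; apply: (le_trans (ler_norm _)); rewrite normrN.
  by apply: Mc; case: PN => _ [].
Qed.

Let fconv_ge0 (m n : {finite_measure set (measurableTypeR R) -> \bar R}) A :
  0 <= fine (fconv m n A).
Proof. by apply: fine_ge0; rewrite /fconv /pushforward; exact: measure_ge0. Qed.

Let fconv_le (m n : {finite_measure set (measurableTypeR R) -> \bar R}) A :
  measurable A -> fine (fconv m n A) <= fine (m setT) * fine (n setT).
Proof.
move=> mA; rewrite -fineM ?fin_num_measure// -product_measure1E// setXTT.
rewrite fine_le ?fin_num_measure//.
- by rewrite -setXTT product_measure1E// fin_numM// fin_num_measure.
- exact: fconv_leT.
Qed.

Let sconv_le M L A : measurable A -> `|fine (sconv M L A)| <= tv M * tv L.
Proof.
move=> mA.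
have f m n : fconv m n A \is a fin_num by exact: fin_num_measure.
have -> : sconv M L A =
  (fconv (jpos M) (jpos L) A + fconv (jneg M) (jneg L) A -
   (fconv (jpos M) (jneg L) A + fconv (jneg M) (jpos L) A))%E by [].
rewrite fineB; [|by rewrite fin_numD !f|by rewrite fin_numD !f].
rewrite [in X in X - _]fineD// [in X in _ - X]fineD//.
rewrite (le_trans (ler_normB _ _))// !ger0_norm ?addr_ge0//.
have := fconv_le (jpos M) (jpos L) mA; have := fconv_le (jpos M) (jneg L) mA.
have := fconv_le (jneg M) (jpos L) mA; have := fconv_le (jneg M) (jneg L) mA.
rewrite /tv; lra.
Qed.

Let spow_le M k A : measurable A -> `|fine (spow M k A)| <= (2%:R * tv M) ^+ k.
Proof.
elim: k A => [A mA|k ih A mA].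
  by rewrite expr0 (_ : spow M 0 A = \d_(0 : measurableTypeR R) A)// diracE; case: (_ \in _); rewrite /= ?normr1 ?normr0.
apply: (le_trans (sconv_le M (spow M k) mA)).
apply: (le_trans (ler_wpM2l (tv_ge0 M) (tv_le ih))).
by rewrite exprS le_eqVlt; apply/orP; left; apply/eqP; ring.
Qed.

Definition expm_term M (A : set (measurableTypeR R)) (k : nat) : R :=
  fine (spow M k A) / k`!%:R.

(* Setwise sum of the M^k / k!. By [is_cvg_expm] below the series converges on
   every measurable set, and [expm] packages the sum as a charge. *)
Definition expm_fun M (A : set (measurableTypeR R)) : \bar R :=
  (limn (series (expm_term M A)))%:E.

Let bnd M : nat -> R := exp_coeff (2%:R * tv M).

Let cvg_bnd M : cvgn (series (bnd M)). Proof. exact: is_cvg_series_exp_coeff. Qed.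

Let term_le M A k : measurable A -> `|expm_term M A k| <= bnd M k.
Proof.
move=> mA; rewrite /expm_term /bnd /exp_coeff/= normrM normfV.
by rewrite (ger0_norm (ler0n _ _)) ler_wpM2r ?invr_ge0// spow_le.
Qed.

Lemma is_cvg_expm M A : measurable A -> cvgn (series (expm_term M A)).
Proof. by move=> mA; apply: (cvg_dominated (@cvg_bnd M)) => k; exact: term_le. Qed.

Let term0 M : expm_term M set0 = fun=> 0.
Proof. by apply/funext => k; rewrite /expm_term charge0/= mul0r. Qed.

Let expm0 M : expm_fun M set0 = 0%E.
Proof.
rewrite /expm_fun term0; congr EFin; apply: cvg_lim => //.
rewrite (_ : series _ = cst 0); first exact: cvg_cst.
by apply/funext => n; rewrite /series/= big1.
Qed.

Let expm_fin M A : measurable A -> expm_fun M A \is a fin_num.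
Proof. by []. Qed.

Let termU M A B : measurable A -> measurable B -> A `&` B = set0 ->
  expm_term M (A `|` B) = expm_term M A \+ expm_term M B.
Proof.
move=> mA mB AB; apply/funext => k.
by rewrite /expm_term/= chargeU// fineD ?fin_num_measure// mulrDl.
Qed.

Let expmU M A B : measurable A -> measurable B -> A `&` B = set0 ->
  expm_fun M (A `|` B) = (expm_fun M A + expm_fun M B)%E.
Proof.
move=> mA mB AB; rewrite /expm_fun -EFinD; congr EFin; rewrite termU//.
have -> : series (expm_term M A \+ expm_term M B) =
    series (expm_term M A) \+ series (expm_term M B).
  by apply/funext => n; rewrite /series/= big_split.
by rewrite limD//; exact: is_cvg_expm.
Qed.

Let chU M A B : measurable A -> measurable B -> A `&` B = set0 ->
  M (A `|` B) = (M A + M B)%E.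
Proof. by move=> mA mB AB; rewrite chargeU. Qed.

Let sum_bigU (mu : set (measurableTypeR R) -> \bar R) F n :
  mu set0 = 0%E ->
  (forall A B, measurable A -> measurable B -> A `&` B = set0 ->
    mu (A `|` B) = (mu A + mu B)%E) ->
  (forall i, measurable (F i)) -> trivIset setT F ->
  (\sum_(0 <= i < n) mu (F i))%E = mu (\big[setU/set0]_(0 <= i < n) F i).
Proof.
move=> mu0 muU mF tF; elim: n => [|n ih]; first by rewrite !big_nil mu0.
rewrite !big_nat_recr//= ih muU//.
  by rewrite big_mkord; exact: bigsetU_measurable.
rewrite big_mkord; apply/seteqP; split=> // x [].
rewrite -bigcup_mkord => -[i /= ltin Fix] Fnx.
move/trivIsetP : tF => /(_ i n Logic.I Logic.I); rewrite ltn_eqF// => /(_ isT).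
by move/seteqP => -[+ _] => /(_ x); apply; split.
Qed.

Let expm_sa M : semi_sigma_additive (expm_fun M).
Proof.
move=> F mF tF mUF.
under eq_fun do rewrite (sum_bigU _ (expm0 M) (@expmU M) mF tF).
rewrite /expm_fun; apply: cvg_EFin; first by apply: nearW.
apply: (tannery (@cvg_bnd M)) => [n k|k|k].
- by apply: term_le; rewrite big_mkord; exact: bigsetU_measurable.
- exact: term_le.
- apply: cvgMl.
  have := @charge_semi_sigma_additive _ _ _ (spow M k) F mF tF mUF.
  under eq_fun do rewrite (sum_bigU _ (charge0 _) (chU (spow M k)) mF tF).
  by rewrite -(@fineK _ (spow M k (\bigcup_i F i))) ?fin_num_measure// => /fine_cvg.
Qed.

HB.instance Definition _ M := isCharge.Build _ _ _ (expm_fun M)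
  (expm0 M) (@expm_fin M) (@expm_sa M).

Definition expm M : smeasure R := expm_fun M.

End expm.

Section transform_and_norm.
Context (R : realType).
Implicit Type M : smeasure R.

Definition charge_integral M (f : R -> R) : R :=
  (\int[jpos M]_x f x) - (\int[jneg M]_x f x).

Definition expi (x : R) : R[i] := cos x +i* sin x.

Definition fourier_stieltjes M (t : R) : R[i] :=
  charge_integral M (fun x => cos (t * x)) +i* charge_integral M (fun x => sin (t * x)).

(* The supremum is taken in the extended reals, so no boundedness is presupposed. *)
Definition kolmogorov_norm M : \bar R :=
  ereal_sup [set `|M `]-oo, x]%classic|%E | x in [set: R]].

End transform_and_norm.

Section markov_binomial.
Context (R : realType) (d : measure_display) (T : measurableType d)
  (P : probability T R).

Definition cond_prob (A B : set T) : R := fine (P (A `&` B)) / fine (P B).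

(* P(next = b | current = a), with true for 1 and false for 0; [qb] and [pb] are
   the barred q and p. *)
Definition trans_prob (p q pb qb : R) (a b : bool) : R :=
  if a then (if b then p else q) else (if b then qb else pb).

Definition history (xi : nat -> {RV P >-> bool}) (x : nat -> bool) (k : nat) :
  set T := [set t | forall j, (j <= k)%N -> xi j t = x j].

(* Time-homogeneous Markov chain started at 0: conditionally on any trajectory up
   to time k of positive probability, the law of the next state depends only on
   the state at time k. *)
Definition markov_chain01 (p q pb qb : R) (xi : nat -> {RV P >-> bool}) : Prop :=
  (forall t, xi 0 t = false) /\
  forall (k : nat) (x : nat -> bool) (b : bool),
    P (history xi x k) != 0%E ->
    cond_prob [set t | xi k.+1 t = b] (history xi x k) =
      trans_prob p q pb qb (x k) b.

Definition weighted_sum (w : R) (n : nat) (xi : nat -> {RV P >-> bool}) (t : T) :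
  measurableTypeR R := w * \sum_(1 <= k < n.+1) (xi k t)%:R.

Let measurable_weighted_sum w n xi : measurable_fun setT (weighted_sum w n xi).
Proof.
apply: measurable_funM; first exact: measurable_cst.
apply: measurable_sum => k.
apply: (@measurableT_comp _ _ _ _ _ _ (fun b : bool => b%:R : R)) => //.
Qed.

HB.instance Definition _ w n xi :=
  isMeasurableFun.Build _ _ _ _ (weighted_sum w n xi)
    (measurable_weighted_sum w n xi).

Definition markov_binomial_law (w : R) (n : nat) (xi : nat -> {RV P >-> bool}) :
  smeasure R :=
  charge_of_finite_measure (distribution P (weighted_sum w n xi)).

End markov_binomial.

Section approximation.
Context (R : realType).

Definition gam (q qb : R) : R := q * qb / (q + qb).

Definition cpoisson (p q qb : R) (n : nat) (Y : smeasure R) : smeasure R :=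
  expm (ssub
    (sscale (gam q qb * (qb - p) / (q + qb) + n%:R * gam q qb) Y)
    (sscale (n%:R * (q * qb ^+ 2 / (q + qb) ^+ 2 * (p + q / (q + qb))
                     + gam q qb ^+ 2 / 2%:R)) (spow Y 2))).

(* The starting value 0 is harmless for positive weights when 0 < N. *)
Definition maxw N (w : 'I_N -> R) : R := \big[Num.max/0]_(i < N) w i.
(* The starting value maxw w leaves the minimum unchanged when 0 < N. *)
Definition minw N (w : 'I_N -> R) : R := \big[Num.min/maxw w]_(i < N) w i.

End approximation.

(* Main.v *)
(** All the measures involved live on lattices, so they are handled through the power
    series of their weights, measured by the l^1 norm.  With F the series of the
    geometric jump and y = F - 1, the series of S_i is W1 Lam^n + W2 Lam2^n, where Lam
    and Lam2 are the eigenvalues of the transfer matrix.  The dominant one is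
    Lam = exp(g y) (1 + g y^2 rho) with rho small; since || y^j exp(s y) || = O(s^(-j/2))
    by the Charlier identities for Poisson weights, the powers Lam^n have the same
    smoothing property, and so do the powers of the second order approximation exp(L)
    of Lam.  As exp(L) - Lam = O(y^3 qb^2 (p + qb)), telescoping Lam^n - exp(L)^n gives
    H_i - D_i = (X - 1) V_i with || V_i || = O(qb (p + qb)) and a further gain
    (n qb)^(-1/2) for || H_i - D_i || itself.  In the telescoped difference of the
    products, X - 1 acts as a difference of shifts by w_i; it is absorbed by the factor k
    with the largest n_k qb_k, whose mass in an interval of length w_i is
    O((w_i / w_k + 1) (n_k qb_k)^(-1/2)).  The measure Y_i is recovered from its transform
    because the indicators of half-lines are iterated bounded pointwise limits of
    trigonometric polynomials. *)

From HB Require Import structures.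
Require Import Defs.
From mathcomp Require Import all_boot all_order all_algebra.
From mathcomp Require Import all_classical all_reals all_analysis.
From mathcomp Require Import measurable_realfun complex ring lra.

Set Implicit Arguments.
Unset Strict Implicit.
Unset Printing Implicit Defensive.

Import Order.TTheory GRing.Theory Num.Theory.
Import numFieldNormedType.Exports.

Local Open Scope classical_set_scope.
Local Open Scope ring_scope.

(** * Formal power series and their truncated l^1 norms *)

(** The Kolmogorov norm is bounded one half-line at a time, and below a given x each lattice has
    only finitely many points. Norms are therefore truncated at an arbitrary degree m, which makes
    them finite for every series; what matters is that the constants do not depend on m. The weights
    [w i] need not be commensurable, so the product of the laws is not a power series in one
    variable: each factor keeps its own series and acts as a convolution operator on functions of a
    real variable. Comparing n-th powers costs a factor n. It is repaid by two powers of y, because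
    n qb decay(n qb)^2 <= 1, while a third y must remain as the common factor of the difference;
    hence the exponent has to match the eigenvalue up to order y^2. In the smoothing of the powers,
    1/20 of the Poisson exponent absorbs y^j and 19/20 absorbs the binomial expansion of (1 + g y^2
    rho)^n. The expansion is dominated by a geometric series once rho has norm at most 1/5, and the
    bounds p <= 1/2 and qb <= 1/30 guarantee this. *)

Record fps (R : Type) := Fps { fcoef : nat -> R }.

Section fps_ring.
Context (R : realType).
Implicit Types a b c : fps R.

Lemma fpsP a b : (forall n, fcoef a n = fcoef b n) -> a = b.
Proof. by case: a b => [f] [g] /= /funext ->. Qed.

HB.instance Definition _ := gen_eqMixin (fps R).
HB.instance Definition _ := gen_choiceMixin (fps R).

Definition fps_const (x : R) := Fps (fun n => if n == 0%N then x else 0).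
Definition fps_add a b := Fps (fun n => fcoef a n + fcoef b n).
Definition fps_opp a := Fps (fun n => - fcoef a n).
Definition fps_mul a b :=
  Fps (fun n => \sum_(i < n.+1) fcoef a i * fcoef b (n - i)).

Lemma fps_addA : associative fps_add.
Proof. by move=> a b c; apply: fpsP => n /=; rewrite addrA. Qed.
Lemma fps_addC : commutative fps_add.
Proof. by move=> a b; apply: fpsP => n /=; rewrite addrC. Qed.
Lemma fps_add0 : left_id (fps_const 0) fps_add.
Proof. by move=> a; apply: fpsP => n /=; rewrite if_same add0r. Qed.
Lemma fps_addN : left_inverse (fps_const 0) fps_opp fps_add.
Proof. by move=> a; apply: fpsP => n /=; rewrite if_same addNr. Qed.

HB.instance Definition _ := GRing.isZmodule.Build (fps R)
  fps_addA fps_addC fps_add0 fps_addN.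

Definition fps_poly a n : {poly R} := \poly_(i < n) fcoef a i.

(** Coefficient n of a product involves only coefficients up to n, so associativity and
    commutativity are inherited from polynomial truncations. *)
Lemma fps_mul_poly a b (p r : {poly R}) n :
  (forall i, (i <= n)%N -> p`_i = fcoef a i) ->
  (forall i, (i <= n)%N -> r`_i = fcoef b i) ->
  fcoef (fps_mul a b) n = (p * r)`_n.
Proof.
move=> pa rb; rewrite coefM /=; apply: eq_bigr => i _.
by rewrite pa ?rb ?leq_subr// -ltnS.
Qed.

Lemma fps_polyE a n i : (i <= n)%N -> (fps_poly a n.+1)`_i = fcoef a i.
Proof. by move=> le; rewrite coef_poly ltnS le. Qed.

Lemma fps_mul_poly_le a b n i : (i <= n)%N ->
  (fps_poly a n.+1 * fps_poly b n.+1)`_i = fcoef (fps_mul a b) i.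
Proof.
by move=> le; symmetry; apply: fps_mul_poly => j ji;
  rewrite fps_polyE// (leq_trans ji).
Qed.

Lemma fps_mulA : associative fps_mul.
Proof.
move=> a b c; apply: fpsP => n.
rewrite (@fps_mul_poly _ _ (fps_poly a n.+1) (fps_poly b n.+1 * fps_poly c n.+1))//;
  [|exact: fps_polyE|exact: fps_mul_poly_le].
rewrite (@fps_mul_poly _ _ (fps_poly a n.+1 * fps_poly b n.+1) (fps_poly c n.+1))//;
  [|exact: fps_mul_poly_le|exact: fps_polyE].
by rewrite mulrA.
Qed.

Lemma fps_mulC : commutative fps_mul.
Proof.
move=> a b; apply: fpsP => n.
by rewrite -(@fps_mul_poly_le _ _ n n)// -(@fps_mul_poly_le _ _ n n)// mulrC.
Qed.

Lemma fps_mul1 : left_id (fps_const 1) fps_mul.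
Proof.
move=> a; apply: fpsP => n /=.
by rewrite big_ord_recl/= mul1r subn0 big1 ?addr0// => i _; rewrite mul0r.
Qed.

Lemma fps_mulDl : left_distributive fps_mul fps_add.
Proof.
move=> a b c; apply: fpsP => n /=; rewrite -big_split /=.
by apply: eq_bigr => i _; rewrite mulrDl.
Qed.

Lemma fps_oneP : fps_const 1 != fps_const 0.
Proof. by apply/eqP => -[] /(congr1 (@^~ 0%N))/= /eqP; rewrite oner_eq0. Qed.

HB.instance Definition _ := GRing.Zmodule_isComNzRing.Build (fps R)
  fps_mulA fps_mulC fps_mul1 fps_mulDl fps_oneP.

Lemma fps_const_zmod : zmod_morphism fps_const.
Proof. by move=> x y; apply: fpsP => -[|n] //=; rewrite subr0. Qed.

Lemma fps_const_monoid : monoid_morphism fps_const.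
Proof.
split=> // x y; apply: fpsP => -[|n] /=; first by rewrite big_ord1.
by rewrite big1// => -[[|i] ?] _ /=; rewrite ?mulr0 ?mul0r.
Qed.

HB.instance Definition _ :=
  GRing.isZmodMorphism.Build R (fps R) fps_const fps_const_zmod.
HB.instance Definition _ :=
  GRing.isMonoidMorphism.Build R (fps R) fps_const fps_const_monoid.

Lemma fcoefD a b n : fcoef (a + b) n = fcoef a n + fcoef b n. Proof. by []. Qed.
Lemma fcoefB a b n : fcoef (a - b) n = fcoef a n - fcoef b n. Proof. by []. Qed.
Lemma fcoefM a b n :
  fcoef (a * b) n = \sum_(i < n.+1) fcoef a i * fcoef b (n - i).
Proof. by []. Qed.
Lemma fcoef0 n : fcoef (0 : fps R) n = 0. Proof. by case: n. Qed.
Lemma fcoef1 n : fcoef (1 : fps R) n = (n == 0%N)%:R.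
Proof. by case: n. Qed.
Lemma fcoefZ x a n : fcoef (fps_const x * a) n = x * fcoef a n.
Proof.
rewrite fcoefM big_ord_recl/= subn0 big1 ?addr0// => i _.
by rewrite mul0r.
Qed.
Lemma fcoef_sum I (r : seq I) (P : pred I) (f : I -> fps R) n :
  fcoef (\sum_(i <- r | P i) f i) n = \sum_(i <- r | P i) fcoef (f i) n.
Proof. exact: (big_morph (fun a => fcoef a n) (fun a b => fcoefD a b n) (fcoef0 n)). Qed.

Definition fps_X : fps R := Fps (fun n => (n == 1%N)%:R).

Lemma fcoefXM a n : fcoef (fps_X * a) n = if n is k.+1 then fcoef a k else 0.
Proof.
rewrite fcoefM; case: n => [|n]; first by rewrite big_ord1 mul0r.
rewrite 2!big_ord_recl/= mul0r add0r mul1r subSS subn0 big1 ?addr0// => i _.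
by rewrite mul0r.
Qed.

(** When the coefficients are the masses of a charge on a lattice, these partial sums are the values
    of its distribution function. *)
Definition psum a m := \sum_(k < m) fcoef a k.

Lemma psumS a m : psum a m.+1 = psum a m + fcoef a m.
Proof. by rewrite /psum big_ord_recr. Qed.

Lemma psum0 a : psum a 0 = 0. Proof. by rewrite /psum big_ord0. Qed.

Lemma psumM a b m : psum (a * b) m = \sum_(k < m) fcoef a k * psum b (m - k).
Proof.
elim: m => [|m ih]; first by rewrite psum0 big_ord0.
rewrite psumS ih [RHS]big_ord_recr/= subSnn psumS psum0 add0r.
rewrite big_ord_recr/= subnn addrA; congr (_ + _).
rewrite -big_split/=; apply: eq_bigr => i _.
by rewrite subSn 1?ltnW// psumS mulrDr.
Qed.

Lemma psumD a b m : psum (a + b) m = psum a m + psum b m.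
Proof. by rewrite /psum -big_split. Qed.
Lemma psumB a b m : psum (a - b) m = psum a m - psum b m.
Proof. by rewrite /psum -sumrB. Qed.
Lemma psumZ x a m : psum (fps_const x * a) m = x * psum a m.
Proof. by rewrite /psum mulr_sumr; apply: eq_bigr => i _; rewrite fcoefZ. Qed.

Section norm.
Variable m : nat.
(** The truncated norm is still submultiplicative, so estimates can be made without any summability
    assumption. *)
Definition fnorm a := \sum_(k < m) `|fcoef a k|.

Lemma fnorm_ge0 a : 0 <= fnorm a. Proof. exact: sumr_ge0. Qed.
Lemma fnormD a b : fnorm (a + b) <= fnorm a + fnorm b.
Proof. by rewrite /fnorm -big_split; apply: ler_sum => i _; exact: ler_normD. Qed.
Lemma fnormN a : fnorm (- a) = fnorm a.
Proof. by apply: eq_bigr => i _; rewrite normrN. Qed.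
Lemma fnormB a b : fnorm (a - b) <= fnorm a + fnorm b.
Proof. by rewrite -(fnormN b) fnormD. Qed.
Lemma fnormZ x a : fnorm (fps_const x * a) = `|x| * fnorm a.
Proof. by rewrite /fnorm mulr_sumr; apply: eq_bigr => i _; rewrite fcoefZ normrM. Qed.
Lemma fnorm_const x : fnorm (fps_const x) <= `|x|.
Proof.
rewrite /fnorm; case: m => [|k]; first by rewrite big_ord0.
by rewrite big_ord_recl/= big1 ?addr0// => i _; rewrite normr0.
Qed.
Lemma fnorm0 : fnorm 0 = 0.
Proof. by rewrite /fnorm big1// => i _; rewrite fcoef0 normr0. Qed.
Lemma fnorm1 : fnorm 1 <= 1.
Proof. by apply: (le_trans (fnorm_const 1)); rewrite normr1. Qed.
Lemma fnorm_sum I (r : seq I) (P : pred I) (f : I -> fps R) :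
  fnorm (\sum_(i <- r | P i) f i) <= \sum_(i <- r | P i) fnorm (f i).
Proof.
elim/big_rec2: _ => [|i x y _ h]; first by rewrite fnorm0.
by apply: (le_trans (fnormD _ _)); rewrite lerD2l.
Qed.
End norm.

Lemma fnorm_mono a m k : (m <= k)%N -> fnorm m a <= fnorm k a.
Proof.
move=> mk; rewrite /fnorm -(subnKC mk) big_split_ord/= lerDl.
exact: sumr_ge0.
Qed.

Lemma fnormM m a b : fnorm m (a * b) <= fnorm m a * fnorm m b.
Proof.
pose a' := Fps (fun k => `|fcoef a k|); pose b' := Fps (fun k => `|fcoef b k|).
have h : fnorm m (a * b) <= psum (a' * b') m.
  apply: ler_sum => k _; rewrite !fcoefM.
  by apply: (le_trans (ler_norm_sum _ _ _)); apply: ler_sum => i _; rewrite normrM.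
apply: (le_trans h); rewrite psumM mulr_suml; apply: ler_sum => i _.
by apply: ler_wpM2l => //=; apply: fnorm_mono; rewrite leq_subr.
Qed.

Lemma fnormX m a n : fnorm m (a ^+ n) <= fnorm m a ^+ n.
Proof.
elim: n => [|n ih]; first by rewrite !expr0 fnorm1.
by rewrite !exprS (le_trans (fnormM _ _ _))// ler_wpM2l ?fnorm_ge0.
Qed.

Lemma fcoef_le_fnorm m a k : (k < m)%N -> `|fcoef a k| <= fnorm m a.
Proof.
move=> km; rewrite /fnorm (bigD1 (Ordinal km))//= lerDl.
exact: sumr_ge0.
Qed.

Lemma psum_le_fnorm m a : `|psum a m| <= fnorm m a.
Proof. exact: ler_norm_sum. Qed.

Lemma fnorm_X m : fnorm m fps_X <= 1.
Proof.
rewrite /fnorm; case: m => [|[|k]]; rewrite ?big_ord0//.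
  by rewrite big_ord1/= normr0.
by rewrite 2!big_ord_recl/= normr0 normr1 add0r big1 ?addr0// => i _; rewrite normr0.
Qed.

End fps_ring.
Arguments fps_X {R}.

(** * Coefficientwise limits and the exponential of a power series *)

Section fps_limit.
Context (R : realType).
Implicit Types (a b : fps R) (u v : nat -> fps R).

Variant fcvg u a : Prop :=
  Fcvg of forall n, fcoef (u K) n @[K --> \oo] --> fcoef a n.

Lemma fcvg_coef u a n : fcvg u a -> fcoef (u K) n @[K --> \oo] --> fcoef a n.
Proof. by case. Qed.

Lemma fcvg_unique u a b : fcvg u a -> fcvg u b -> a = b.
Proof.
move=> ua ub; apply: fpsP => n.
exact: (cvg_unique (@norm_hausdorff R R^o) (@fcvg_coef _ _ n%N ua) (@fcvg_coef _ _ n%N ub)).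
Qed.

Lemma fcvg_cst a : fcvg (fun=> a) a. Proof. by split=> n; exact: cvg_cst. Qed.

Lemma fcvgD u v a b : fcvg u a -> fcvg v b -> fcvg (fun K => u K + v K) (a + b).
Proof. by move=> ua vb; split=> n; apply: cvgD; exact: fcvg_coef. Qed.

Lemma fcvgM u v a b : fcvg u a -> fcvg v b -> fcvg (fun K => u K * v K) (a * b).
Proof.
move=> ua vb; split=> n; rewrite fcoefM.
under eq_fun do rewrite fcoefM.
by apply: cvg_big => [|i _]; [exact: add_continuous|apply: cvgM; exact: fcvg_coef].
Qed.

Lemma fcvg_shift u a : fcvg u a -> fcvg (fun K => u K.+1) a.
Proof. by move=> ua; split=> n; have := @fcvg_coef _ _ n ua; rewrite -(cvg_shiftS (fun K => fcoef (u K) n)). Qed.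

Lemma fcvg_fnorm m u a B : fcvg u a -> (forall K, fnorm m (u K) <= B) ->
  fnorm m a <= B.
Proof.
move=> ua uB.
have h : fnorm m (u K) @[K --> \oo] --> fnorm m a.
  by apply: cvg_big => [|i _]; [exact: add_continuous|apply: cvg_norm; exact: fcvg_coef].
rewrite -(cvg_lim _ h)//; apply: limr_le; first by apply/cvg_ex; exists (fnorm m a).
by apply: nearW.
Qed.

Lemma series_le_expR (x : R) K : 0 <= x -> series (exp_coeff x) K <= expR x.
Proof.
move=> x0; apply: nondecreasing_cvgn_le; last exact: is_cvg_series_exp_coeff.
apply: nondecreasing_series => n _ _; exact: exp_coeff_ge0.
Qed.

Definition psums (c : nat -> R) a K := \sum_(k < K) fps_const (c k) * a ^+ k.

(** Exponents built from [F - 1] have a nonzero constant term, so each coefficient of the sum is a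
    genuine infinite series; it converges absolutely once |c k| <= 1/k!. *)
Definition fps_entire (c : nat -> R) a :=
  Fps (fun n => limn (fun K => fcoef (psums c a K) n)).

Section entire.
Variable c : nat -> R.
Hypothesis hc : forall k, `|c k| <= k`!%:R^-1.

Lemma psums_fcvg a : fcvg (psums c a) (fps_entire c a).
Proof.
split=> n; rewrite /fps_entire/=.
have -> : (fun K => fcoef (psums c a K) n) =
    series (fun k => c k * fcoef (a ^+ k) n).
  apply/funext => K; rewrite /psums fcoef_sum seriesEord.
  by apply: eq_bigr => k _; rewrite fcoefZ.
apply: (@cvg_dominated _ (exp_coeff (fnorm n.+1 a))).
  exact: is_cvg_series_exp_coeff.
move=> k; rewrite normrM /exp_coeff/= mulrC.
apply: ler_pM => //; apply: le_trans (fnormX _ _ _).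
exact: fcoef_le_fnorm.
Qed.

Lemma fnorm_entire m a : fnorm m (fps_entire c a) <= expR (fnorm m a).
Proof.
apply: (fcvg_fnorm (psums_fcvg a)) => K.
apply: le_trans (series_le_expR K (fnorm_ge0 _ _)).
rewrite /psums; apply: (le_trans (fnorm_sum _ _ _ _)).
rewrite seriesEord; apply: ler_sum => k _.
rewrite fnormZ /exp_coeff/= mulrC; apply: ler_pM => //; rewrite ?fnorm_ge0//.
exact: fnormX.
Qed.

End entire.

Lemma entire_shift c a : (forall k, `|c k| <= k`!%:R^-1) ->
  (forall k, `|c k.+1| <= k`!%:R^-1) ->
  fps_entire c a = fps_const (c 0%N) + a * fps_entire (fun k => c k.+1) a.
Proof.
move=> hc hc'; apply: (fcvg_unique (fcvg_shift (psums_fcvg hc a))).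
have := fcvgD (fcvg_cst (fps_const (c 0%N)))
  (fcvgM (fcvg_cst a) (psums_fcvg hc' a)).
rewrite (_ : (fun K => _) = (fun K => psums c a K.+1))//.
apply/funext => K; rewrite /psums big_ord_recl expr0 mulr1; congr (_ + _).
by rewrite mulr_sumr; apply: eq_bigr => i _; rewrite mulrCA exprS.
Qed.

Opaque fps_entire.

(** [a ^+ j * exp_tail j a] is the Taylor remainder of the exponential after j terms; the explicit
    factor [a ^+ j] supplies the powers of y in the error terms. *)
Definition exp_tail (j : nat) a := fps_entire (fun k => (k + j)`!%:R^-1) a.
Definition fexp a := exp_tail 0 a.

Lemma exp_tail_coef j k : `|(k + j)`!%:R^-1 : R| <= k`!%:R^-1.
Proof.
rewrite ger0_norm ?invr_ge0// lef_pV2 ?posrE ?ltr0n ?fact_gt0//.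
by rewrite ler_nat leq_fact ?leq_addr.
Qed.

Lemma fnorm_exp_tail m j a : fnorm m (exp_tail j a) <= expR (fnorm m a).
Proof. by apply: fnorm_entire => k; exact: exp_tail_coef. Qed.

Lemma exp_tailS j a :
  exp_tail j a = fps_const (j`!%:R^-1) + a * exp_tail j.+1 a.
Proof.
rewrite /exp_tail entire_shift; first 1 last.
- by move=> k; exact: exp_tail_coef.
- by move=> k; rewrite addSnnS; exact: exp_tail_coef.
by under eq_fun do rewrite addSnnS.
Qed.

Lemma fexp1 a : fexp a = 1 + a * exp_tail 1 a.
Proof. by rewrite /fexp exp_tailS fact0 invr1 rmorph1. Qed.

Lemma fexp2 a : fexp a = 1 + a + a ^+ 2 * exp_tail 2 a.
Proof. by rewrite fexp1 exp_tailS invr1 rmorph1; ring. Qed.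

Lemma fexp3 a :
  fexp a = 1 + a + a ^+ 2 * (fps_const 2^-1 + a * exp_tail 3 a).
Proof. by rewrite fexp2 exp_tailS. Qed.

Lemma fexp_fcvg a : fcvg (psums (fun k => k`!%:R^-1) a) (fexp a).
Proof.
rewrite /fexp /exp_tail.
have := psums_fcvg (exp_tail_coef 0) a.
rewrite (_ : (fun k => (k + 0)`!%:R^-1) = (fun k => k`!%:R^-1 : R))//.
by apply/funext => k; rewrite addn0.
Qed.

Lemma fcoef0M a b : fcoef (a * b) 0 = fcoef a 0 * fcoef b 0.
Proof. by rewrite fcoefM big_ord1. Qed.

Lemma fcoef0X a k : fcoef (a ^+ k) 0 = fcoef a 0 ^+ k.
Proof.
by elim: k => [|k ih]; rewrite ?expr0 ?fcoef1// !exprS fcoef0M ih.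
Qed.

Lemma fcoef0_fexp a : fcoef (fexp a) 0 = expR (fcoef a 0).
Proof.
apply: (cvg_unique (@norm_hausdorff R R^o) (@fcvg_coef _ _ 0%N (fexp_fcvg a))).
rewrite (_ : (fun K => _) = series (exp_coeff (fcoef a 0))).
  exact: is_cvg_series_exp_coeff.
apply/funext => K; rewrite /psums fcoef_sum seriesEord.
by apply: eq_bigr => k _; rewrite fcoefZ fcoef0X /exp_coeff/= mulrC.
Qed.

(* Euler's derivation [X d/dX]: [fexp a] is the solution of the linear equation
   [theta Z = theta a * Z] with constant term [expR a_0], whence its addition formula. *)
Definition theta a := Fps (fun n => n%:R * fcoef a n).

Lemma thetaD a b : theta (a + b) = theta a + theta b.
Proof. by apply: fpsP => n; rewrite fcoefD /= mulrDr. Qed.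

Lemma thetaB a b : theta (a - b) = theta a - theta b.
Proof. by apply: fpsP => n; rewrite fcoefB /= mulrBr. Qed.

Lemma theta_const x : theta (fps_const x) = 0.
Proof. by apply: fpsP => -[|n]; rewrite /= ?mul0r ?mulr0. Qed.

Lemma thetaM a b : theta (a * b) = theta a * b + a * theta b.
Proof.
apply: fpsP => n; rewrite fcoefD !fcoefM/= mulr_sumr -big_split/=.
apply: eq_bigr => i _.
have -> : n%:R = i%:R + (n - i)%:R :> R by rewrite -natrD subnKC// -ltnS.
ring.
Qed.

Lemma thetaX a k : theta (a ^+ k.+1) = k.+1%:R * a ^+ k * theta a.
Proof.
elim: k => [|k ih]; first by rewrite expr1 expr0; ring.
by rewrite exprS thetaM ih -[in RHS]natr1 exprS; ring.
Qed.

Lemma theta_fexp a : theta (fexp a) = theta a * fexp a.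
Proof.
apply: (@fcvg_unique (fun K => theta (psums (fun k => k`!%:R^-1) a K.+1))).
  split=> n /=; apply: cvgM; first exact: cvg_cst.
  exact: (@fcvg_coef _ _ n%N (fcvg_shift (fexp_fcvg a))).
have := fcvgM (fcvg_cst (theta a)) (fexp_fcvg a).
rewrite (_ : (fun K => _) =
  (fun K => theta (psums (fun k => k`!%:R^-1) a K.+1)))//.
apply/funext => K; rewrite /psums; elim: K => [|K ih].
  by rewrite big_ord0 mulr0 big_ord1 expr0 mulr1 theta_const.
rewrite big_ord_recr/= mulrDr ih [in RHS]big_ord_recr/= thetaD; congr (_ + _).
rewrite thetaM theta_const mul0r add0r thetaX.
have -> : K`!%:R^-1 = K.+1`!%:R^-1 * K.+1%:R :> R.
  by rewrite factS natrM invfM mulrAC mulVf ?mul1r// pnatr_eq0.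
by rewrite rmorphM rmorph_nat; ring.
Qed.

(** Uniqueness for a linear differential equation: [theta b] has no constant term, so in degree n+1
    the equation expresses (n+1) a_(n+1) through lower coefficients, which vanish by induction. *)
Lemma theta_eq0 a b : fcoef a 0 = 0 -> theta a = theta b * a -> a = 0.
Proof.
move=> a0 ab; apply: fpsP => n; rewrite fcoef0.
elim/ltn_ind: n => -[//|n] ih.
have /(congr1 (fun c => fcoef c n.+1)) := ab.
rewrite fcoefM big1/= ?mul0r//; last first.
  case=> -[|i] /= ltin _; first by rewrite !mul0r.
  by rewrite ih ?mulr0// subSS ltnS leq_subr.
by move/eqP; rewrite mulf_eq0 pnatr_eq0 => /eqP.
Qed.

Lemma fexpD a b : fexp (a + b) = fexp a * fexp b.
Proof.
apply/eqP; rewrite -subr_eq0; apply/eqP.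
apply: (@theta_eq0 _ (a + b)).
  move: (fcoef0_fexp a) (fcoef0_fexp b) (fcoef0_fexp (a + b)).
  move: (fexp a) (fexp b) (fexp (a + b)) => X Y Z hX hY hZ.
  by rewrite fcoefB fcoef0M hX hY hZ fcoefD expRD subrr.
move: (theta_fexp a) (theta_fexp b) (theta_fexp (a + b)).
move: (fexp a) (fexp b) (fexp (a + b)) => X Y Z hX hY hZ.
by rewrite thetaB thetaM hX hY hZ thetaD; ring.
Qed.

Lemma fexp0 : fexp 0 = 1. Proof. by rewrite fexp1 mul0r addr0. Qed.

Lemma fexpMn a n : fexp (n%:R * a) = fexp a ^+ n.
Proof.
elim: n => [|n ih]; first by rewrite mul0r fexp0.
by rewrite -natr1 mulrDl mul1r fexpD ih exprSr.
Qed.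

Lemma fexp_const x : fexp (fps_const x) = fps_const (expR x).
Proof.
apply/eqP; rewrite -subr_eq0; apply/eqP.
apply: (@theta_eq0 _ (fps_const 0)); first by rewrite fcoefB fcoef0_fexp subrr.
by rewrite thetaB theta_fexp !theta_const !mul0r subrr.
Qed.

End fps_limit.
#[global] Opaque fexp exp_tail fps_entire theta.

(** * Smoothing by compound Poisson laws *)

Section poisson_weights.
Context (R : realType).
Variable s : R.
Hypothesis s_gt0 : 0 < s.

Definition poisson_wt (k : nat) : R := expR (- s) * (s ^+ k / k`!%:R).
Local Notation P := poisson_wt.

Lemma poisson_wt_ge0 k : 0 <= P k.
Proof. by rewrite mulr_ge0 ?expR_ge0// divr_ge0// exprn_ge0// ltW. Qed.

Lemma poisson_wtS k : k.+1%:R * P k.+1 = s * P k.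
Proof.
rewrite /P factS natrM exprS; field.
by rewrite pnatr_eq0 -lt0n fact_gt0 addrC natr1 pnatr_eq0.
Qed.

Lemma poisson_wt_sum K : \sum_(k < K) P k <= 1.
Proof.
rewrite -mulr_sumr -[leRHS](expRxMexpNx_1 s) mulrC ler_wpM2r ?expR_ge0//.
by have := series_le_expR K (ltW s_gt0); rewrite seriesEord.
Qed.

Variables (C g : R -> R) (c tau : R).
Hypothesis gC : forall x, C x ^+ 2 = c - g x + g (x - 1) * (x / s).
Hypothesis g_ge0 : forall x, s <= x -> 0 <= g x.
Hypothesis tau_gt0 : 0 < tau.
Hypothesis ctau : c <= tau ^+ 2.
Hypothesis c_ge0 : 0 <= c.

(* The identity [gC] makes the truncated second moment telescope; [C] will be a
   Charlier polynomial, so that P C is a finite difference of the Poisson weights. *)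
Lemma poisson_sqr_sum_eq K : \sum_(k < K.+1) P k * C k%:R ^+ 2 =
  c * (\sum_(k < K.+1) P k) - g K%:R * P K.
Proof.
elim: K => [|K ih]; first by rewrite !big_ord1 gC mul0r; ring.
rewrite big_ord_recr/= ih [in RHS]big_ord_recr/= gC.
have -> : K.+1%:R - 1 = K%:R :> R by rewrite -natr1 addrK.
have h := poisson_wtS K.
have -> : P K = P K.+1 * (K.+1%:R / s).
  by apply: (mulfI (lt0r_neq0 s_gt0)); rewrite -h; field; exact: lt0r_neq0.
by ring.
Qed.

Lemma poisson_sqr_sum K : \sum_(k < K) P k * C k%:R ^+ 2 <= c.
Proof.
pose M := (K + Num.truncn s).+1.
have sM : s <= M%:R.
  by apply/ltW/(lt_le_trans (truncnS_gt _)); rewrite ler_nat ltnS leq_addl.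
apply: (@le_trans _ _ (\sum_(k < M.+1) P k * C k%:R ^+ 2)).
  have KM : (K <= M.+1)%N by rewrite /M -addnS -addnS leq_addr.
  rewrite -(subnKC KM) big_split_ord/= lerDl; apply: sumr_ge0 => i _.
  by rewrite mulr_ge0 ?poisson_wt_ge0// sqr_ge0.
rewrite poisson_sqr_sum_eq.
have := poisson_wt_sum M.+1; have := g_ge0 sM; have := poisson_wt_ge0 M.
move=> PM gM QM; have := mulr_ge0 gM PM; have := ler_wpM2l c_ge0 QM; lra.
Qed.

(** Cauchy-Schwarz in the linearised form |x| <= tau/2 + x^2/(2 tau), which applies term by term to
    truncated sums. *)
Lemma poisson_abs_sum K : \sum_(k < K) `|P k * C k%:R| <= tau.
Proof.
have h k : `|P k * C k%:R| <= P k * (tau / 2) + P k * C k%:R ^+ 2 * (2 * tau)^-1.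
  rewrite normrM (ger0_norm (poisson_wt_ge0 _)) -mulrA -mulrDr.
  apply: ler_wpM2l; first exact: poisson_wt_ge0.
  rewrite -real_normK ?num_real//; set x := `|_|.
  have -> : tau / 2 + x ^+ 2 / (2 * tau) = x + (x - tau) ^+ 2 / (2 * tau).
    by field; exact: lt0r_neq0.
  by rewrite lerDl divr_ge0 ?sqr_ge0// mulr_ge0// ltW.
apply: (@le_trans _ _ (\sum_(k < K)
    (P k * (tau / 2) + P k * C k%:R ^+ 2 * (2 * tau)^-1))).
  by apply: ler_sum => k _; exact: h.
rewrite big_split/= -!mulr_suml.
have -> : tau = 1 * (tau / 2) + tau ^+ 2 * (2 * tau)^-1.
  by field; exact: lt0r_neq0.
have t0 := tau_gt0; apply: lerD.
  have -> : (1 * (tau / 2) + tau ^+ 2 / (2 * tau)) / 2 = tau / 2.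
    by field; exact: lt0r_neq0.
  by rewrite ler_wpM2r ?poisson_wt_sum// divr_ge0// ltW.
have -> : 2 * (1 * (tau / 2) + tau ^+ 2 / (2 * tau)) = 2 * tau.
  by field; exact: lt0r_neq0.
rewrite ler_wpM2r ?invr_ge0 ?mulr_ge0 ?(ltW t0)//.
exact: (le_trans (poisson_sqr_sum K) ctau).
Qed.

End poisson_weights.

Section compound_poisson.
Context (R : realType).
Variable F : fps R.
Hypothesis F0 : fcoef F 0 = 0.
Hypothesis F1 : forall m, fnorm m F <= 1.
Implicit Types c : nat -> R.

Lemma fcoefX_small k i : (i < k)%N -> fcoef (F ^+ k) i = 0.
Proof.
elim: k i => [//|k ih] i ik; rewrite exprS fcoefM big1// => -[[|j] ji] _ /=.
  by rewrite F0 mul0r.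
rewrite ih ?mulr0//; apply: leq_trans (_ : i <= k)%N => //.
by rewrite ltn_subrL/=; exact: leq_ltn_trans (leq0n j) ji.
Qed.

(** Composition of the series with coefficients [c] and [F]: as [F] has no constant term, [F ^+ k]
    starts in degree k and finite sums suffice. *)
Definition fcomp c := Fps (fun i => \sum_(k < i.+1) c k * fcoef (F ^+ k) i).

Lemma fcomp_psums c i K : (i < K)%N -> fcoef (psums c F K) i = fcoef (fcomp c) i.
Proof.
move=> iK; rewrite /psums fcoef_sum [RHS](big_ord_widen K
  (fun k => c k * fcoef (F ^+ k) i))// [RHS]big_mkcond; apply: eq_bigr => k _.
by rewrite fcoefZ; case: ltnP => // ik; rewrite fcoefX_small ?mulr0.
Qed.

Lemma fcomp_fcvg c : fcvg (psums c F) (fcomp c).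
Proof.
split=> n; apply: cvg_near_cst; exists n.+1 => // K /= nK.
by rewrite fcomp_psums.
Qed.

(** Powers of [F] have norm at most 1, so absolute sums of Poisson weights and of their differences
    bound the compound Poisson series, whatever the jump. *)
Lemma fnorm_fcomp m c : fnorm m (fcomp c) <= \sum_(k < m) `|c k|.
Proof.
have -> : fnorm m (fcomp c) = fnorm m (psums c F m).
  by apply: eq_bigr => i _; rewrite fcomp_psums.
apply: (le_trans (fnorm_sum _ _ _ _)); apply: ler_sum => k _.
rewrite fnormZ ler_piMr//; apply: (le_trans (fnormX _ _ _)).
by rewrite exprn_ile1 ?fnorm_ge0.
Qed.

Definition bdiff c k := (if k is k'.+1 then c k' else 0) - c k.

Lemma fcomp_bdiff c : (F - 1) * fcomp c = fcomp (bdiff c).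
Proof.
apply: (@fcvg_unique _ (fun K => psums (bdiff c) F K.+1)); last first.
  exact: (@fcvg_shift _ (psums (bdiff c) F) _ (fcomp_fcvg _)).
have := fcvgD (fcvgM (fcvg_cst F) (fcomp_fcvg c))
  (fcvgM (fcvg_cst (-1)) (fcvg_shift (fcomp_fcvg c))).
rewrite -mulrDl; congr fcvg; apply/funext => K.
rewrite /psums big_ord_recl [in RHS]big_ord_recl !mulrDr !mulr_sumr.
rewrite addrCA -big_split/= rmorphB rmorph0.
congr (_ + _); first by ring.
by apply: eq_bigr => i _; rewrite rmorphB exprS; ring.
Qed.

Lemma fexp_fcomp (s : R) :
  fexp (fps_const s * (F - 1)) = fcomp (poisson_wt s).
Proof.
have -> : fps_const s * (F - 1) = fps_const s * F + fps_const (- s).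
  by rewrite rmorphN; ring.
rewrite fexpD fexp_const; apply: (@fcvg_unique _ (psums (poisson_wt s) F));
  last exact: fcomp_fcvg.
have := fcvgM (fexp_fcvg (fps_const s * F)) (fcvg_cst (fps_const (expR (- s)))).
congr fcvg; apply/funext => K; rewrite /psums mulr_suml; apply: eq_bigr => k _.
by rewrite /poisson_wt !rmorphM exprMn rmorphXn; ring.
Qed.

Lemma fnorm_fexp m s : 0 < s -> fnorm m (fexp (fps_const s * (F - 1))) <= 1.
Proof.
move=> s0; rewrite fexp_fcomp; apply: (le_trans (fnorm_fcomp _ _)).
rewrite (eq_bigr (fun k : 'I_m => poisson_wt s k)) ?poisson_wt_sum// => k _.
by rewrite ger0_norm// poisson_wt_ge0.
Qed.

Lemma fnorm_smooth1 m s : 0 < s ->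
  fnorm m ((F - 1) * fexp (fps_const s * (F - 1))) <= (Num.sqrt s)^-1.
Proof.
move=> s0; have sn0 := lt0r_neq0 s0.
rewrite fexp_fcomp fcomp_bdiff; apply: (le_trans (fnorm_fcomp _ _)).
rewrite (eq_bigr (fun k : 'I_m => `|poisson_wt s k * (k%:R / s - 1)|)).
  (* The first Charlier polynomial, whose second moment under the Poisson law is 1/s. *)
  apply: (poisson_abs_sum s0 (C := fun x => x / s - 1)
    (g := fun x => x / s - 1 + s^-1) (c := s^-1)) => //.
  - by move=> x; field.
  - by move=> x sx; rewrite addr_ge0 ?invr_ge0 ?(ltW s0)// subr_ge0 ler_pdivlMr// mul1r.
  - by rewrite invr_gt0 sqrtr_gt0.
  - by rewrite exprVn sqr_sqrtr// ltW.
  - by rewrite invr_ge0 ltW.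
move=> k _; congr `|_|; case: (val k) => [|j] /=; first by rewrite /bdiff; field.
have h := poisson_wtS s j; rewrite /bdiff.
have -> : poisson_wt s j = poisson_wt s j.+1 * (j.+1%:R / s).
  by apply: (mulfI sn0); rewrite -h; field.
by ring.
Qed.

Lemma fnorm_smooth2 m s : 0 < s ->
  fnorm m ((F - 1) ^+ 2 * fexp (fps_const s * (F - 1))) <= 17 / 12 / s.
Proof.
move=> s0; have sn0 := lt0r_neq0 s0.
rewrite fexp_fcomp expr2 -mulrA !fcomp_bdiff; apply: (le_trans (fnorm_fcomp _ _)).
rewrite (eq_bigr (fun k : 'I_m => `|poisson_wt s k *
    (k%:R * (k%:R - 1) / s ^+ 2 - 2 * k%:R / s + 1)|)).
  (* The second Charlier polynomial, with second moment 2/s^2; 17/12 is a rational number slightly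
     above the square root of 2. *)
  apply: (poisson_abs_sum s0 (C := fun x => x * (x - 1) / s ^+ 2 - 2 * x / s + 1)
    (g := fun x => ((x - s) ^+ 3 + x * (x - s) + 2 * s) / s ^+ 3)
    (c := 2 / s ^+ 2)) => //.
  - by move=> x; field.
  - move=> x sx; rewrite divr_ge0 ?exprn_ge0 ?(ltW s0)//.
    have xs : 0 <= x - s by rewrite subr_ge0.
    rewrite !addr_ge0 ?exprn_ge0// mulr_ge0// ?(ltW s0)//.
    exact: le_trans (ltW s0) sx.
  - by rewrite divr_gt0// divr_gt0.
  - rewrite expr_div_n ler_wpM2r ?invr_ge0 ?exprn_ge0 ?(ltW s0)//.
    by lra.
  - by rewrite divr_ge0// exprn_ge0// ltW.
move=> k _; congr `|_|.
case: (val k) => [|[|j]] /=.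
- by rewrite /bdiff; field.
- have h := poisson_wtS s 0; rewrite /bdiff.
  have -> : poisson_wt s 0 = poisson_wt s 1 / s.
    by apply: (mulfI sn0); rewrite -h; field.
  by field.
- have h := poisson_wtS s j; have h1 := poisson_wtS s j.+1; rewrite /bdiff.
  have -> : poisson_wt s j = poisson_wt s j.+1 * (j.+1%:R / s).
    by apply: (mulfI sn0); rewrite -h; field.
  have -> : poisson_wt s j.+1 = poisson_wt s j.+2 * (j.+2%:R / s).
    by apply: (mulfI sn0); rewrite -h1; field.
  by rewrite -!natr1; field.
Qed.

End compound_poisson.

(** * Smoothing by powers of a perturbed compound Poisson series *)

Section power_smoothing.
Context (R : realType).

Lemma expR1_le3 : expR 1 <= 3 :> R.
Proof.
have h : (7 / 8 : R) <= expR (- 8^-1).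
  by apply: (le_trans _ (expR_ge1Dx _)); lra.
have h8 : (7 / 8 : R) ^+ 8 <= expR (- 1).
  have -> : - 1 = 8%:R * - 8^-1 :> R by field.
  by rewrite expRM_natl lerXn2r ?nnegrE ?expR_ge0//; lra.
have := expR_gt0 (1 : R); have := expRxMexpNx_1 (1 : R).
have : 3^-1 <= (7 / 8 : R) ^+ 8 by lra.
by move: h8; nra.
Qed.

(** k^k/k! is one term of the series of e^k, and e <= 3. This pays for the k^k that appears when a
    Poisson factor is split into k equal parts. *)
Lemma expn_self_le_fact k : (k%:R : R) ^+ k <= 3 ^+ k * k`!%:R.
Proof.
rewrite -ler_pdivrMr ?ltr0n ?fact_gt0//.
apply: (@le_trans _ _ (expR k%:R)).
  apply: le_trans (series_le_expR k.+1 (ler0n _ _)).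
  rewrite seriesEord/= big_ord_recr/= lerDr; apply: sumr_ge0 => i _.
  exact: exp_coeff_ge0.
rewrite -{1}[k%:R]mulr1 expRM_natl lerXn2r ?nnegrE ?expR_ge0//.
exact: expR1_le3.
Qed.

Lemma bin_le_expn n k : 'C(n, k)%:R <= n%:R ^+ k / k`!%:R :> R.
Proof.
rewrite ler_pdivlMr ?ltr0n ?fact_gt0// -natrM -natrX ler_nat bin_ffact.
elim: k => [//|k ih]; by rewrite ffactnSr expnSr leq_mul// leq_subr.
Qed.

(** This is min(1, s^(-1/2)): the smoothing rate, with the trivial bound where s is small. It is the
    origin of max(n qb, 1) in the final estimate. *)
Definition decay (s : R) := (Num.sqrt (Num.max 1 s))^-1.

Lemma decay_gt0 s : 0 < decay s.
Proof. by rewrite invr_gt0 sqrtr_gt0 lt_max ltr01. Qed.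

Lemma decay_le1 s : decay s <= 1.
Proof.
rewrite invf_le1 ?sqrtr_gt0 ?lt_max ?ltr01// -[leLHS]sqrtr1 ler_wsqrtr//.
by rewrite le_max lexx.
Qed.

Lemma decay_scale s t (c : R) : 0 < c -> Num.max 1 t <= c ^+ 2 * Num.max 1 s ->
  decay s <= c * decay t.
Proof.
move=> c0 h; rewrite /decay ler_pdivlMr ?sqrtr_gt0 ?lt_max ?ltr01//.
rewrite mulrC ler_pdivrMr ?sqrtr_gt0 ?lt_max ?ltr01//.
apply: (le_trans (ler_wsqrtr h)).
by rewrite sqrtrM ?sqr_ge0// sqrtr_sqr gtr0_norm.
Qed.

Variable F : fps R.
Hypothesis F0 : fcoef F 0 = 0.
Hypothesis F1 : forall m, fnorm m F <= 1.
Local Notation y := (F - 1).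
Local Notation E s := (fexp (fps_const s * y)).

Lemma fnorm_y m : fnorm m y <= 2.
Proof.
by apply: (le_trans (fnormB _ _ _)); have := F1 m; have := fnorm1 R m; lra.
Qed.

Lemma fexp_pow s n : E s ^+ n = E (n%:R * s).
Proof. by rewrite -fexpMn rmorphM rmorph_nat mulrA. Qed.

Lemma fexp_scaleD s t : E s * E t = E (s + t).
Proof. by rewrite -fexpD rmorphD mulrDl. Qed.

Lemma fnorm_smooth m s : 0 < s -> fnorm m (y * E s) <= 2 * decay s.
Proof.
move=> s0; rewrite /decay; have [s1|s1] := leP s 1.
  rewrite sqrtr1 invr1 mulr1; apply: (le_trans (fnormM _ _ _)).
  rewrite -[leRHS]mulr1; apply: ler_pM; rewrite ?fnorm_ge0//.
    exact: fnorm_y.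
  exact: fnorm_fexp.
apply: (le_trans (fnorm_smooth1 F0 F1 _ s0)).
by rewrite ler_peMl// ?invr_ge0 ?sqrtr_ge0//; lra.
Qed.

(** The exponent s/20 is cut into three parts s/60, enough for j <= 3 factors y. In the constant 16
    = 2 * 8, the 8 comes from 60 <= 8^2. *)
Lemma fnorm_smoothX m s j : 0 < s -> (j <= 3)%N ->
  fnorm m (y ^+ j * E (s / 20)) <= (16 * decay s) ^+ j.
Proof.
move=> s0 j3.
have s60 : 0 < s / 60 by rewrite divr_gt0.
have -> : E (s / 20) = E (s / 60) ^+ 3.
  by rewrite fexp_pow (_ : 3%:R * (s / 60) = s / 20)//; field.
have -> : y ^+ j * E (s / 60) ^+ 3 = (y * E (s / 60)) ^+ j * E (s / 60) ^+ (3 - j).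
  by rewrite exprMn -mulrA -exprD subnKC.
apply: (le_trans (fnormM _ _ _)); rewrite -[leRHS]mulr1.
apply: ler_pM; rewrite ?fnorm_ge0//; apply: (le_trans (fnormX _ _ _)).
  rewrite lerXn2r ?nnegrE ?fnorm_ge0 ?mulr_ge0 ?(ltW (decay_gt0 _))//.
  apply: (le_trans (fnorm_smooth _ s60)).
  have : decay (s / 60) <= 8 * decay s.
    apply: decay_scale => //; rewrite ge_max; apply/andP; split.
      have : 1 <= Num.max 1 (s / 60) by rewrite le_max lexx.
      by lra.
    have : s / 60 <= Num.max 1 (s / 60) by rewrite le_max lexx orbT.
    by lra.
  by lra.
rewrite exprn_ile1 ?fnorm_ge0//; exact: fnorm_fexp.
Qed.

Variables (m : nat) (g : R) (rho : fps R).
Hypothesis g0 : 0 < g.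
Hypothesis hrho : fnorm m rho <= 5^-1.

(* The Poisson factor is split into k equal parts, each of which absorbs one y^2. *)
Lemma fnorm_binomial_term (n k : nat) : (0 < n)%N ->
  fnorm m (E (19 / 20 * (n%:R * g)) *
    ((fps_const g * y ^+ 2 * rho) ^+ k *+ 'C(n, k))) <= (9 / 10) ^+ k.
Proof.
move=> n0; have s0 : 0 < n%:R * g by rewrite mulr_gt0 ?ltr0n.
set s := n%:R * g in s0 *.
case: k => [|k].
  rewrite !expr0 bin0 mulr1n mulr1 fnorm_fexp// mulr_gt0//; lra.
have k0 : 0 < k.+1%:R :> R by rewrite ltr0n.
have -> : E (19 / 20 * s) = E (19 / 20 * s / k.+1%:R) ^+ k.+1.
  rewrite fexp_pow (_ : k.+1%:R * (19 / 20 * s / k.+1%:R) = 19 / 20 * s)//.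
  by field; rewrite nat1r lt0r_neq0.
have sk0 : 0 < 19 / 20 * s / k.+1%:R by rewrite divr_gt0// mulr_gt0//; lra.
set e := E _.
have -> : e ^+ k.+1 * ((fps_const g * y ^+ 2 * rho) ^+ k.+1 *+ 'C(n, k.+1)) =
    fps_const ('C(n, k.+1)%:R * g ^+ k.+1) * ((y ^+ 2 * e) * rho) ^+ k.+1.
  rewrite rmorphM rmorph_nat rmorphXn /= -mulr_natl !exprMn.
  move: (e ^+ k.+1) (y ^+ 2 ^+ k.+1) (rho ^+ k.+1) => a b c; ring.
rewrite fnormZ.
have h1 : fnorm m ((y ^+ 2 * e) * rho) <=
    17 / 12 / (19 / 20 * s / k.+1%:R) * 5^-1.
  apply: (le_trans (fnormM _ _ _)); apply: ler_pM; rewrite ?fnorm_ge0//.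
  exact: fnorm_smooth2.
apply: (@le_trans _ _ ((s ^+ k.+1 / k.+1`!%:R) *
    (17 / 12 / (19 / 20 * s / k.+1%:R) * 5^-1) ^+ k.+1)).
  apply: ler_pM; rewrite ?fnorm_ge0//.
    rewrite ger0_norm ?mulr_ge0 ?exprn_ge0 ?(ltW g0)//.
    rewrite /s exprMn mulrAC ler_wpM2r ?exprn_ge0 ?(ltW g0)//.
    exact: bin_le_expn.
  apply: (le_trans (fnormX _ _ _)). apply: lerXn2r; rewrite ?nnegrE.
  exact: fnorm_ge0. exact: le_trans (fnorm_ge0 _ _) h1. exact: h1.
(* Times the 3 of k^k <= 3^k k!, the ratio 17/57 stays below 9/10; the bound 1/5 on [rho] is chosen
   for this. *)
have -> : 17 / 12 / (19 / 20 * s / k.+1%:R) * 5^-1 =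
    (17 / 57) * (k.+1%:R / s).
  by field; rewrite nat1r !lt0r_neq0.
have f0 : 0 < k.+1`!%:R :> R by rewrite ltr0n fact_gt0.
have -> : s ^+ k.+1 / k.+1`!%:R * (17 / 57 * (k.+1%:R / s)) ^+ k.+1 =
    (17 / 57) ^+ k.+1 * (k.+1%:R ^+ k.+1 / k.+1`!%:R).
  have -> : (17 / 57 * (k.+1%:R / s)) ^+ k.+1 =
      (17 / 57) ^+ k.+1 * (k.+1%:R ^+ k.+1 / s ^+ k.+1).
    by rewrite exprMn (expr_div_n k.+1%:R).
  have : s ^+ k.+1 != 0 by rewrite expf_neq0// lt0r_neq0.
  move: (s ^+ k.+1) (k.+1%:R ^+ k.+1) ((17 / 57) ^+ k.+1) k.+1`!%:R f0.
  by move=> a b c f f0 a0; field; rewrite a0 lt0r_neq0.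
apply: (@le_trans _ _ ((17 / 57) ^+ k.+1 * 3 ^+ k.+1)).
  rewrite ler_wpM2l ?exprn_ge0//.
  by rewrite ler_pdivrMr//; exact: expn_self_le_fact.
by rewrite -exprMn lerXn2r ?nnegrE//; lra.
Qed.

Lemma geometric_sum_le (x : R) n : 0 <= x < 1 -> \sum_(k < n) x ^+ k <= (1 - x)^-1.
Proof.
move=> /andP[x0 x1]; have x1' : 0 < 1 - x by rewrite subr_gt0.
rewrite -[leRHS]mul1r ler_pdivlMr// mulrC.
have := subrX1 x n; have := exprn_ge0 n x0; lra.
Qed.

(** A twentieth of the Poisson exponent is spent on [y ^+ j], the rest on the binomial terms, whose
    norms are summed by a geometric series of ratio 9/10; the factor 10 is its sum. *)
Lemma fnorm_power_smooth n j : (0 < n)%N -> (j <= 3)%N ->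
  fnorm m (y ^+ j * (E g * (1 + fps_const g * y ^+ 2 * rho)) ^+ n) <=
  10 * (16 * decay (n%:R * g)) ^+ j.
Proof.
move=> n0 j3; have s0 : 0 < n%:R * g by rewrite mulr_gt0 ?ltr0n.
rewrite exprMn fexp_pow; set s := n%:R * g in s0 *.
have -> : E s = E (s / 20) * E (19 / 20 * s).
  by rewrite fexp_scaleD (_ : s / 20 + 19 / 20 * s = s)//; field.
rewrite -(mulrA (E (s / 20))) mulrA [10 * _]mulrC; apply: (le_trans (fnormM _ _ _)).
apply: ler_pM; rewrite ?fnorm_ge0//; first exact: fnorm_smoothX.
rewrite exprDn mulr_sumr; apply: (le_trans (fnorm_sum _ _ _ _)).
apply: (@le_trans _ _ (\sum_(k < n.+1) (9 / 10 : R) ^+ k)).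
  apply: ler_sum => k _; rewrite expr1n mul1r; exact: (@fnorm_binomial_term n k n0).
apply: (le_trans (geometric_sum_le _ _)); first by apply/andP; split; lra.
by rewrite (_ : (1 - 9 / 10)^-1 = 10)//; field.
Qed.

End power_smoothing.

(** * Contractions and inverses in the ring of power series *)

Section fixed_point.
Context (R : realType).
Variables (T : fps R -> fps R) (M : R).
Hypothesis M0 : 0 <= M.
Hypothesis TM : forall m x, fnorm m x <= M -> fnorm m (T x) <= M.
Hypothesis Tlip : forall m x x', fnorm m x <= M -> fnorm m x' <= M ->
  fnorm m (T x - T x') <= 3 / 4 * fnorm m (x - x').
Hypothesis Tcont : forall u a, fcvg u a -> fcvg (fun K => T (u K)) (T a).

(** Banach iteration from 0, carried out in all truncated norms at once: the increments decrease
    geometrically, so each coefficient converges, and the bound [M] passes to the limit. *)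
Lemma fps_fixed_point : exists2 x, T x = x & forall m, fnorm m x <= M.
Proof.
pose u K := iter K T 0.
have uM m K : fnorm m (u K) <= M.
  by elim: K => [|K ih]; [rewrite fnorm0|exact: TM].
have du m K : fnorm m (u K.+1 - u K) <= geometric (M + M) (3 / 4) K.
  elim: K => [|K ih]; rewrite /geometric/=.
    by rewrite expr0 mulr1; apply: (le_trans (fnormB _ _ _)); apply: lerD; [exact: (uM m 1%N)|exact: (uM m 0%N)].
  apply: (le_trans (Tlip (uM m K.+1) (uM m K))).
  by rewrite exprS mulrCA ler_wpM2l//; lra.
have telescope n K : fcoef (u K) n = series (fun k => fcoef (u k.+1 - u k) n) K.
  rewrite (_ : series _ K = \sum_(k < K) fcoef (u k.+1 - u k) n);
    last by rewrite seriesEord.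
  elim: K => [|K ih].
    by rewrite big_ord0 /u -(fcoef0 R n).
  by rewrite big_ord_recr -ih/= addrC subrK.
have cu n : cvgn (fun K => fcoef (u K) n).
  rewrite (funext (telescope n)).
  apply: (@cvg_dominated _ (geometric (M + M) (3 / 4))).
    by apply: is_cvg_geometric_series; rewrite ger0_norm; lra.
  move=> k; apply: le_trans (du n.+1 k); exact: fcoef_le_fnorm.
pose x := Fps (fun n => limn (fun K => fcoef (u K) n)).
have ux : fcvg u x by split.
exists x => [|m]; last exact: (fcvg_fnorm ux).
exact: (fcvg_unique (Tcont ux) (fcvg_shift ux)).
Qed.

End fixed_point.

Section fps_inverse.
Context (R : realType).

(** The inverse is the fixed point of x = 1 - a x; the bound 4 is 1/(1 - 3/4). *)
Lemma fps_near1_inv (a : fps R) : (forall m, fnorm m a <= 3 / 4) ->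
  exists2 x, (1 + a) * x = 1 & forall m, fnorm m x <= 4.
Proof.
move=> ha; have [] := @fps_fixed_point R (fun x => 1 - a * x) 4.
- by [].
- move=> m x hx; apply: (le_trans (fnormB _ _ _)).
  have := fnorm1 R m; have := fnormM m a x.
  have := ler_pM (fnorm_ge0 _ _) (fnorm_ge0 _ _) (ha m) hx; lra.
- move=> m x x' _ _; have -> : 1 - a * x - (1 - a * x') = - (a * (x - x')) by ring.
  rewrite fnormN; apply: (le_trans (fnormM _ _ _)).
  by rewrite ler_wpM2r ?fnorm_ge0.
- move=> u b ub.
  have := fcvgD (fcvg_cst 1) (fcvgM (fcvg_cst (- a)) ub).
  rewrite mulNr; congr fcvg; apply/funext => K; ring.
move=> x hx xM; exists x => //; rewrite mulrDl mul1r -[X in X + _]hx; ring.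
Qed.

End fps_inverse.

Section geometric_gf.
Context (R : realType).
Variable p : R.
Hypothesis p01 : 0 <= p < 1.

(** The law of the length of a sojourn of the chain in state 1, with series q X/(1 - p X);
    [geom_gf p - 1] will be the series of [Y]. *)
Definition geom_gf : fps R :=
  Fps (fun k => if k is j.+1 then (1 - p) * p ^+ j else 0).
Local Notation F := geom_gf.

Lemma fnorm_geom_gf m : fnorm m F <= 1.
Proof.
have /andP[p0 p1] := p01.
have h k : `|fcoef F k| = fcoef F k.
  case: k => [|k] /=; first by rewrite normr0.
  by rewrite ger0_norm// mulr_ge0 ?exprn_ge0// subr_ge0 ltW.
rewrite /fnorm; under eq_bigr do rewrite h.
case: m => [|m]; first by rewrite big_ord0.
rewrite big_ord_recl/= add0r.
have -> : \sum_(i < m) (1 - p) * p ^+ i = 1 - p ^+ m.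
  by rewrite -mulr_sumr -[LHS]opprK -mulNr opprB -subrX1 opprB.
by rewrite gerBl exprn_ge0.
Qed.

Lemma geom_gfM : F * (1 - fps_const p * fps_X) = fps_const (1 - p) * fps_X.
Proof.
have -> : F * (1 - fps_const p * fps_X) = F - fps_const p * (fps_X * F) by ring.
apply: fpsP => n; rewrite fcoefB !fcoefZ fcoefXM.
case: n => [|[|n]] /=; first by rewrite !mulr0 subrr.
  by rewrite expr0 !mulr0 subr0.
by rewrite exprS !mulr0; ring.
Qed.

End geometric_gf.

(** * The eigenvalues of the two-state chain *)

Section fnorm_bounds.
Context (R : realType).
Implicit Types (a b : fps R) (x z : R).

Lemma fnormM_le m a b x z : fnorm m a <= x -> fnorm m b <= z ->
  fnorm m (a * b) <= x * z.
Proof.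
move=> ax bz; apply: (le_trans (fnormM _ _ _)); apply: ler_pM => //; exact: fnorm_ge0.
Qed.

Lemma fnormZ_le m x a z : 0 <= x -> fnorm m a <= z -> fnorm m (fps_const x * a) <= x * z.
Proof. by move=> x0 az; rewrite fnormZ ger0_norm// ler_wpM2l. Qed.

Lemma fps_const_inj x a b : x != 0 -> fps_const x * a = fps_const x * b -> a = b.
Proof.
move=> x0 /(congr1 (fun d => fps_const x^-1 * d)); rewrite !mulrA -rmorphM.
by rewrite mulVf// rmorph1 !mul1r.
Qed.

Lemma expR_le_15_14 x : x <= 1 / 15 -> expR x <= 15 / 14.
Proof.
move=> x15; have h : 14 / 15 <= expR (- x) by apply: (le_trans _ (expR_ge1Dx _)); lra.
have := expR_gt0 x; have := expRxMexpNx_1 x; nra.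
Qed.

Lemma fnorm_exp_tail_le m j a x : fnorm m a <= x -> x <= 1 / 15 ->
  fnorm m (exp_tail j a) <= 15 / 14.
Proof.
move=> ax x15; apply: (le_trans (fnorm_exp_tail _ _ _)); apply: expR_le_15_14.
exact: le_trans ax x15.
Qed.

End fnorm_bounds.

(** Turns every norm into a fresh variable, so that [lra] works only with the inequalities placed in
    the goal. *)
Ltac norm_lra :=
  repeat match goal with H : context [fnorm] |- _ => clear H end;
  repeat match goal with H := _ |- _ => clearbody H end;
  repeat match goal with |- context [@fnorm ?R ?m ?a] =>
    move: (@fnorm R m a) => ? end; lra.

(** * From eigenvalue estimates to the difference of n-th powers *)

Section chain_assembly.
Context (R : realType).
Variables (K e qb : R) (m n : nat) (y V2 L2 La EL Q R1 E1 : fps R) (c1 : R).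
Variable t : nat -> R.
Local Notation c := (@fps_const R).
Local Notation N := (fnorm m).

(** EL^n - La^n is y^3 Q times the sum [s] of the n products EL^(n-1-i) La^i. In each product the
    power with the larger exponent, at least (n-1)/2, receives all factors y, hence the hypothesis
    on [maxn]. Two factors y compensate the n terms through n qb t^2 <= 2, and one more yields the
    gain [t n]. *)
Lemma chain_assembly : 1 <= K -> 0 <= e <= 1 -> 0 <= qb ->
  N y <= 2 -> N V2 <= K * e -> N L2 <= 2 / 3 ->
  (forall k j, (j <= 3)%N -> N (y ^+ j * La ^+ k) <= K * t k ^+ j) ->
  (forall k j, (j <= 3)%N -> N (y ^+ j * EL ^+ k) <= K * t k ^+ j) ->
  EL - La = y ^+ 3 * Q -> N Q <= K * (qb * e) ->
  E1 = 1 + c c1 * y * R1 -> `|c1| <= 2 * e -> N R1 <= K -> N E1 <= K ->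
  (forall k, 0 < t k <= 1) -> (2 / 3) ^+ n <= 2 * t n ->
  n%:R * qb * t n ^+ 2 <= 2 ->
  (forall a b, n = (a + b).+1 -> t (maxn a b) <= 2 * t n) ->
  let H := La ^+ n + y * V2 * (L2 ^+ n - La ^+ n) in
  let D := E1 * EL ^+ n in
  let K' := 30 * K ^+ 3 in
  exists V, [/\ H - D = y * V, N V <= K' * e, N (y * V) <= K' * e * t n,
     N H <= K' /\ N D <= K' & N (y * H) <= K' * t n /\ N (y * D) <= K' * t n].
Proof.
move=> K1 /andP[e0 e1] qb0 y2 hV2 hL2 hLa hEL ELLa hQ hE1 hc1 hR1 NE1 ht t23 nqb tmax.
move=> H D K'.
have K0 : 0 <= K by lra.
have /andP[tn0 tn1] := ht n.
set s := \sum_(i < n) EL ^+ (n.-1 - i) * La ^+ i.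
have ELnLa : EL ^+ n - La ^+ n = y ^+ 3 * Q * s.
  rewrite -ELLa /s; case: (n) => [|k]; last by rewrite subrXX.
  by rewrite !expr0 subrr big_ord0 mulr0.
have NLa k : N (La ^+ k) <= K.
  by have := hLa k 0%N isT; rewrite !expr0 mul1r mulr1.
have NEL k : N (EL ^+ k) <= K.
  by have := hEL k 0%N isT; rewrite !expr0 mul1r mulr1.
have NyLa k : N (y * La ^+ k) <= K * t k by have := hLa k 1%N isT; rewrite !expr1.
have NyEL k : N (y * EL ^+ k) <= K * t k by have := hEL k 1%N isT; rewrite !expr1.
have hs j : (j <= 3)%N -> N (y ^+ j * s) <= n%:R * (K ^+ 2 * (2 * t n) ^+ j).
  move=> j3; rewrite /s mulr_sumr; apply: (le_trans (fnorm_sum _ _ _ _)).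
  have -> : n%:R * (K ^+ 2 * (2 * t n) ^+ j) =
      \sum_(i < n) (K ^+ 2 * (2 * t n) ^+ j).
    by rewrite sumr_const card_ord mulr_natl.
  apply: ler_sum => i _.
  have hmax k : t k <= 2 * t n -> K * t k ^+ j * K <= K ^+ 2 * (2 * t n) ^+ j.
    move=> tk; rewrite mulrAC -expr2 ler_wpM2l ?sqr_ge0// lerXn2r// nnegrE.
      by have /andP[/ltW] := ht k.
    by rewrite mulr_ge0// ltW.
  have hn : n = (n.-1 - i + i).+1.
    by case: (n) i => [[]//|k] i /=; rewrite subnK// -ltnS.
  have := tmax _ _ hn; rewrite /maxn; case: ltnP => _ tk.
    apply: le_trans (hmax _ tk).
    have -> : y ^+ j * (EL ^+ (n.-1 - i) * La ^+ i) =
      y ^+ j * La ^+ i * EL ^+ (n.-1 - i) by ring.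
    by apply: fnormM_le; [exact: hLa|exact: NEL].
  apply: le_trans (hmax _ tk); rewrite mulrA.
  by apply: fnormM_le; [exact: hEL|exact: NLa].
have NL2 : N (L2 ^+ n) <= 2 * t n.
  apply: le_trans t23; apply: (le_trans (fnormX _ _ _)).
  by rewrite lerXn2r ?nnegrE ?fnorm_ge0//; lra.
have NL21 : N (L2 ^+ n) <= 2 by lra.
(* One summand per source of error: the second eigenvalue, the factor [E1] of the approximation that
   does not depend on n, and the replacement of [La] by [EL]. A factor y has been taken out of
   each. *)
pose V := V2 * (L2 ^+ n - La ^+ n) - c c1 * (R1 * EL ^+ n) - Q * (y ^+ 2 * s).
have HDV : H - D = y * V.
  rewrite /H /D /V hE1; have -> : La ^+ n = EL ^+ n - y ^+ 3 * Q * s.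
    by rewrite -ELnLa; ring.
  by ring.
have Kn i j : (i <= j)%N -> K ^+ i <= K ^+ j by move=> ij; rewrite ler_weXn2l.
have K23 : K ^+ 2 <= K ^+ 3 by exact: Kn.
have K13 : K <= K ^+ 3 by have := Kn 1%N 3%N isT; rewrite expr1.
have KK : K * K = K ^+ 2 by rewrite expr2.
have K33 : K ^+ 3 = K * K ^+ 2 by rewrite exprS.
have K2e : K ^+ 2 * e <= K ^+ 3 * e by rewrite ler_wpM2r.
have K1e : K * e <= K ^+ 3 * e by rewrite ler_wpM2r.
have K3e : K ^+ 3 * e <= K ^+ 3 by rewrite ler_piMr// exprn_ge0.
have K2t : K ^+ 2 * t n <= K ^+ 3 * t n by rewrite ler_wpM2r// ltW.
have K1t : K * t n <= K ^+ 3 * t n by rewrite ler_wpM2r// ltW.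
have K2et : K ^+ 2 * e * t n <= K ^+ 3 * e * t n by rewrite ler_wpM2r// ltW.
have K1et : K * e * t n <= K ^+ 3 * e * t n by rewrite ler_wpM2r// ltW.
have K3et : K ^+ 3 * e * t n <= K ^+ 3 * t n by rewrite ler_wpM2r// ltW.
have e3 : 0 <= K ^+ 3 * e by rewrite mulr_ge0// exprn_ge0.
have et3 : 0 <= K ^+ 3 * e * t n by rewrite mulr_ge0// ltW.
have t3 : 0 <= K ^+ 3 * t n by rewrite mulr_ge0 ?exprn_ge0// ltW.
have hQs : N (Q * (y ^+ 2 * s)) <= 8 * (K ^+ 3 * e).
  apply: (le_trans (fnormM_le hQ (hs 2%N isT))).
  have -> : K * (qb * e) * (n%:R * (K ^+ 2 * (2 * t n) ^+ 2)) =
    4 * (K ^+ 3 * e) * (n%:R * qb * t n ^+ 2) by ring.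
  have := ler_wpM2l e3 nqb; lra.
have hyQs : N (Q * (y ^+ 3 * s)) <= 16 * (K ^+ 3 * e * t n).
  apply: (le_trans (fnormM_le hQ (hs 3%N isT))).
  have -> : K * (qb * e) * (n%:R * (K ^+ 2 * (2 * t n) ^+ 3)) =
    8 * (K ^+ 3 * e * t n) * (n%:R * qb * t n ^+ 2) by ring.
  have := ler_wpM2l et3 nqb; lra.
have Nc1 a z : N a <= z -> N (c c1 * a) <= 2 * e * z.
  by move=> az; rewrite fnormZ; apply: ler_pM => //; exact: fnorm_ge0.
have a1 := fnormM_le hV2 (NLa n); have a2 := fnormM_le hV2 NL21.
have a3 := fnormM_le hV2 (NyLa n).
have a4 := fnormM_le y2 (fnormM_le hV2 NL2).
exists V; split.
- by [].
- rewrite /V; apply: (le_trans (fnormB _ _ _)).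
  have := fnormB m (V2 * (L2 ^+ n - La ^+ n)) (c c1 * (R1 * EL ^+ n)).
  have := Nc1 _ _ (fnormM_le hR1 (NEL n)).
  have := fnormB m (V2 * L2 ^+ n) (V2 * La ^+ n).
  rewrite -mulrBr /K'; move: a1 a2 hQs; norm_lra.
- have -> : y * V = (y * (V2 * L2 ^+ n) - V2 * (y * La ^+ n))
    - c c1 * (R1 * (y * EL ^+ n)) - Q * (y ^+ 3 * s) by rewrite /V; ring.
  apply: (le_trans (fnormB _ _ _)).
  have := fnormB m (y * (V2 * L2 ^+ n) - V2 * (y * La ^+ n))
    (c c1 * (R1 * (y * EL ^+ n))).
  have := Nc1 _ _ (fnormM_le hR1 (NyEL n)).
  have := fnormB m (y * (V2 * L2 ^+ n)) (V2 * (y * La ^+ n)).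
  rewrite /K'; move: a3 a4 hyQs; norm_lra.
- split.
    have -> : H = La ^+ n + (y * (V2 * L2 ^+ n) - y * (V2 * La ^+ n)).
      by rewrite /H; ring.
    apply: (le_trans (fnormD _ _ _)).
    have := fnormB m (y * (V2 * L2 ^+ n)) (y * (V2 * La ^+ n)).
    have := NLa n; have := fnormM_le y2 a1; have := fnormM_le y2 a2.
    rewrite /K'; norm_lra.
  have := fnormM_le NE1 (NEL n); rewrite -/D /K'; norm_lra.
- split.
    have -> : y * H = y * La ^+ n + (y * (y * (V2 * L2 ^+ n)) - y * (V2 * (y * La ^+ n))).
      by rewrite /H; ring.
    apply: (le_trans (fnormD _ _ _)).
    have := fnormB m (y * (y * (V2 * L2 ^+ n))) (y * (V2 * (y * La ^+ n))).
    have := NyLa n; have := fnormM_le y2 a3; have := fnormM_le y2 a4.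
    rewrite /K'; norm_lra.
  have -> : y * D = E1 * (y * EL ^+ n) by rewrite /D; ring.
  have := fnormM_le NE1 (NyEL n); rewrite /K'; norm_lra.
Qed.

End chain_assembly.


(** * The dominant eigenvalue and its exponential approximation *)

Section chain_root.
Context (R : realType).
Variables (p qb : R).
Hypotheses (p_ge0 : 0 <= p) (p_le : p <= 1 / 2).
Hypotheses (qb_gt0 : 0 < qb) (qb_le : qb <= 1 / 30).
Local Notation q := (1 - p).
Local Notation u := ((q + qb)^-1).
Local Notation g := (gam q qb).
Local Notation c := (@fps_const R).
Local Notation F := (geom_gf p).
Local Notation y := (F - 1).
Local Notation X := (@fps_X R).
Local Notation A := (1 + c p * y).

Ltac bounds := have := p_ge0; have := p_le; have := qb_gt0; have := qb_le;
  move=> ? ? ? ?.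

Lemma qqb_gt0 : 0 < q + qb. Proof. by bounds; lra. Qed.
Let qqb_neq0 : q + qb != 0. Proof. exact: lt0r_neq0 qqb_gt0. Qed.
Let u_gt0 : 0 < u. Proof. by rewrite invr_gt0 qqb_gt0. Qed.

Lemma gamE : g = q * qb * u. Proof. by []. Qed.
Lemma gam_mul : g * (q + qb) = q * qb. Proof. by rewrite gamE divfK. Qed.
Lemma gam_gt0 : 0 < g.
Proof. by bounds; rewrite gamE divr_gt0 ?qqb_gt0// mulr_gt0//; lra. Qed.
Lemma gam_le : g <= qb.
Proof. by bounds; rewrite gamE ler_pdivrMr ?qqb_gt0//; nra. Qed.
Lemma gam_ge : qb <= 2 * g.
Proof. by bounds; rewrite gamE mulrA ler_pdivlMr ?qqb_gt0//; nra. Qed.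
(** Together with the next bound, this constant makes the ball of radius 13/10 stable in [chain_mu]
    and later gives norm at most 1/7 for [chain_eta], small enough for the two perturbation bounds
    1/5. *)
Lemma gamu_le : g * u <= 3 / 50.
Proof.
by bounds; rewrite gamE -!mulrA -invfM mulrA ler_pdivrMr ?mulr_gt0 ?qqb_gt0//; nra.
Qed.
Lemma qbpu_le : qb * p * u <= 1 / 32.
Proof. by bounds; rewrite ler_pdivrMr ?qqb_gt0//; nra. Qed.
Lemma u_le : u <= 2.
Proof. by bounds; rewrite -[leRHS]invrK lef_pV2 ?posrE ?qqb_gt0//; lra. Qed.

Let p01 : 0 <= p < 1. Proof. by bounds; apply/andP; split; lra. Qed.
Let F1 m : fnorm m F <= 1. Proof. exact: fnorm_geom_gf. Qed.
Let y2 m : fnorm m y <= 2. Proof. exact: fnorm_y. Qed.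

Lemma fnorm_A m : fnorm m A <= 1.
Proof.
bounds; have -> : A = c q + c p * F by rewrite rmorphB rmorph1; ring.
apply: (le_trans (fnormD _ _ _)); rewrite fnormZ.
have := fnorm_const m q; have := F1 m; rewrite !ger0_norm ?subr_ge0//; last lra.
have := p_ge0; nra.
Qed.

(** In closed form y is (X - 1)/(1 - p X), and [A] is q/(1 - p X), a geometric law starting at 0.
    Hence y and X - 1 differ by factors of bounded norm in both directions. *)
Lemma yMX : y * (1 - c p * X) = X - 1.
Proof.
by rewrite mulrBl geom_gfM mul1r rmorphB rmorph1; ring.
Qed.

Lemma AMX : A * (1 - c p * X) = c q.
Proof.
have -> : A * (1 - c p * X) = 1 - c p * X + c p * (y * (1 - c p * X)) by ring.
by rewrite yMX rmorphB rmorph1; ring.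
Qed.

(* [1 + g y mu] is the dominant eigenvalue of the transfer matrix. *)
Lemma chain_mu : exists2 mu,
  mu = 1 - (c (g * u) * (y * A * mu ^+ 2) + c (qb * p * u) * (y * mu)) &
  forall m, fnorm m mu <= 13 / 10.
Proof.
have gu0 : 0 <= g * u by rewrite mulr_ge0 ?ltW ?gam_gt0.
have pu0 : 0 <= qb * p * u by rewrite mulr_ge0 ?mulr_ge0// ltW.
have gu := gamu_le; have pu := qbpu_le.
have yA m : fnorm m (y * A) <= 2.
  by rewrite -[leRHS]mulr1; apply: fnormM_le; [exact: y2|exact: fnorm_A].
have [] := @fps_fixed_point R (fun x =>
  1 - (c (g * u) * (y * A * x ^+ 2) + c (qb * p * u) * (y * x))) (13 / 10).
- by lra.
- move=> m x hx; apply: (le_trans (fnormB _ _ _)).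
  have h1 : fnorm m (c (g * u) * (y * A * x ^+ 2)) <= g * u * (2 * (13 / 10 * (13 / 10))).
    by apply: fnormZ_le => //; apply: fnormM_le => //; rewrite expr2; exact: fnormM_le.
  have h2 : fnorm m (c (qb * p * u) * (y * x)) <= qb * p * u * (2 * (13 / 10)).
    by apply: fnormZ_le => //; exact: fnormM_le.
  have := fnormD m (c (g * u) * (y * A * x ^+ 2)) (c (qb * p * u) * (y * x)).
  have := fnorm1 R m; lra.
- move=> m x x' hx hx'.
  have -> : 1 - (c (g * u) * (y * A * x ^+ 2) + c (qb * p * u) * (y * x)) -
     (1 - (c (g * u) * (y * A * x' ^+ 2) + c (qb * p * u) * (y * x'))) =
     - ((c (g * u) * (y * A * (x + x')) + c (qb * p * u) * y) * (x - x')) by ring.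
  rewrite fnormN; apply: fnormM_le => //; apply: (le_trans (fnormD _ _ _)).
  have h1 : fnorm m (c (g * u) * (y * A * (x + x'))) <= g * u * (2 * (13 / 10 + 13 / 10)).
    apply: fnormZ_le => //; apply: fnormM_le => //.
    by apply: (le_trans (fnormD _ _ _)); exact: lerD.
  have h2 : fnorm m (c (qb * p * u) * y) <= qb * p * u * 2.
    exact: fnormZ_le.
  lra.
- move=> v a va.
  have h1 := fcvgM (fcvg_cst (- c (g * u) * y * A)) (fcvgM va va).
  have h2 := fcvgM (fcvg_cst (- c (qb * p * u) * y)) va.
  have := fcvgD (fcvg_cst 1) (fcvgD h1 h2).
  have -> : 1 - (c (g * u) * (y * A * a ^+ 2) + c (qb * p * u) * (y * a)) =
    1 + (- c (g * u) * y * A * (a * a) + - c (qb * p * u) * y * a) by ring.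
  by congr fcvg; apply/funext => K; ring.
by move=> x hx xM; exists x.
Qed.

Variable mu : fps R.
Hypothesis hmu :
  mu = 1 - (c (g * u) * (y * A * mu ^+ 2) + c (qb * p * u) * (y * mu)).
Hypothesis mu_le : forall m, fnorm m mu <= 13 / 10.

Definition chain_eta := c (g * u) * (A * mu ^+ 2) + c (qb * p * u) * mu.
Local Notation eta := chain_eta.
Definition chain_lam := c g * y * mu.
Local Notation lam := chain_lam.
Local Notation Lam := (1 + lam).

Lemma mu_eta : mu = 1 - y * eta.
Proof. by rewrite {1}hmu /eta; ring. Qed.

Lemma lam_eta : lam = c g * y - c g * y ^+ 2 * eta.
Proof. by rewrite /lam {1}mu_eta; ring. Qed.

(** With lam = g y mu and g (q + qb) = q qb, division by g y (q + qb) turns this equation into the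
    fixed point equation of [mu]; the proof goes the opposite way. *)
Lemma lam_quadratic :
  lam ^+ 2 * A + lam * (c qb * A + c q) = c (qb * q) * y.
Proof.
have h : c (q + qb) * mu = c (q + qb) - (c g * (y * A * mu ^+ 2) + c (qb * p) * (y * mu)).
  have -> : g = (q + qb) * (g * u) by rewrite [RHS]mulrC divfK.
  have -> : qb * p = (q + qb) * (qb * p * u) by rewrite [RHS]mulrC divfK.
  by rewrite !(rmorphM _ (q + qb)) {1}hmu; ring.
have h2 : c (g * (q + qb)) = c (q * qb) by rewrite gam_mul.
have -> : lam ^+ 2 * A + lam * (c qb * A + c q) =
   c g * y * (c (q + qb) * mu + (c g * (y * A * mu ^+ 2) + c (qb * p) * (y * mu))).
  by rewrite /lam (rmorphD _ q) (rmorphM _ qb); ring.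
rewrite h subrK; have -> : c g * y * c (q + qb) = c (g * (q + qb)) * y.
  by rewrite (rmorphM _ g); ring.
by rewrite h2 [q * qb]mulrC.
Qed.

(** This is the characteristic equation of the transfer matrix at 1 + lam. It follows from the
    previous one on multiplying by 1 - p X and cancelling q. *)
Lemma lam_quadraticX : lam ^+ 2 + lam * (c qb + 1 - c p * X) = c qb * (X - 1).
Proof.
apply: (@fps_const_inj _ q); first by bounds; rewrite lt0r_neq0//; lra.
have h := lam_quadratic; rewrite -yMX.
have -> : c q * (c qb * (y * (1 - c p * X))) = (c (qb * q) * y) * (1 - c p * X).
  by rewrite rmorphM; ring.
rewrite -h; have h2 := AMX.
have -> : (lam ^+ 2 * A + lam * (c qb * A + c q)) * (1 - c p * X) =
  lam ^+ 2 * (A * (1 - c p * X)) + lam * (c qb * (A * (1 - c p * X)) + c q * (1 - c p * X)).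
  ring.
by rewrite h2; ring.
Qed.

Lemma eta_le m : fnorm m eta <= 1 / 7.
Proof.
have gu0 : 0 <= g * u by rewrite mulr_ge0 ?ltW ?gam_gt0.
have pu0 : 0 <= qb * p * u by rewrite mulr_ge0 ?mulr_ge0// ltW.
apply: (le_trans (fnormD _ _ _)).
have h1 : fnorm m (c (g * u) * (A * mu ^+ 2)) <= g * u * (1 * (13 / 10 * (13 / 10))).
  apply: fnormZ_le => //; apply: fnormM_le; first exact: fnorm_A.
  by rewrite expr2; exact: fnormM_le.
have h2 : fnorm m (c (qb * p * u) * mu) <= qb * p * u * (13 / 10).
  exact: fnormZ_le.
have gu := gamu_le; have pu := qbpu_le; lra.
Qed.

Local Notation G := (c g * y).

Let g30 : g <= 1 / 30. Proof. exact: le_trans gam_le qb_le. Qed.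
Lemma fnorm_G m : fnorm m G <= 2 * g.
Proof. by rewrite [leRHS]mulrC; apply: fnormZ_le; [rewrite ltW ?gam_gt0|exact: y2]. Qed.

Lemma fnorm_1G m : fnorm m (1 + G) <= 1.
Proof.
have -> : 1 + G = c (1 - g) + c g * F by rewrite rmorphB rmorph1; ring.
apply: (le_trans (fnormD _ _ _)); rewrite fnormZ.
have := fnorm_const m (1 - g); have g0 := gam_gt0; have g3 := g30.
rewrite !ger0_norm ?(ltW g0)//; last lra.
have := F1 m; nra.
Qed.

(* Chosen so that [1 + lam = exp(g y) (1 + g y^2 rho)]. *)
Definition chain_rho :=
  c g * (c (2^-1 - 1) + G * c 2^-1 - (1 + G) * (G * exp_tail 3 (- G)))
  - eta * fexp (- G).

Lemma chain_rho_le m : fnorm m chain_rho <= 5^-1.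
Proof.
have g0 := gam_gt0; have g3 := g30; have G2 := fnorm_G m; have G1 := fnorm_1G m.
have NG : fnorm m (- G) <= 2 * g by rewrite fnormN.
have g15 : 2 * g <= 1 / 15 by lra.
have T3 := fnorm_exp_tail_le 3 NG g15.
have T0 : fnorm m (fexp (- G)) <= 15 / 14 := fnorm_exp_tail_le 0 NG g15.
have h1 : fnorm m (c (2^-1 - 1)) <= 2^-1.
  by apply: (le_trans (fnorm_const _ _)); rewrite ler0_norm; lra.
have h2 := fnormM_le G2 (fnorm_const m 2^-1).
have h3 := fnormM_le G1 (fnormM_le G2 T3).
have h4 := fnormM_le (eta_le m) T0.
apply: (le_trans (fnormB _ _ _)).
have h5 : fnorm m (c (2^-1 - 1) + G * c 2^-1 - (1 + G) * (G * exp_tail 3 (- G))) <=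
   2^-1 + 2 * g * 2^-1 + 1 * (2 * g * (15 / 14)).
  apply: (le_trans (fnormB _ _ _)); apply: lerD => //.
  apply: (le_trans (fnormD _ _ _)); apply: lerD.
    exact: h1.
  by move: h2; rewrite ger0_norm.
have h6 := fnormZ_le (ltW g0) h5.
move: h4 h6 (ler_wpM2l (ltW g0) g3); lra.
Qed.

Lemma Lam_exp : Lam = fexp G * (1 + c g * y ^+ 2 * chain_rho).
Proof.
have e0 : fexp G * fexp (- G) = 1 by rewrite -fexpD subrr fexp0.
rewrite /chain_rho; have e3 := fexp3 (- G); have l := lam_eta.
move: (exp_tail 3 (- G)) (fexp G) (fexp (- G)) e0 e3 => T3 E E' e0 e3.
have -> : Lam = E * (Lam * E') by rewrite mulrCA e0 mulr1.
congr (_ * _); rewrite l.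
have -> : (1 + (G - c g * y ^+ 2 * eta)) * E' =
  (1 + G) * E' - c g * y ^+ 2 * eta * E' by ring.
have -> : (1 + G) * E' = (1 + G) * (1 - G + G ^+ 2 * (c 2^-1 - G * T3)).
  by rewrite e3; ring.
by rewrite rmorphB rmorph1; ring.
Qed.

(** [chain_B] = g * [chain_beta] is minus the coefficient of y^2 in log(1 + lam): expanding lam = g
    y - g y^2 eta, it is g times the leading term g u + qb p u of eta, plus g^2/2 from the square of
    g y. This explains the second order term of the compound Poisson measure. *)
Definition chain_beta := g * u + qb * p * u + g / 2.
Definition chain_B := q * qb ^+ 2 / (q + qb) ^+ 2 * (p + q / (q + qb)) + g ^+ 2 / 2.
Local Notation B := chain_B.
Local Notation beta := chain_beta.

Lemma chain_BE : B = g * beta.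
Proof. by rewrite /chain_B /chain_beta gamE; field. Qed.

Lemma beta_ge0 : 0 <= beta.
Proof.
have g0 := gam_gt0; have u0 := ltW u_gt0; have q0 := ltW qb_gt0.
have : 0 <= g * u by rewrite mulr_ge0// ltW.
have : 0 <= qb * p * u by rewrite mulr_ge0// mulr_ge0.
by rewrite /chain_beta; lra.
Qed.

Lemma beta_le : beta <= 11 / 100.
Proof.
have := gamu_le; have := qbpu_le; have := g30; rewrite /chain_beta; lra.
Qed.

Lemma gu_le_qb : g * u <= 2 * qb.
Proof.
have := u_le; have := gam_le; have := ltW gam_gt0; have := u_gt0; have := qb_gt0; nra.
Qed.

Lemma qbpu_le_qbp : qb * p * u <= 2 * (qb * p).
Proof.
have : 0 <= qb * p by rewrite mulr_ge0// ltW.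
have := u_le; nra.
Qed.

Lemma beta_le_qb : beta <= 4 * qb.
Proof.
have := gu_le_qb; have := qbpu_le_qbp; have := gam_le; bounds.
rewrite /chain_beta; nra.
Qed.

Local Notation L := (c g * y - c B * y ^+ 2).
Local Notation EL := (fexp L).

Let B0 : 0 <= B. Proof. by rewrite chain_BE mulr_ge0 ?beta_ge0// ltW// gam_gt0. Qed.

Let B_le : B <= 4 * qb ^+ 2.
Proof.
have := beta_le_qb; have := gam_le; have := gam_gt0; have := beta_ge0.
by rewrite chain_BE; bounds; nra.
Qed.

(** Puts [EL] into the same form exp(g y) (1 + g y^2 rho) as the eigenvalue, so that one smoothing
    estimate serves for both. *)
Definition chain_rhoD := - (c beta * exp_tail 1 (- (c B * y ^+ 2))).

Lemma chain_rhoD_le m : fnorm m chain_rhoD <= 5^-1.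
Proof.
have b0 := beta_ge0; have b1 := beta_le; have Bq := B_le; bounds.
have y4 : fnorm m (y ^+ 2) <= 2 * 2 by rewrite expr2; apply: fnormM_le.
have h : fnorm m (- (c B * y ^+ 2)) <= B * (2 * 2) by rewrite fnormN; apply: fnormZ_le.
rewrite fnormN; apply: (le_trans (fnormZ_le b0 (fnorm_exp_tail_le 1 h _))).
  by move: Bq; nra.
lra.
Qed.

Lemma EL_exp : EL = fexp G * (1 + c g * y ^+ 2 * chain_rhoD).
Proof.
rewrite fexpD; congr (_ * _); rewrite /chain_rhoD fexp1 {1}chain_BE (rmorphM _ g).
by move: (exp_tail _ _) => T; ring.
Qed.

Definition chain_eta1 :=
  c (g * u) * (c p * mu ^+ 2 - eta * (mu + 1)) - c (qb * p * u) * eta.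

Lemma eta_eta1 : eta = c (g * u + qb * p * u) + y * chain_eta1.
Proof.
rewrite /chain_eta1 rmorphD; set e := (X in _ = _ + y * (_ * (_ - X * _) - _)).
have -> : c (g * u) + c (qb * p * u) + y * (c (g * u) * (c p * mu ^+ 2 - e * (mu + 1)) -
   c (qb * p * u) * e) = c (g * u) * (1 + c p * y * mu ^+ 2 - y * e * (mu + 1)) +
   c (qb * p * u) * (1 - y * e) by ring.
rewrite -mu_eta /e.
have <- : 1 - mu = y * eta by rewrite {1}mu_eta; ring.
by rewrite /chain_eta; ring.
Qed.

Definition chain_l := c g - c B * y.
Definition chain_Q :=
  c g * chain_eta1 - c (g * B) + c (B ^+ 2 / 2) * y + chain_l ^+ 3 * exp_tail 3 L.

(** By the choice of [chain_B] the terms of order y and y^2 cancel; [chain_Q] collects the Taylor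
    remainders. *)
Lemma EL_Lam : EL - Lam = y ^+ 3 * chain_Q.
Proof.
have hL : L = y * chain_l by rewrite /chain_l; ring.
rewrite fexp3 lam_eta eta_eta1 /chain_Q.
move: (exp_tail 3 L) chain_eta1 => T e1.
have hB : c B = c g * c (g * u + qb * p * u) + c 2^-1 * c g ^+ 2.
  by rewrite -!rmorphM -rmorphXn -rmorphM -rmorphD chain_BE; congr c;
    rewrite /chain_beta; field.
have hh : c 2^-1 + c 2^-1 = 1 by rewrite -rmorphD -(rmorph1 c); congr c; field.
rewrite (rmorphM _ g B) (rmorphM _ (B ^+ 2)) rmorphXn.
have -> : 1 + L + L ^+ 2 * (c 2^-1 + L * T) =
  1 + L + L ^+ 2 * c 2^-1 + y ^+ 3 * (chain_l ^+ 3 * T) by rewrite hL; ring.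
have -> : c g * c B = (c 2^-1 + c 2^-1) * (c g * c B) by rewrite hh mul1r.
have e : c g * c (g * u + qb * p * u) = c B - c 2^-1 * c g ^+ 2 by rewrite hB; ring.
have -> : c g * y ^+ 2 * (c (g * u + qb * p * u) + y * e1) =
   y ^+ 2 * (c g * c (g * u + qb * p * u)) + c g * y ^+ 3 * e1 by ring.
by rewrite e; ring.
Qed.

Local Notation e := (qb * (p + qb)).

(** The factor p + qb comes from [chain_eta1]: of its terms, one carries p and the others carry eta
    = O(qb), all multiplied by O(qb). The remaining terms of [chain_Q] are at least cubic in qb,
    hence O(qb e). *)
Lemma chain_Q_le m : fnorm m chain_Q <= 100 * (qb * e).
Proof.
bounds; have g0 := gam_gt0; have gq := gam_le; have guq := gu_le_qb.
have pq := qbpu_le_qbp; have Bq := B_le.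
have gu0 : 0 <= g * u by rewrite mulr_ge0 ?ltW.
have pu0 : 0 <= qb * p * u by rewrite mulr_ge0 ?mulr_ge0// ltW.
have M1 : fnorm m (mu + 1) <= 23 / 10.
  by apply: (le_trans (fnormD _ _ _)); have := mu_le m; have := fnorm1 R m; lra.
have M2 : fnorm m (mu ^+ 2) <= 13 / 10 * (13 / 10) by rewrite expr2; apply: fnormM_le.
have etaq : fnorm m eta <= 5 * qb.
  have h1 := fnormZ_le gu0 (fnormM_le (fnorm_A m) M2).
  have h2 := fnormZ_le pu0 (mu_le m).
  apply: (le_trans (fnormD _ _ _)); apply: (le_trans (lerD h1 h2)).
  by move: guq pq; nra.
have he1 : fnorm m chain_eta1 <= 40 * e.
  have h1 := fnormZ_le p_ge0 M2; have h2 := fnormM_le etaq M1.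
  have h3 := fnormZ_le gu0 (le_trans (fnormB _ _ _) (lerD h1 h2)).
  have h4 := fnormZ_le pu0 etaq.
  apply: (le_trans (fnormB _ _ _)); apply: (le_trans (lerD h3 h4)).
  have := ler_wpM2r p_ge0 guq; have := ler_wpM2r (ltW qb_gt0) guq.
  have := ler_wpM2r (ltW qb_gt0) pq.
  have : 0 <= qb * p by rewrite mulr_ge0// ltW.
  move=> x1 x2 x3 x4; have x5 := ler_wpM2l x1 qb_le.
  have x6 := sqr_ge0 qb; move: x2 x3 x4 x5; rewrite expr2 in x6; lra.
have hl : fnorm m chain_l <= 2 * qb.
  have h1 := fnormZ_le B0 (y2 m); have h2 := fnorm_const m g.
  apply: (le_trans (fnormB _ _ _)); apply: (le_trans (lerD h2 h1)).
  rewrite ger0_norm ?(ltW g0)//; nra.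
have hL : fnorm m L <= 2 * (2 * qb).
  have -> : L = y * chain_l by rewrite /chain_l; ring.
  exact: fnormM_le.
have T3 : fnorm m (exp_tail 3 L) <= 2.
  apply: (le_trans (fnorm_exp_tail _ _ _)).
  have h : 13 / 15 <= expR (- fnorm m L).
    by apply: (le_trans _ (expR_ge1Dx _)); lra.
  have := expR_gt0 (fnorm m L); have := expRxMexpNx_1 (fnorm m L); nra.
have h1 := fnormZ_le (ltW g0) he1.
have h2 := fnorm_const m (g * B).
have h3 := fnormZ_le (_ : 0 <= B ^+ 2 / 2) (y2 m).
have h4 : fnorm m (chain_l ^+ 3) <= (2 * qb) ^+ 3.
  by apply: (le_trans (fnormX _ _ _)); rewrite lerXn2r ?nnegrE ?fnorm_ge0//; lra.
have h5 := fnormM_le h4 T3.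
apply: (le_trans (fnormD _ _ _)); apply: le_trans (lerD _ h5) _.
  apply: (le_trans (fnormD _ _ _)); apply: lerD (h3 _).
    apply: (le_trans (fnormB _ _ _)); exact: lerD h1 h2.
  by rewrite divr_ge0// sqr_ge0.
rewrite (ger0_norm (mulr_ge0 (ltW g0) B0)).
have qp : 0 <= qb * p by rewrite mulr_ge0// ltW.
have q0 := ltW qb_gt0.
have e0 : 0 <= e by rewrite mulrDr addr_ge0// mulr_ge0.
have x1 : g * (40 * e) <= qb * (40 * e) by rewrite ler_wpM2r// mulr_ge0.
have x2 : g * B <= qb * (4 * qb ^+ 2) by apply: ler_pM => //; exact: ltW.
have x3 : B * B <= 4 * qb ^+ 2 * (4 * qb ^+ 2) by apply: ler_pM.
have x4 : qb * qb * qb * qb <= 1 / 30 * (qb * qb * qb).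
  by rewrite [leRHS]mulrC ler_wpM2l// !mulr_ge0.
have x5 : 0 <= qb * qb * p by rewrite -mulrA mulr_ge0.
have x6 : 0 <= qb * qb * qb by rewrite !mulr_ge0.
move: x1 x2 x3 x4 x5 x6; lra.
Qed.

End chain_root.

(** * Uniform estimates for a single chain *)

Section chain_estimates.
Context (R : realType).
Local Notation c := (@fps_const R).
Local Notation X := (@fps_X R).

Lemma decay0 : decay (0 : R) = 1.
Proof. by rewrite /decay max_l// sqrtr1 invr1. Qed.

Lemma max1_le (x z : R) : 1 <= z -> x <= z -> Num.max 1 x <= z.
Proof. by move=> z1 xz; rewrite ge_max z1 xz. Qed.

Lemma ge_max1 (x : R) : 1 <= Num.max 1 x /\ x <= Num.max 1 x.
Proof. by rewrite !le_max !lexx orbT. Qed.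

Lemma decay_sqr (s : R) : decay s ^+ 2 = (Num.max 1 s)^-1.
Proof.
have [m1 _] := ge_max1 s.
by rewrite /decay exprVn sqr_sqrtr// (le_trans ler01).
Qed.

Lemma pow23_le n : (2 / 3) ^+ n * (n%:R + 2) <= 2 :> R.
Proof.
elim: n => [|n ih]; first by rewrite expr0; lra.
apply: le_trans ih; rewrite exprSr -mulrA ler_wpM2l ?exprn_ge0//.
by rewrite -natr1; have := ler0n R n; lra.
Qed.

(** Powers of the second eigenvalue do not smooth, but its norm is at most 2/3, so they are smaller
    than the smoothing rate itself. *)
Lemma pow23_decay (g : R) n : 0 <= g <= 1 -> (2 / 3) ^+ n <= 2 * decay (n%:R * g).
Proof.
move=> /andP[g0 g1]; have n0 := ler0n R n.
apply: (@le_trans _ _ (2 / (n%:R + 2))).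
  by rewrite ler_pdivlMr ?pow23_le//; lra.
rewrite ler_wpM2l// lef_pV2 ?posrE; [|lra|by rewrite sqrtr_gt0 lt_max ltr01].
have -> : n%:R + 2 = Num.sqrt ((n%:R + 2) ^+ 2) :> R by rewrite sqrtr_sqr ger0_norm; lra.
apply: ler_wsqrtr; apply: max1_le; nra.
Qed.

Lemma decay_maxn (g : R) a b n : 0 <= g <= 1 -> n = (a + b).+1 ->
  decay ((maxn a b)%:R * g) <= 2 * decay (n%:R * g).
Proof.
move=> /andP[g0 g1] ->; apply: decay_scale => //.
have [m1 m2] := ge_max1 ((maxn a b)%:R * g).
apply: max1_le; first by lra.
have h : ((a + b).+1%:R : R) <= 2 * (maxn a b)%:R + 1.
  rewrite -natr1 lerD2r natrD mulr_natl mulr2n.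
  by apply: lerD; rewrite ler_nat ?leq_maxl ?leq_maxr.
have := ler_wpM2r g0 h; lra.
Qed.

Section two_roots.
Variables (P Q0 La L2 W : fps R).

Lemma two_term_recurrence (h : nat -> fps R) n :
  h 0%N = 1 -> h 1%N = La + W * (L2 - La) ->
  (forall k, h k.+2 = P * h k.+1 - Q0 * h k) ->
  La ^+ 2 = P * La - Q0 -> L2 = P - La ->
  h n = La ^+ n + W * (L2 ^+ n - La ^+ n).
Proof.
move=> h0 h1 hS hLa hL2.
suff : h n = La ^+ n + W * (L2 ^+ n - La ^+ n) /\
  h n.+1 = La ^+ n.+1 + W * (L2 ^+ n.+1 - La ^+ n.+1) by case.
elim: n => [|n [ih1 ih2]]; first by rewrite h0 h1 !expr0 !expr1; split => //; ring.
split=> //; rewrite hS ih1 ih2.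
have e1 : La ^+ n.+2 = La ^+ n * La ^+ 2 by rewrite -exprD addn2.
have e2 : L2 ^+ n.+2 = L2 ^+ n * L2 ^+ 2 by rewrite -exprD addn2.
have hL22 : L2 ^+ 2 = P * L2 - Q0.
  have -> : Q0 = P * La - La ^+ 2 by rewrite hLa; ring.
  by rewrite hL2; ring.
by rewrite e1 e2 hLa hL22 !exprS; ring.
Qed.

End two_roots.

Lemma chain_estimates : exists2 K : R, 1 <= K &
  forall (p qb : R) (n m : nat) (h : nat -> fps R),
  0 <= p -> p <= 1 / 2 -> 0 < qb -> qb <= 1 / 30 ->
  h 0%N = 1 -> h 1%N = c (1 - qb) + c qb * X ->
  (forall k, h k.+2 = (c (1 - qb) + c p * X) * h k.+1 - c (p - qb) * X * h k) ->
  let q := 1 - p in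
  let y := geom_gf p - 1 in
  let D := fexp (c (gam q qb * (qb - p) / (q + qb) + n%:R * gam q qb) * y
    - c (n%:R * (q * qb ^+ 2 / (q + qb) ^+ 2 * (p + q / (q + qb))
         + gam q qb ^+ 2 / 2)) * y ^+ 2) in
  let e := qb * (p + qb) in
  let t := decay (n%:R * qb) in
  exists V, [/\ h n - D = (X - 1) * V, fnorm m V <= K * e,
    fnorm m (h n - D) <= K * e * t,
    fnorm m (h n) <= K /\ fnorm m D <= K
    & fnorm m ((X - 1) * h n) <= K * t /\ fnorm m ((X - 1) * D) <= K * t].
Proof.
(* The largest smoothing constant 10 * 16^j for j <= 3; it also dominates the other constants
   below. *)
pose K : R := 10 * 16 ^+ 3.
have K1 : 1 <= K by rewrite /K; lra.
have K100 : 100 <= K by rewrite /K; lra.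
have K16 j : (j <= 3)%N -> 10 * 16 ^+ j <= K.
  by move=> j3; rewrite /K ler_wpM2l// ler_weXn2l//; lra.
clearbody K; have [K' hK'] : exists K', 30 * K ^+ 3 = K' by exists (30 * K ^+ 3).
have K'1 : 1 <= K' by rewrite -hK'; have := exprn_ege1 3 K1; lra.
(* One factor 2 replaces n g by n qb inside [decay], the other passes from y to X - 1. *)
exists (4 * K'); first by lra.
move=> p qb n m h p0 p2 qb0 qb30 h0 h1 hS q y D e t.
set g := gam q qb.
have g0 : 0 < g := gam_gt0 p0 p2 qb0 qb30.
have gqb : g <= qb := gam_le p0 p2 qb0 qb30.
have qbg : qb <= 2 * g := gam_ge p0 p2 qb0 qb30.
have p01 : 0 <= p < 1 by apply/andP; split; lra.
have e0 : 0 <= e by rewrite /e mulr_ge0//; lra.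
pose c1 := g * (qb - p) / (q + qb).
have qqb0 : 0 < q + qb := qqb_gt0 p0 p2 qb0 qb30.
have c1e : c1 = g / (q + qb) * (qb - p) by rewrite /c1 mulrAC.
have gu0 : 0 <= g / (q + qb) by rewrite divr_ge0// ltW.
have gu2 : g / (q + qb) <= 2 * qb := gu_le_qb p0 p2 qb0 qb30.
have qp : `|qb - p| <= p + qb by rewrite ler_norml; apply/andP; split; lra.
have c1le : `|c1| <= 2 * e.
  rewrite c1e normrM (ger0_norm gu0) /e mulrA.
  by apply: ler_pM => //; exact: normr_ge0.
have gu3 : g / (q + qb) <= 3 / 50 := gamu_le p0 p2 qb0 qb30.
have c130 : `|c1| * 2 <= 1 / 15.
  have qp2 : `|qb - p| <= 1 / 2 by rewrite ler_norml; apply/andP; split; lra.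
  rewrite c1e normrM (ger0_norm gu0); have := ler_pM gu0 (normr_ge0 _) gu3 qp2; lra.
have g01 : 0 <= g <= 1 by apply/andP; split; lra.
have e01 : 0 <= e <= 1 by rewrite e0 /e; nra.
have nt : n%:R * qb * decay (n%:R * g) ^+ 2 <= 2.
  rewrite decay_sqr; have [m1 m2] := ge_max1 (n%:R * g).
  rewrite ler_pdivrMr; last by lra.
  have := ler_wpM2l (ler0n R n) qbg; lra.
have q0 : 0 < q by rewrite /q; lra.
have dt : decay (n%:R * g) <= 2 * t.
  apply: decay_scale => //; have [m1 m2] := ge_max1 (n%:R * g).
  apply: max1_le; first by lra.
  have := ler_wpM2l (ler0n R n) qbg; lra.
have q2 : q^-1 <= 2 by rewrite -[leRHS]invrK lef_pV2 ?posrE// /q; lra.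
have p12 : 1 + p <= 2 by lra.
have K'0 : 0 <= K' by lra.
have t0 : 0 < t by exact: decay_gt0.
have K'e : 0 <= K' * e by rewrite mulr_ge0.
have r1 : 2 * (K' * e) <= 4 * K' * e by lra.
have r2 : K' * e * decay (n%:R * g) <= 4 * K' * e * t.
  by apply: (le_trans (ler_wpM2l K'e dt)); have := mulr_ge0 K'e (ltW t0); lra.
have r3 : K' <= 4 * K' by lra.
have r4 : 2 * (K' * decay (n%:R * g)) <= 4 * K' * t.
  by have := ler_wpM2l K'0 dt; have := mulr_ge0 K'0 (ltW t0); lra.
have K15 : 15 / 14 <= K by lra.
have [mu hmu muM] := chain_mu p0 p2 qb0 qb30.
have F1 : forall k, fnorm k (geom_gf p) <= 1 by move=> k; exact: fnorm_geom_gf.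
have F0 : fcoef (geom_gf p) 0 = 0 by [].
have y2 : fnorm m y <= 2 by exact: fnorm_y.
set lam := chain_lam p qb mu; pose La := 1 + lam.
set B := chain_B p qb; pose EL := fexp (c g * y - c B * y ^+ 2).
have lamq : lam ^+ 2 + lam * (c qb + 1 - c p * X) = c qb * (X - 1).
  exact: (lam_quadraticX p0 p2 qb0 qb30 hmu).
have lamN k : fnorm k lam <= g * (2 * (13 / 10)).
  rewrite /lam /chain_lam -mulrA; apply: fnormZ_le; first exact: ltW.
  by apply: fnormM_le => //; exact: fnorm_y.
have pX k : fnorm k (c p * X) <= p by have := fnormZ_le p0 (fnorm_X R k); rewrite mulr1.
have cq k : fnorm k (c qb) <= qb.
  by apply: (le_trans (fnorm_const _ _)); rewrite ger0_norm// ltW.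
(* The series inverted here is the difference La - L2 of the two eigenvalues; its distance to 1 is
   at most qb + p + 2 ||lam|| <= 3/4. *)
have [x hx xM] : exists2 x, (1 + (c qb - c p * X + (lam + lam))) * x = 1 &
    forall k, fnorm k x <= 4.
  apply: fps_near1_inv => k.
  have := fnormD k (c qb - c p * X) (lam + lam); have := fnormD k lam lam.
  have := fnormB k (c qb) (c p * X); have := lamN k; have := pX k; have := cq k.
  move: (fnorm _ _) (fnorm _ _) (fnorm _ _) (fnorm _ _) (fnorm _ _) (fnorm _ _).
  by move=> *; lra.
pose s := lam + (c qb - c p * X).
(* The weight of the second eigenvalue is (h 1 - La)/(L2 - La), and h 1 - La = lam * s by the
   characteristic equation. Since lam contains the factor y, so does the weight; [V2] is the
   cofactor. *)
pose V2 := - (c g * (mu * s * x)).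
pose L2 := c (1 - qb) + c p * X - La.
have hn : h n = La ^+ n + y * V2 * (L2 ^+ n - La ^+ n).
  apply: (@two_term_recurrence (c (1 - qb) + c p * X) (c (p - qb) * X)) => //.
  - rewrite h1.
    have -> : La + y * V2 * (L2 - La) =
        La + (lam * s) * ((1 + (c qb - c p * X + (lam + lam))) * x).
      have -> : y * V2 = - (lam * s * x).
        by rewrite /V2 (_ : lam = c g * y * mu)//; ring.
      by rewrite /L2 /La rmorphB rmorph1; ring.
    rewrite hx mulr1 /La.
    have -> : 1 + lam + lam * s = 1 + (lam ^+ 2 + lam * (c qb + 1 - c p * X)).
      by rewrite /s; ring.
    by rewrite lamq rmorphB rmorph1; ring.
  - have -> : La ^+ 2 = 1 + lam - lam * (c qb - c p * X) +
      (lam ^+ 2 + lam * (c qb + 1 - c p * X)) by rewrite /La; ring.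
    by rewrite lamq /La !rmorphB rmorph1; ring.
have V2N : fnorm m V2 <= K * e.
  have sN : fnorm m s <= g * (2 * (13 / 10)) + (qb + p).
    apply: (le_trans (fnormD _ _ _)); apply: lerD => //.
    by apply: (le_trans (fnormB _ _ _)); exact: lerD.
  rewrite fnormN; apply: (le_trans (fnormZ_le (ltW g0)
    (fnormM_le (fnormM_le (muM m) sN) (xM m)))).
  apply: (@le_trans _ _ (100 * e)); last by rewrite ler_wpM2r.
  by rewrite /e; clear - p0 p2 qb0 qb30 g0 gqb; nra.
have L2N : fnorm m L2 <= 2 / 3.
  have -> : L2 = c p * X - (c qb + lam) by rewrite /L2 /La rmorphB rmorph1; ring.
  apply: (le_trans (fnormB _ _ _)).
  have := fnormD m (c qb) lam; have := lamN m; have := pX m; have := cq m.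
  by move: (fnorm _ _) (fnorm _ _) (fnorm _ _) (fnorm _ _) => *; lra.
have smooth (rho : fps R) k j : fnorm m rho <= 5^-1 -> (j <= 3)%N ->
    fnorm m (y ^+ j * (fexp (c g * y) * (1 + c g * y ^+ 2 * rho)) ^+ k) <=
    K * decay (k%:R * g) ^+ j.
  move=> rhoN j3.
  case: (posnP k) => [->|k0].
    rewrite expr0 mulr1 mul0r decay0 expr1n mulr1; apply: le_trans (K16 _ j3).
    apply: (le_trans (fnormX _ _ _)); rewrite -[leLHS]mul1r ler_pM ?exprn_ge0 ?fnorm_ge0//.
      by lra.
    by rewrite lerXn2r ?nnegrE ?fnorm_ge0//; lra.
  apply: (le_trans (fnorm_power_smooth F0 F1 g0 rhoN k0 j3)).
  by rewrite exprMn mulrA; apply: ler_wpM2r;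
    [rewrite exprn_ge0// ltW// decay_gt0|exact: K16].
have LaE := Lam_exp hmu; have ELE := EL_exp p0 p2 qb0 qb30.
have hLa k j : (j <= 3)%N -> fnorm m (y ^+ j * La ^+ k) <= K * decay (k%:R * g) ^+ j.
  move=> j3; rewrite /La /lam LaE; apply: smooth => //.
  exact: (chain_rho_le p0 p2 qb0 qb30 muM).
have hEL k j : (j <= 3)%N -> fnorm m (y ^+ j * EL ^+ k) <= K * decay (k%:R * g) ^+ j.
  move=> j3; rewrite /EL ELE; apply: smooth => //.
  exact: (chain_rhoD_le p0 p2 qb0 qb30).
have c1y : fnorm m (c c1 * y) <= 1 / 15.
  by rewrite fnormZ; apply: le_trans c130; rewrite ler_wpM2l.
pose R1 := exp_tail 1 (c c1 * y).
have R1N : fnorm m R1 <= 15 / 14 by apply: fnorm_exp_tail_le c1y _.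
have E1N : fnorm m (fexp (c c1 * y)) <= 15 / 14.
  exact: (@fnorm_exp_tail_le _ m 0 _ _ c1y).
have DE : D = fexp (c c1 * y) * EL ^+ n.
  rewrite /EL -fexpMn -fexpD /D -/g -/c1; congr fexp.
  rewrite [n%:R * (_ + _)](_ : _ = n%:R * B)//.
  by rewrite rmorphD (rmorphM _ n%:R g) (rmorphM _ n%:R B) !rmorph_nat; ring.
have QN : fnorm m (chain_Q p qb mu) <= K * (qb * e).
  apply: (le_trans (chain_Q_le p0 p2 qb0 qb30 muM m)).
  by rewrite ler_wpM2r// mulr_ge0// ltW.
have ht k : 0 < decay (k%:R * g) <= 1 by rewrite decay_gt0 decay_le1.
have AX : (1 + c p * y) * (1 - c p * X) = c q := AMX p.
have yX : y * (1 - c p * X) = X - 1 := yMX p.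
have AN : fnorm m (1 + c p * y) <= 1 := fnorm_A p0 p2 qb0 qb30 m.
have qAN : fnorm m (c q^-1 * (1 + c p * y)) <= 2.
  apply: (le_trans (fnormZ_le _ AN)); first by rewrite invr_ge0 ltW.
  by rewrite mulr1.
have XN a z : fnorm m (y * a) <= z -> fnorm m ((X - 1) * a) <= 2 * z.
  move=> az; rewrite -yX mulrAC mulrC; apply: fnormM_le => //.
  exact: le_trans (fnormB _ _ _) (le_trans (lerD (fnorm1 R m) (pX m)) p12).
have [V [HD VN yVN [HN DN] [yH yD]]] := chain_assembly K1 e01 (ltW qb0) y2 V2N L2N hLa hEL
  (EL_Lam p0 p2 qb0 qb30 hmu) QN (fexp1 _) c1le (le_trans R1N K15)
  (le_trans E1N K15) ht (pow23_decay n g01) nt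
  (fun a b => @decay_maxn g a b n g01).
rewrite -hn -DE in HD HN yH; rewrite hK' in VN yVN HN DN yH yD.
have DN' : fnorm m D <= K' by rewrite DE.
have yD' : fnorm m (y * D) <= K' * decay (n%:R * g) by rewrite DE.
(* q^-1 (1 + p y) is the inverse of 1 - p X, which converts the factor y into X - 1. *)
exists (c q^-1 * (1 + c p * y) * V); split.
- rewrite HD -yX.
  have -> : y * (1 - c p * X) * (c q^-1 * (1 + c p * y) * V) =
    c q^-1 * ((1 + c p * y) * (1 - c p * X)) * (y * V) by ring.
  by rewrite AX -rmorphM mulVf ?rmorph1 ?mul1r// lt0r_neq0.
- exact: le_trans (fnormM_le qAN VN) r1.
- by rewrite HD; exact: le_trans yVN r2.
- by split; [exact: le_trans HN r3|exact: le_trans DN' r3].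
- by split; [exact: le_trans (XN _ _ yH) r4|exact: le_trans (XN _ _ yD') r4].
Qed.

End chain_estimates.

(** * Uniqueness of Fourier-Stieltjes transforms *)

Section charge_integral_theory.
Context (R : realType).
Local Notation mR := (measurableTypeR R).
Implicit Types (M : smeasure R) (f g : mR -> R).

Definition bmeasurable f (B : R) := measurable_fun setT f /\ forall x, `|f x| <= B.

Lemma bmeasurable_integrable (m : {finite_measure set mR -> \bar R}) f B :
  bmeasurable f B -> m.-integrable setT (EFin \o f).
Proof.
move=> [mf fB]; apply: measurable_bounded_integrable => //.
  by rewrite ltey_eq fin_num_measure.
by exists B; split; [exact: num_real|move=> z Bz x _ /=; exact: le_trans (fB x) (ltW Bz)].
Qed.

Lemma bmeasurableD f g B C : bmeasurable f B -> bmeasurable g C ->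
  bmeasurable (fun x => f x + g x) (B + C).
Proof.
move=> [mf fB] [mg gC]; split; first exact: measurable_funD.
by move=> x; rewrite (le_trans (ler_normD _ _))// lerD.
Qed.

Lemma bmeasurableZ f B (k : R) : bmeasurable f B ->
  bmeasurable (fun x => k * f x) (`|k| * B).
Proof.
move=> [mf fB]; split; first by apply: measurable_funM => //; exact: measurable_cst.
by move=> x; rewrite normrM ler_wpM2l.
Qed.

Lemma bmeasurable_cst (k : R) : bmeasurable (cst k) `|k|.
Proof. by split; first exact: measurable_cst. Qed.

Lemma bmeasurable_comp f B (h : mR -> mR) : measurable_fun setT h ->
  bmeasurable f B -> bmeasurable (fun x => f (h x)) B.
Proof. by move=> mh [mf fB]; split=> [|x]; [exact: measurableT_comp|exact: fB]. Qed.

Lemma bmeasurable_cvg (f_ : nat -> mR -> R) f B :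
  (forall n, bmeasurable (f_ n) B) -> (forall x, f_ n x @[n --> \oo] --> f x) ->
  bmeasurable f B.
Proof.
move=> fB ff; split.
  by apply: (@measurable_fun_cvg _ _ _ _ f_) => [n|x _]; [case: (fB n)|exact: ff].
move=> x; have h : `|f_ n x| @[n --> \oo] --> `|f x| by apply: cvg_norm; exact: ff.
rewrite -(cvg_lim _ h)//; apply: limr_le; first by apply/cvg_ex; exists `|f x|.
by apply: nearW => n; case: (fB n).
Qed.

Lemma Rintegral_dominated_cvg (m : {finite_measure set mR -> \bar R})
  (f_ : nat -> mR -> R) f B :
  (forall n, bmeasurable (f_ n) B) -> (forall x, f_ n x @[n --> \oo] --> f x) ->
  \int[m]_x f_ n x @[n --> \oo] --> \int[m]_x f x.
Proof.
move=> fB ff; have fb := bmeasurable_cvg fB ff.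
have := @dominated_cvg _ _ _ m setT measurableT (fun n => EFin \o f_ n) (EFin \o f)
  (cst B%:E).
have fi := integrable_fin_num measurableT (bmeasurable_integrable m fb).
rewrite -(fineK fi) => h; apply: fine_cvg; apply: h => //.
- by move=> n; apply/measurable_EFinP; case: (fB n).
- by move=> x _; apply: cvg_EFin; [exact: nearW|exact: ff].
- exact: (bmeasurable_integrable m (bmeasurable_cst B)).
- by move=> n x _ /=; rewrite lee_fin; case: (fB n).
Qed.

Lemma charge_integralD M f g B C : bmeasurable f B -> bmeasurable g C ->
  charge_integral M (fun x => f x + g x) = charge_integral M f + charge_integral M g.
Proof.
move=> bf bg; rewrite /charge_integral !RintegralD//;
  try exact: bmeasurable_integrable bf; try exact: bmeasurable_integrable bg.
by ring.
Qed.

Lemma charge_integralZ M f B (k : R) : bmeasurable f B ->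
  charge_integral M (fun x => k * f x) = k * charge_integral M f.
Proof.
move=> bf; rewrite /charge_integral !RintegralZl//;
  try exact: bmeasurable_integrable bf.
by ring.
Qed.

Lemma charge_integral_cvg M (f_ : nat -> mR -> R) f B :
  (forall n, bmeasurable (f_ n) B) -> (forall x, f_ n x @[n --> \oo] --> f x) ->
  charge_integral M (f_ n) @[n --> \oo] --> charge_integral M f.
Proof. by move=> fB ff; apply: cvgB; apply: Rintegral_dominated_cvg ff. Qed.

Lemma charge_integral_indic M A : measurable A ->
  charge_integral M (\1_A) = fine (M A).
Proof.
move=> mA; rewrite jposB// fineB ?fin_num_measure// /charge_integral /Rintegral.
by rewrite !integral_indic// !setIT.
Qed.

End charge_integral_theory.

(** * Functionals that vanish on all sines and cosines *)

Section fourier_uniqueness.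
Context (R : realType).
Local Notation mR := (measurableTypeR R).
Implicit Types (f g : mR -> R).
Variable Phi : (mR -> R) -> R.
Hypothesis PhiD : forall f g B C, bmeasurable f B -> bmeasurable g C ->
  Phi (fun x => f x + g x) = Phi f + Phi g.
Hypothesis PhiZ : forall f B k, bmeasurable f B -> Phi (fun x => k * f x) = k * Phi f.
Hypothesis Phi_cvg : forall (f_ : nat -> mR -> R) f B,
  (forall n, bmeasurable (f_ n) B) -> (forall x, f_ n x @[n --> \oo] --> f x) ->
  Phi (f_ n) @[n --> \oo] --> Phi f.
Hypothesis Phi_cos : forall t, Phi (fun x => cos (t * x)) = 0.
Hypothesis Phi_sin : forall t, Phi (fun x => sin (t * x)) = 0.

Inductive trig_poly : (mR -> R) -> Prop :=
| trig_cos t : trig_poly (fun x => cos (t * x))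
| trig_sin t : trig_poly (fun x => sin (t * x))
| trig_add f g : trig_poly f -> trig_poly g -> trig_poly (fun x => f x + g x)
| trig_scale k f : trig_poly f -> trig_poly (fun x => k * f x).

Lemma trig_ext f g : trig_poly f -> f =1 g -> trig_poly g.
Proof. by move=> tf /funext <-. Qed.

Lemma trig_poly_bmeasurable f : trig_poly f -> exists B, bmeasurable f B.
Proof.
have mM t : measurable_fun setT (fun x : mR => t * x : mR).
  by apply: measurable_funM => //; exact: measurable_cst.
elim=> {f} [t|t|f g _ [B bf] _ [C bg]|k f _ [B bf]].
- exists 1; split=> [|x]; last by rewrite ler_norml cos_geN1 cos_le1.
  apply: measurableT_comp => //.
  by apply: continuous_measurable_fun; exact: continuous_cos.
- exists 1; split=> [|x]; last by rewrite ler_norml sin_geN1 sin_le1.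
  apply: measurableT_comp => //.
  by apply: continuous_measurable_fun; exact: continuous_sin.
- by exists (B + C); exact: bmeasurableD.
- by exists (`|k| * B); exact: bmeasurableZ.
Qed.

Lemma Phi_trig f : trig_poly f -> Phi f = 0.
Proof.
elim=> {f} [t|t|f g tf f0 tg g0|k f tf f0] //.
  have [B bf] := trig_poly_bmeasurable tf; have [C bg] := trig_poly_bmeasurable tg.
  by rewrite (PhiD bf bg) f0 g0 addr0.
have [B bf] := trig_poly_bmeasurable tf.
by rewrite (PhiZ _ bf) f0 mulr0.
Qed.

(** Product-to-sum formulas. Stability under products is needed to apply a polynomial repeatedly to
    a sine. *)
Lemma trig_mul f g : trig_poly f -> trig_poly g -> trig_poly (fun x => f x * g x).
Proof.
move=> tf tg; elim: tf => {f} [t|t|f f' _ tf _ tf'|k f _ tf].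
- elim: tg => {g} [s|s|g g' _ hg _ hg'|k g _ hg].
  + apply: (trig_ext (trig_add (trig_scale 2^-1 (trig_cos (t + s)))
      (trig_scale 2^-1 (trig_cos (t - s))))) => x.
    by rewrite !mulrDl mulNr !cosD cosN sinN; field.
  + apply: (trig_ext (trig_add (trig_scale 2^-1 (trig_sin (s + t)))
      (trig_scale 2^-1 (trig_sin (s - t))))) => x.
    by rewrite !mulrDl mulNr !sinD cosN sinN; field.
  + by apply: (trig_ext (trig_add hg hg')) => x; rewrite mulrDr.
  + by apply: (trig_ext (trig_scale k hg)) => x; rewrite mulrCA.
- elim: tg => {g} [s|s|g g' _ hg _ hg'|k g _ hg].
  + apply: (trig_ext (trig_add (trig_scale 2^-1 (trig_sin (t + s)))
      (trig_scale 2^-1 (trig_sin (t - s))))) => x.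
    by rewrite !mulrDl mulNr !sinD cosN sinN; field.
  + apply: (trig_ext (trig_add (trig_scale 2^-1 (trig_cos (t - s)))
      (trig_scale (- 2^-1) (trig_cos (t + s))))) => x.
    by rewrite !mulrDl mulNr !cosD cosN sinN; field.
  + by apply: (trig_ext (trig_add hg hg')) => x; rewrite mulrDr.
  + by apply: (trig_ext (trig_scale k hg)) => x; rewrite mulrCA.
- by apply: (trig_ext (trig_add tf tf')) => x; rewrite mulrDl.
- by apply: (trig_ext (trig_scale k tf)) => x; rewrite mulrA.
Qed.

(* The iterates of this odd cubic, which fixes -1, 0 and 1, converge on [-1, 1] to
   the sign function. *)
Definition smoothstep (v : R) := (3 * v - v ^+ 3) / 2.

Lemma smoothstepN v : smoothstep (- v) = - smoothstep v.
Proof. by rewrite /smoothstep; field. Qed.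

Lemma iter_smoothstepN n v : iter n smoothstep (- v) = - iter n smoothstep v.
Proof. by elim: n => //= n ->; rewrite smoothstepN. Qed.

(** 1 - smoothstep z = (1 - z)^2 (2 + z)/2, and the iterates stay above v, so each step multiplies
    the distance to 1 by at most 1 - v/2. *)
Lemma iter_smoothstep_pos n v : 0 < v <= 1 ->
  v <= iter n smoothstep v <= 1 /\ 1 - iter n smoothstep v <= (1 - v / 2) ^+ n.
Proof.
move=> /andP[v0 v1]; elim: n => [|n]; rewrite /= ?expr0 ?lexx ?v1; first by split=> //; lra.
set z := iter n _ _; move=> [/andP[vz z1] h].
have e1 : smoothstep z = z + z * (1 - z) * (1 + z) / 2 by rewrite /smoothstep; field.
have e2 : 1 - smoothstep z = (1 - z) * ((1 - z) * (2 + z) / 2) by rewrite /smoothstep; field.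
have z0 : 0 <= 1 - z by lra.
have zv : 0 <= (1 - z) * (2 + z) / 2 <= 1 - v / 2 by nra.
split.
  have : 0 <= z * (1 - z) * (1 + z) by rewrite !mulr_ge0//; lra.
  have : 0 <= 1 - smoothstep z by rewrite e2 mulr_ge0//; case/andP: zv.
  by move=> ? ?; apply/andP; split; lra.
by rewrite e2 exprSr; case/andP: zv => ? ?; apply: ler_pM.
Qed.

Lemma iter_smoothstep_cvg v : `|v| <= 1 ->
  (forall n, `|iter n smoothstep v| <= 1) /\
  iter n smoothstep v @[n --> \oo] --> Num.sg v.
Proof.
have pos u : 0 < u <= 1 -> (forall n, `|iter n smoothstep u| <= 1) /\
    iter n smoothstep u @[n --> \oo] --> (1 : R).
  move=> u01; have /andP[u0 u1] := u01; split=> [n|].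
    have [/andP[h1 h2] _] := iter_smoothstep_pos n u01.
    by rewrite ler_norml h2 andbT; lra.
  apply: (@squeeze_cvgr _ _ _ _ (fun n => 1 - (1 - u / 2) ^+ n) (cst 1)).
  - apply: nearW => n; have [/andP[h1 h2] h3] := iter_smoothstep_pos n u01.
    by rewrite h2 andbT; lra.
  - rewrite -[X in _ --> X]subr0; apply: cvgB; first exact: cvg_cst.
    by apply: cvg_expr; rewrite ger0_norm; lra.
  - exact: cvg_cst.
rewrite ler_norml => /andP[v1 v2]; case: (ltgtP v 0) => v0.
- have [|h1 h2] := pos (- v); first by apply/andP; split; lra.
  rewrite ltr0_sg//; split=> [n|].
    by rewrite -normrN -iter_smoothstepN.
  rewrite (_ : (fun n => _) = (fun n => - iter n smoothstep (- v))); first exact: cvgN h2.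
  by apply/funext => n; rewrite iter_smoothstepN opprK.
- by have [|h1 h2] := pos v; rewrite ?gtr0_sg//; apply/andP; split.
- rewrite v0 sgr0.
  have e n : iter n smoothstep 0 = 0.
    by elim: n => //= n ->; rewrite /smoothstep; ring.
  split=> [n|]; first by rewrite e normr0.
  by under eq_fun do rewrite e; exact: cvg_cst.
Qed.

Lemma trig_iter n f : trig_poly f -> trig_poly (fun x => iter n smoothstep (f x)).
Proof.
move=> tf; elim: n => [|n ih] //=.
have t3 := trig_mul ih (trig_mul ih ih).
apply: (trig_ext (trig_add (trig_scale (3 / 2) ih) (trig_scale (- 2^-1) t3))) => x /=.
by rewrite /smoothstep; field.
Qed.

Lemma cvg_Phi0 (f_ : nat -> mR -> R) f B :
  (forall n, bmeasurable (f_ n) B) -> (forall x, f_ n x @[n --> \oo] --> f x) ->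
  (forall n, Phi (f_ n) = 0) -> bmeasurable f B /\ Phi f = 0.
Proof.
move=> fB ff f0; split; first exact: bmeasurable_cvg ff.
have := Phi_cvg fB ff; under eq_fun do rewrite f0.
by move=> h; apply/esym; apply: (cvg_unique (@norm_hausdorff R R^o) (cvg_cst 0) h).
Qed.

(* Square waves; letting their period tend to infinity gives half-lines. *)
Lemma Phi_sg_sin t a : bmeasurable (fun x => Num.sg (sin (t * (x - a)))) 1 /\
  Phi (fun x => Num.sg (sin (t * (x - a)))) = 0.
Proof.
have tsin : trig_poly (fun x => sin (t * (x - a))).
  apply: (trig_ext (trig_add (trig_scale (cos (t * a)) (trig_sin t))
    (trig_scale (- sin (t * a)) (trig_cos t)))) => x.
  by rewrite mulrBr sinB; ring.
have sin1 x : `|sin (t * (x - a))| <= 1 by rewrite ler_norml sin_geN1 sin_le1.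
apply: (@cvg_Phi0 (fun n x => iter n smoothstep (sin (t * (x - a))))).
- move=> n; split; last by move=> x; case: (iter_smoothstep_cvg (sin1 x)).
  by have [B []] := trig_poly_bmeasurable (trig_iter n tsin).
- by move=> x; case: (iter_smoothstep_cvg (sin1 x)).
- by move=> n; apply: Phi_trig; exact: trig_iter.
Qed.

Lemma sg_sin_small (x : R) : `|x| < 2 -> Num.sg (sin x) = Num.sg x.
Proof.
have pi2 := pi_ge2 R; rewrite ltr_norml => /andP[x1 x2].
case: (ltgtP x 0) => x0.
- rewrite (ltr0_sg x0) -[x]opprK sinN ltr0_sg// oppr_lt0 sin_gt0_pi//.
  by apply/andP; split; lra.
- by rewrite (gtr0_sg x0) gtr0_sg// sin_gt0_pi//; apply/andP; split; lra.
- by rewrite x0 sin0.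
Qed.

Lemma Phi_sg a : bmeasurable (fun x => Num.sg (x - a)) 1 /\
  Phi (fun x => Num.sg (x - a)) = 0.
Proof.
apply: (@cvg_Phi0 (fun n x => Num.sg (sin (n.+1%:R^-1 * (x - a))))).
- by move=> n; case: (Phi_sg_sin n.+1%:R^-1 a).
- move=> x; apply: cvg_near_cst; exists (Num.truncn `|x - a|) => // n /= hn.
  have n0 : 0 < n.+1%:R :> R by rewrite ltr0n.
  rewrite sg_sin_small; first by rewrite sgrM gtr0_sg ?mul1r// invr_gt0.
  rewrite normrM normfV (gtr0_norm n0) mulrC ltr_pdivrMr//.
  apply: (lt_le_trans (truncnS_gt _)).
  apply: (@le_trans _ _ n.+1%:R); first by rewrite ler_nat ltnS.
  by rewrite ler_peMl// ?ltW//; lra.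
- by move=> n; case: (Phi_sg_sin n.+1%:R^-1 a).
Qed.

Lemma Phi_indic a : Phi (\1_(`]-oo, a]%classic)) = 0.
Proof.
have [bh Ph] : bmeasurable (fun x : mR => if x <= a then -1 else 1 : R) 1 /\
    Phi (fun x => if x <= a then -1 else 1) = 0.
  (* The jump points decrease to a, so the limit at x = a is -1 and the half-line is closed; the
     sign function centred at a would be 0 there. *)
  apply: (@cvg_Phi0 (fun n x => Num.sg (x - (a + n.+1%:R^-1)))).
  - by move=> n; case: (Phi_sg (a + n.+1%:R^-1)).
  - move=> x; apply: cvg_near_cst; case: (leP x a) => xa.
      exists 0%N => // n _; rewrite ltr0_sg//.
      have n0 : 0 < n.+1%:R^-1 :> R by rewrite invr_gt0 ltr0n.
      by rewrite subr_lt0 (le_lt_trans xa)// ltrDl.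
    exists (Num.truncn (x - a)^-1) => // n /= hn; rewrite gtr0_sg//.
    rewrite subr_gt0 -ltrBrDl -[ltRHS]invrK ltf_pV2 ?posrE ?ltr0n ?invr_gt0 ?subr_gt0//.
    by apply: (lt_le_trans (truncnS_gt _)); rewrite ler_nat ltnS.
  - by move=> n; case: (Phi_sg (a + n.+1%:R^-1)).
have b1 : bmeasurable (fun x : mR => cos (0 * x)) 1.
  by under eq_fun do rewrite mul0r cos0; rewrite -[X in bmeasurable _ X]normr1;
    exact: bmeasurable_cst.
(* [cos (0 * x)] plays the part of the constant 1. *)
have -> : \1_(`]-oo, a]%classic) = (fun x : mR =>
    2^-1 * cos (0 * x) + (- 2^-1) * (if x <= a then -1 else 1)).
  apply/funext => x; rewrite indicE mul0r cos0.
  have -> : (x \in `]-oo, a]%classic) = (x <= a).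
    by apply/idP/idP; rewrite inE/= in_itv.
  by case: ifP => _; rewrite /=; lra.
rewrite (PhiD (bmeasurableZ _ b1) (bmeasurableZ _ bh)) (PhiZ _ b1) (PhiZ _ bh).
by rewrite Ph Phi_cos !mulr0 addr0.
Qed.

End fourier_uniqueness.

(** * Charges on a lattice *)

Section distribution_function.
Context (R : realType).
Local Notation mR := (measurableTypeR R).
Implicit Types (M L : smeasure R) (m n : {finite_measure set mR -> \bar R}).

Definition scdf M (x : R) : R := fine (M `]-oo, x]%classic).

Lemma fin_charge M A : measurable A -> M A \is a fin_num.
Proof. exact: fin_num_measure. Qed.

Lemma fine_le_setT m A : measurable A -> 0 <= fine (m A) <= fine (m setT).
Proof.
by move=> mA; rewrite fine_ge0//= fine_le ?fin_num_measure// le_measure ?inE.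
Qed.

Lemma scdf_bounded M : exists B, forall x, `|scdf M x| <= B.
Proof.
exists (fine (jpos M setT) + fine (jneg M setT)) => x.
rewrite /scdf jposB// fineB ?fin_num_measure//.
apply: (le_trans (ler_normB _ _)).
have /andP[p0 p1] := @fine_le_setT (jpos M) _ (measurable_itv `]-oo, x]).
have /andP[n0 n1] := @fine_le_setT (jneg M) _ (measurable_itv `]-oo, x]).
by rewrite !ger0_norm// lerD.
Qed.

Lemma ysection_add x v :
  ysection ((fun z : mR * mR => z.1 + z.2 : mR) @^-1` `]-oo, x]) v = `]-oo, x - v]%classic.
Proof.
by apply/funext => u; apply/propext; rewrite /ysection/= inE/= !in_itv/= lerBrDr.
Qed.

Let madd : measurable_fun setT (fun z : mR * mR => z.1 + z.2 : mR).
Proof. exact: (measurable_funD measurable_fst measurable_snd). Qed.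

Let mhalf x : measurable ((fun z : mR * mR => z.1 + z.2 : mR) @^-1` `]-oo, x]).
Proof. by rewrite -[X in measurable X]setTI; apply: madd. Qed.

Lemma bmeasurable_half m x :
  bmeasurable (fun v : mR => fine (m `]-oo, x - v]%classic)) (fine (m setT)).
Proof.
split=> [|v]; last first.
  have /andP[h0 h1] := @fine_le_setT m _ (measurable_itv `]-oo, x - v]).
  by rewrite ger0_norm.
apply: measurableT_comp; first by [].
rewrite (_ : (fun v => _) = m \o ysection
  ((fun z : mR * mR => z.1 + z.2 : mR) @^-1` `]-oo, x])).
  exact: measurable_fun_ysection.
by apply/funext => v /=; rewrite ysection_add.
Qed.

Lemma fconv_half m n x :
  fine (fconv m n `]-oo, x]%classic) = \int[n]_v fine (m `]-oo, x - v]%classic).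
Proof.
rewrite /fconv /pushforward (@product_measure_unique _ _ _ _ _ m n (m \x^ n)%E)//; last first.
  exact: product_measure2E.
rewrite /product_measure2 /Rintegral; congr fine; apply: eq_integral => v _.
by rewrite /= ysection_add fineK// fin_num_measure.
Qed.

Lemma scdf_jpos M x :
  scdf M x = fine (jpos M `]-oo, x]%classic) - fine (jneg M `]-oo, x]%classic).
Proof. by rewrite /scdf jposB// fineB ?fin_num_measure. Qed.

Lemma scdf_sconv_int M L x :
  scdf (sconv M L) x = charge_integral L (fun v => scdf M (x - v)).
Proof.
have f m n : fconv m n `]-oo, x]%classic \is a fin_num by exact: fin_num_measure.
have -> : scdf (sconv M L) x =
  fine (fconv (jpos M) (jpos L) `]-oo, x]%classic +
   fconv (jneg M) (jneg L) `]-oo, x]%classic -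
   (fconv (jpos M) (jneg L) `]-oo, x]%classic +
    fconv (jneg M) (jpos L) `]-oo, x]%classic))%E by [].
rewrite fineB; [|by rewrite fin_numD !f|by rewrite fin_numD !f].
rewrite [in X in X - _]fineD// [in X in _ - X]fineD// !fconv_half.
rewrite (_ : (fun v => scdf M (x - v)) = (fun v => fine (jpos M `]-oo, x - v]%classic) -
    fine (jneg M `]-oo, x - v]%classic))); last first.
  by apply/funext => v; rewrite scdf_jpos.
rewrite /charge_integral.
rewrite !RintegralB//; try exact: bmeasurable_integrable (bmeasurable_half _ _).
by ring.
Qed.

Lemma scdf_ssub M L x : scdf (ssub M L) x = scdf M x - scdf L x.
Proof.
have -> : scdf (ssub M L) x = fine (M `]-oo, x]%classic - L `]-oo, x]%classic)%E by [].
by rewrite fineB// fin_charge.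
Qed.

Lemma scdf_sscale a M x : scdf (sscale a M) x = a * scdf M x.
Proof.
have -> : scdf (sscale a M) x = fine (a%:E * M `]-oo, x]%classic)%E by [].
by rewrite fineM// fin_charge.
Qed.

Lemma scdf_unit x : scdf (unit_mass R) x = (0 <= x)%R%:R.
Proof.
rewrite /scdf (_ : unit_mass R _ = \d_(0 : mR) `]-oo, x]%classic)// diracE/=; congr (_%:R); congr nat_of_bool.
by apply/idP/idP; rewrite inE/= in_itv.
Qed.

End distribution_function.

(** * Charges described by a power series on a lattice *)

Section lattice_charges.
Context (R : realType).
Local Notation mR := (measurableTypeR R).
Implicit Types (M L : smeasure R) (a b : fps R) (w x : R).

(* For 0 < w, the number of k with w k <= x. *)
Definition lattice_count w x : nat := if x < 0 then 0 else (Num.truncn (x / w)).+1.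

Lemma lattice_countP w x k : 0 < w -> (k < lattice_count w x)%N = (w * k%:R <= x).
Proof.
move=> w0; rewrite /lattice_count; case: ltP => x0.
  by apply/esym/negbTE; rewrite -ltNge (lt_le_trans x0)// mulr_ge0// ltW.
have xw : 0 <= x / w by rewrite divr_ge0// ltW.
by rewrite ltnS truncn_ge_nat// ler_pdivlMr// mulrC.
Qed.

Lemma lattice_count_eq w x n : 0 < w ->
  (forall k, (w * k%:R <= x) = (k < n)%N) -> lattice_count w x = n.
Proof.
move=> w0 h; apply/eqP; rewrite eqn_leq; apply/andP; split; rewrite leqNgt.
  by rewrite lattice_countP// h ltnn.
by rewrite -h -lattice_countP// ltnn.
Qed.

Lemma le_lattice_count w x z : 0 < w -> x <= z ->
  (lattice_count w x <= lattice_count w z)%N.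
Proof.
move=> w0 xz; rewrite leqNgt lattice_countP//; apply/negP => /le_trans /(_ xz).
by rewrite -lattice_countP// ltnn.
Qed.

Lemma lattice_count_lat w n : 0 < w -> lattice_count w (w * n%:R) = n.+1.
Proof.
by move=> w0; apply: lattice_count_eq => // k; rewrite ler_pM2l// ler_nat.
Qed.

Lemma lattice_countB w x k : 0 < w ->
  lattice_count w (x - w * k%:R) = (lattice_count w x - k)%N.
Proof.
move=> w0; apply: lattice_count_eq => // j.
by rewrite lerBrDr -mulrDr -natrD -lattice_countP// ltn_subRL addnC.
Qed.

(** The description is through half-lines rather than point masses: this is what the Kolmogorov norm
    sees, and it is stable under convolution. *)
Definition lattice_charge M w a := forall x, scdf M x = psum a (lattice_count w x).

Lemma lattice_psum_bounded M w a : 0 < w -> lattice_charge M w a ->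
  exists B, forall n, `|psum a n| <= B.
Proof.
move=> w0 hM; have [B hB] := scdf_bounded M; exists B => -[|n].
  by rewrite psum0 normr0 (le_trans _ (hB 0)).
by rewrite -(lattice_count_lat n w0) -hM.
Qed.

(** [L] need not be carried by the same lattice, which is what permits factors with different
    weights. The distribution function of [M] is a pointwise limit of finite sums of half-line
    indicators, dominated because the partial sums of [a] are bounded; terms beyond the count vanish
    with [L] on the negative axis, so any larger [K] will do. *)
Lemma scdf_sconv M L w a K x : 0 < w -> lattice_charge M w a ->
  (forall z, z < 0 -> scdf L z = 0) -> (lattice_count w x <= K)%N ->
  scdf (sconv M L) x = \sum_(k < K) fcoef a k * scdf L (x - w * k%:R).
Proof.
move=> w0 hM hL xK; rewrite scdf_sconv_int.
have [B hB] := lattice_psum_bounded w0 hM.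
pose f n (v : mR) : R := \sum_(k < n) fcoef a k * \1_(`]-oo, x - w * k%:R]%classic) v.
have indE k v : \1_(`]-oo, x - w * k%:R]%classic) v =
    (k < lattice_count w (x - v))%N%:R :> R.
  rewrite indicE lattice_countP//; congr (_%:R); congr nat_of_bool.
  by apply/idP/idP; rewrite inE/= in_itv/= lerBrDr lerBrDr addrC.
have fE n v : f n v = psum a (minn n (lattice_count w (x - v))).
  rewrite /f /psum; elim: n => [|n ih]; first by rewrite min0n !big_ord0.
  rewrite big_ord_recr/= ih indE; have [h|] := boolP (n < _)%N.
    by rewrite (minn_idPl (ltnW h)) (minn_idPl h) big_ord_recr/= mulr1.
  by rewrite -leqNgt => h; rewrite mulr0 addr0 (minn_idPr h) (minn_idPr (leqW h)).
have bind k : bmeasurable (\1_(`]-oo, x - w * k%:R]%classic) : mR -> R) 1.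
  split; first exact: measurable_indic.
  by move=> v; rewrite indE; case: (_ < _)%N; rewrite ?normr1 ?normr0.
have fint n : (exists C, bmeasurable (f n) C) /\
    charge_integral L (f n) = \sum_(k < n) fcoef a k * scdf L (x - w * k%:R).
  elim: n => [|n [[C bf] ih]].
    have -> : f 0%N = cst 0 by apply/funext => v; rewrite /f big_ord0.
    rewrite big_ord0; split; first by exists `|0 : R|; exact: bmeasurable_cst.
    have := charge_integralZ L 0 (bmeasurable_cst (0 : R)).
    rewrite mul0r (_ : (fun v => 0 * cst 0 v) = cst 0)//.
    by apply/funext => v; rewrite mul0r.
  have -> : f n.+1 = (fun v => f n v + fcoef a n * \1_(`]-oo, x - w * n%:R]%classic) v).
    by apply/funext => v; rewrite /f big_ord_recr.
  split; first by eexists; exact: bmeasurableD bf (bmeasurableZ _ (bind n)).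
  rewrite (charge_integralD _ bf (bmeasurableZ _ (bind n))) ih.
  rewrite (charge_integralZ _ _ (bind n)) charge_integral_indic//.
  by rewrite big_ord_recr.
have fcv : charge_integral L (f n) @[n --> \oo] -->
    charge_integral L (fun v => scdf M (x - v)).
  apply: (@charge_integral_cvg _ L f _ B).
    move=> n; split; last by move=> v; rewrite fE.
    by have [[C []]] := fint n.
  move=> v; apply: cvg_near_cst; exists (lattice_count w (x - v)) => // n /= hn.
  by rewrite fE (minn_idPr hn) hM.
apply: (cvg_unique (@norm_hausdorff R R^o) fcv).
apply: cvg_near_cst; exists K => // n /= Kn.
have [_ ->] := fint n; rewrite -(subnKC Kn) big_split_ord/= [X in _ + X]big1 ?addr0//.
move=> k _; rewrite hL ?mulr0// subr_lt0 ltNge -lattice_countP// -leqNgt.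
by rewrite (leq_trans xK)// leq_addr.
Qed.

Lemma lattice_charge_neg M w a x : lattice_charge M w a -> x < 0 -> scdf M x = 0.
Proof. by move=> hM x0; rewrite hM /lattice_count x0 psum0. Qed.

Lemma lattice_charge_unit w : 0 < w -> lattice_charge (unit_mass R) w 1.
Proof.
move=> w0 x; rewrite scdf_unit /lattice_count; case: ltP => x0; first by rewrite psum0.
by rewrite /psum big_ord_recl/= big1 ?addr0.
Qed.

Lemma lattice_charge_sconv M L w a b : 0 < w ->
  lattice_charge M w a -> lattice_charge L w b -> lattice_charge (sconv M L) w (a * b).
Proof.
move=> w0 hM hL x.
rewrite (scdf_sconv w0 hM (fun z => lattice_charge_neg hL) (leqnn _)) psumM.
by apply: eq_bigr => k _; rewrite hL lattice_countB.
Qed.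

Lemma lattice_charge_ssub M L w a b :
  lattice_charge M w a -> lattice_charge L w b -> lattice_charge (ssub M L) w (a - b).
Proof. by move=> hM hL x; rewrite scdf_ssub hM hL psumB. Qed.

Lemma lattice_charge_sscale M w a k :
  lattice_charge M w a -> lattice_charge (sscale k M) w (fps_const k * a).
Proof. by move=> hM x; rewrite scdf_sscale hM psumZ. Qed.

Lemma lattice_charge_spow M w a k : 0 < w ->
  lattice_charge M w a -> lattice_charge (spow M k) w (a ^+ k).
Proof.
move=> w0 hM; elim: k => [|k ih]; first exact: lattice_charge_unit.
by rewrite exprS; exact: lattice_charge_sconv.
Qed.

Lemma lattice_charge_expm M w a : 0 < w ->
  lattice_charge M w a -> lattice_charge (expm M) w (fexp a).
Proof.
move=> w0 hM x; rewrite /scdf/= /expm_fun/=; apply: cvg_lim => //.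
set n := lattice_count w x.
rewrite (_ : series _ = fun K => psum (psums (fun k => k`!%:R^-1) a K) n).
  apply: cvg_big => [|i _]; first exact: add_continuous.
  exact: (@fcvg_coef _ _ _ i (fexp_fcvg a)).
apply/funext => K; rewrite seriesEord/=.
elim: K => [|K ih].
  by rewrite big_ord0 /psums big_ord0 /psum big1// => i _; rewrite fcoef0.
rewrite big_ord_recr/= ih {2}/psums big_ord_recr psumD psumZ; congr (_ + _).
by rewrite /expm_term mulrC -/(scdf _ _) (lattice_charge_spow K w0 hM).
Qed.

Lemma lattice_charge_cpoisson p q qb n (Y : smeasure R) w a : 0 < w ->
  lattice_charge Y w a ->
  lattice_charge (cpoisson p q qb n Y) w
    (fexp (fps_const (gam q qb * (qb - p) / (q + qb) + n%:R * gam q qb) * a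
    - fps_const (n%:R * (q * qb ^+ 2 / (q + qb) ^+ 2 * (p + q / (q + qb))
         + gam q qb ^+ 2 / 2)) * a ^+ 2)).
Proof.
move=> w0 hY; apply: lattice_charge_expm => //.
apply: lattice_charge_ssub; first exact: lattice_charge_sscale.
by apply: lattice_charge_sscale; exact: lattice_charge_spow.
Qed.

End lattice_charges.

(** * The signed measure with the given geometric transform *)

Section fourier_geometric.
Context (R : realType).
Local Notation mR := (measurableTypeR R).
Variables (p q w : R) (Y : smeasure R).
Hypothesis p01 : 0 < p < 1.
Hypothesis pq : p + q = 1.
Hypothesis w0 : 0 < w.
Local Open Scope complex_scope.
Hypothesis hY : forall t, fourier_stieltjes Y t =
  q%:C * expi (w * t) / (1 - p%:C * expi (w * t)) - 1.
Local Close Scope complex_scope.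
Let C t := charge_integral Y (fun x => cos (t * x)).
Let S t := charge_integral Y (fun x => sin (t * x)).

(* Multiplying the transform by 1 - p e^{iwt} clears the denominator: Y - p (Y
   shifted by w) has the same transform as the difference of the unit masses at w
   and 0. *)
Lemma transform_components t :
  C t - p * (cos (w * t) * C t - sin (w * t) * S t) = cos (w * t) - 1 /\
  S t - p * (cos (w * t) * S t + sin (w * t) * C t) = sin (w * t).
Proof.
have /andP[p0 p1] := p01.
have h := hY t; rewrite /fourier_stieltjes -/(C t) -/(S t) in h.
set e := expi (w * t) in h.
have e1 : (1 - (p%:C)%C * e != 0 :> R[i])%C.
  apply/eqP => /eqP; rewrite subr_eq0 eq_complex/= !mul0r !subr0 ?addr0.
  move=> /andP[/eqP h1 _].
  have := cos_le1 (w * t); have c1 : p * cos (w * t) = 1 by rewrite -h1; ring.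
  by move=> ?; nra.
have : ((C t +i* S t) * (1 - (p%:C) * e) = (q%:C) * e - (1 - (p%:C) * e))%C.
  by rewrite h mulrBl mul1r divfK.
have -> : q = 1 - p by rewrite -pq addrC addKr.
by move=> /eqP; rewrite eq_complex/= => /andP[/eqP h1 /eqP h2]; split; lra.
Qed.

Let bcos t : bmeasurable (fun x : mR => cos (t * x)) 1.
Proof.
have mM : measurable_fun setT (fun x : mR => t * x : mR).
  by apply: measurable_funM => //; exact: measurable_cst.
split=> [|x]; last by rewrite ler_norml cos_geN1 cos_le1.
apply: measurableT_comp => //.
by apply: continuous_measurable_fun; exact: continuous_cos.
Qed.

Let bsin t : bmeasurable (fun x : mR => sin (t * x)) 1.
Proof.
have mM : measurable_fun setT (fun x : mR => t * x : mR).
  by apply: measurable_funM => //; exact: measurable_cst.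
split=> [|x]; last by rewrite ler_norml sin_geN1 sin_le1.
apply: measurableT_comp => //.
by apply: continuous_measurable_fun; exact: continuous_sin.
Qed.

Let mshift : measurable_fun setT (fun x : mR => x + w : mR).
Proof. by apply: measurable_funD => //; exact: measurable_cst. Qed.

Let Phi (f : mR -> R) :=
  charge_integral Y f - p * charge_integral Y (fun x => f (x + w)) - (f w - f 0).

Lemma scdf_geometric_rec x :
  scdf Y x = p * scdf Y (x - w) + (w <= x)%R%:R - (0 <= x)%R%:R.
Proof.
have Pcos t : Phi (fun x => cos (t * x)) = 0.
  have [h1 _] := transform_components t; rewrite /Phi -/(C t) mulr0 cos0.
  rewrite (_ : (fun x : mR => cos (t * (x + w))) =
    (fun x => cos (w * t) * cos (t * x) + (- sin (w * t)) * sin (t * x))); last first.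
    by apply/funext => z; rewrite mulrDr cosD [t * w]mulrC; ring.
  rewrite (charge_integralD _ (bmeasurableZ _ (bcos t)) (bmeasurableZ _ (bsin t))).
  rewrite (charge_integralZ _ _ (bcos t)) (charge_integralZ _ _ (bsin t)).
  by rewrite -/(C t) -/(S t) [t * w]mulrC; lra.
have Psin t : Phi (fun x => sin (t * x)) = 0.
  have [_ h1] := transform_components t; rewrite /Phi -/(S t) mulr0 sin0.
  rewrite (_ : (fun x : mR => sin (t * (x + w))) =
    (fun x => cos (w * t) * sin (t * x) + sin (w * t) * cos (t * x))); last first.
    by apply/funext => z; rewrite mulrDr sinD [t * w]mulrC; ring.
  rewrite (charge_integralD _ (bmeasurableZ _ (bsin t)) (bmeasurableZ _ (bcos t))).
  rewrite (charge_integralZ _ _ (bcos t)) (charge_integralZ _ _ (bsin t)).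
  by rewrite -/(C t) -/(S t) [t * w]mulrC; lra.
have : Phi (\1_(`]-oo, x]%classic)) = 0.
  apply: (@Phi_indic R Phi _ _ _ Pcos Psin x).
  - move=> f g B D bf bg; rewrite /Phi (charge_integralD _ bf bg).
    rewrite (charge_integralD _ (bmeasurable_comp mshift bf) (bmeasurable_comp mshift bg)).
    by ring.
  - move=> f B k bf; rewrite /Phi (charge_integralZ _ _ bf).
    by rewrite (charge_integralZ _ _ (bmeasurable_comp mshift bf)); ring.
  - move=> f_ f B bf ff; rewrite /Phi; apply: cvgB; last by apply: cvgB; exact: ff.
    apply: cvgB; first exact: charge_integral_cvg bf ff.
    apply: cvgM; first exact: cvg_cst.
    apply: (@charge_integral_cvg _ Y (fun n x => f_ n (x + w)) _ B).
      by move=> n; exact: bmeasurable_comp mshift (bf n).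
    by move=> z; exact: ff.
rewrite /Phi.
have -> : (fun z : mR => \1_(`]-oo, x]%classic) (z + w)) =
    \1_(`]-oo, x - w]%classic) :> (mR -> R).
  apply/funext => z; rewrite !indicE; congr (_%:R); congr nat_of_bool.
  by apply/idP/idP; rewrite !inE/= !in_itv/= lerBrDr.
rewrite !charge_integral_indic// -/(scdf Y x) -/(scdf Y (x - w)) !indicE.
have mem (z : R) : (z \in `]-oo, x]%classic) = (z <= x).
  by apply/idP/idP; rewrite inE/= in_itv.
by rewrite !mem; lra.
Qed.

(** On the negative axis both unit masses disappear and the recursion reads G(x) = p G(x - w). As G
    is bounded, iterating gives |G(x)| <= p^n B for every n. *)
Lemma scdf_geometric_neg x : x < 0 -> scdf Y x = 0.
Proof.
have /andP[p0 p1] := p01; have [B hB] := scdf_bounded Y.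
have h n z : z < 0 -> `|scdf Y z| <= p ^+ n * B.
  elim: n z => [|n ih] z z0; first by rewrite expr0 mul1r.
  have wz : (w <= z) = false by apply/negbTE; rewrite -ltNge (lt_trans z0).
  have zz : (0 <= z) = false by apply/negbTE; rewrite -ltNge.
  rewrite scdf_geometric_rec wz zz subr0 addr0 normrM.
  rewrite (ger0_norm (ltW p0)) exprS -mulrA; apply: ler_wpM2l; first exact: ltW.
  by apply: ih; rewrite subr_lt0 (lt_trans z0).
move=> x0; apply/eqP; rewrite -normr_le0.
have cv : p ^+ n * B @[n --> \oo] --> 0 * B.
  by apply: cvgM; [apply: cvg_expr; rewrite ger0_norm// ltW|exact: cvg_cst].
rewrite mul0r in cv; rewrite -(cvg_lim _ cv)//.
apply: limr_ge; first by apply/cvg_ex; exists 0.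
by apply: nearW => n; exact: h.
Qed.

(** The same recursion as for the distribution function of [Y], one lattice step at a time; with
    equal values on the negative axis, induction on the lattice count identifies the two. *)
Lemma psum_geom_gf n :
  psum (geom_gf p - 1) n.+1 = p * psum (geom_gf p - 1) n + (0 < n)%N%:R - 1.
Proof.
have e : geom_gf p - 1 = fps_const p * (fps_X * (geom_gf p - 1)) + (fps_X - 1).
  by have := yMX p; rewrite mulrBr mulr1 => <-; ring.
have X1 k : psum (fps_X - 1 : fps R) k.+1 = (0 < k)%N%:R - 1.
  rewrite psumB /psum; congr (_ - _); last first.
    by rewrite big_ord_recl/= big1 ?addr0.
  case: k => [|k]; first by rewrite big_ord1.
  by rewrite 2!big_ord_recl/= big1 ?addr0 ?add0r.
have -> : psum (geom_gf p - 1) n.+1 =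
    psum (fps_const p * (fps_X * (geom_gf p - 1))) n.+1 + psum (fps_X - 1) n.+1.
  by rewrite -psumD -e.
rewrite (X1 n) psumZ -addrA; congr (_ * _ + _).
rewrite /psum big_ord_recl fcoefXM add0r; apply: eq_bigr => i _.
by rewrite fcoefXM.
Qed.

Lemma lattice_charge_geometric : lattice_charge Y w (geom_gf p - 1).
Proof.
move=> x; move e : (lattice_count w x) => n; elim: n x e => [|n ih] x e.
  rewrite psum0 scdf_geometric_neg//; rewrite ltNge.
  by have := lattice_countP x 0 w0; rewrite e mulr0 => /esym/negbT.
have x0 : 0 <= x by have := lattice_countP x 0 w0; rewrite e mulr0 => <-.
have wx : (w <= x) = (0 < n)%N.
  by have := lattice_countP x 1 w0; rewrite e mulr1.
rewrite scdf_geometric_rec (ih (x - w)); last first.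
  by have := lattice_countB x 1 w0; rewrite e mulr1 subn1.
by rewrite psum_geom_gf x0 wx.
Qed.

End fourier_geometric.

(** * The Markov binomial law *)

Section markov_binomial_gf.
Context (R : realType).
Local Notation c := (@fps_const R).
Local Notation X := (@fps_X R).

(* The generating function of the number of visits to 1 during n steps from a. *)
Fixpoint visits_gf (p q pb qb : R) (n : nat) (a : bool) : fps R :=
  if n is n'.+1 then
    c (trans_prob p q pb qb a false) * visits_gf p q pb qb n' false +
    c (trans_prob p q pb qb a true) * (X * visits_gf p q pb qb n' true)
  else 1.

(** Cayley-Hamilton for the transfer matrix, with trace 1 - qb + p X and determinant (p - qb) X. *)
Lemma visits_gf_rec (p qb : R) n :
  let h n := visits_gf p (1 - p) (1 - qb) qb n false in
  h n.+2 = (c (1 - qb) + c p * X) * h n.+1 - c (p - qb) * X * h n.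
Proof.
move=> h; rewrite /h /=.
move: (visits_gf _ _ _ _ n false) (visits_gf _ _ _ _ n true) => g0 g1.
by rewrite !rmorphB !rmorph1; ring.
Qed.

Lemma psum_XM (a : fps R) K : psum (X * a) K = psum a K.-1.
Proof.
case: K => [|K]; first by rewrite !psum0.
by rewrite /psum big_ord_recl fcoefXM add0r; apply: eq_bigr => i _; rewrite fcoefXM.
Qed.

Context (d : measure_display) (T : measurableType d) (P : probability T R).
Variables (p q pb qb : R) (xi : nat -> {RV P >-> bool}).
Hypothesis hxi : markov_chain01 p q pb qb xi.

Local Notation pr A := (fine (P A)).

Let mxi k b : measurable [set t | xi k t = b].
Proof.
rewrite (_ : [set t | xi k t = b] = setT `&` xi k @^-1` [set b]).
  exact: (measurable_funPT (xi k)).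
by rewrite setTI.
Qed.

Lemma historyS x k :
  history xi x k.+1 = history xi x k `&` [set t | xi k.+1 t = x k.+1].
Proof.
apply/seteqP; split=> t /=.
  by move=> h; split=> [j jk|]; [apply: h; exact: leqW|exact: h].
by move=> [h1 h2] j; rewrite leq_eqVlt => /predU1P[->//|]; exact: h1.
Qed.

Lemma measurable_history x k : measurable (history xi x k).
Proof.
elim: k => [|k ih]; last by rewrite historyS; exact: measurableI.
rewrite (_ : history _ _ _ = [set t | xi 0%N t = x 0%N])//.
apply/seteqP; split=> t /= h; first exact: h.
by move=> j; rewrite leqn0 => /eqP ->.
Qed.

Definition history_step (x : nat -> bool) k b j := if j == k.+1 then b else x j.

Lemma history_stepE x k b :
  history xi (history_step x k b) k.+1 = history xi x k `&` [set t | xi k.+1 t = b].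
Proof.
rewrite historyS /history_step eqxx; congr (_ `&` _).
by apply/seteqP; split=> t /= h j jk; have := h j jk; rewrite ltn_eqF.
Qed.

Lemma pr_history_step x k b :
  pr (history xi (history_step x k b) k.+1) =
  pr (history xi x k) * trans_prob p q pb qb (x k) b.
Proof.
have mh := measurable_history x k; rewrite history_stepE setIC.
(* The Markov property says nothing about a trajectory of probability 0, but then both sides
   vanish. *)
have [h0|h0] := eqVneq (P (history xi x k)) 0%E.
  rewrite h0/= mul0r (_ : P _ = 0%E)//; apply/eqP; rewrite eq_le measure_ge0 andbT.
  by rewrite -h0 le_measure ?inE//; exact: measurableI.
have := (hxi.2 k x b h0); rewrite /cond_prob => <-; rewrite mulrC divfK//.
by apply: contra h0 => /eqP h; rewrite -(@fineK _ (P _)) ?fin_num_measure// h.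
Qed.

Definition visits (n : nat) (t : T) : nat := (\sum_(1 <= k < n.+1) xi k t)%N.

Let mvisits n K : measurable [set t | (visits n t < K)%N].
Proof.
have mv : measurable_fun setT (fun t => weighted_sum 1 n xi t) by [].
rewrite (_ : [set t | _] = setT `&`
  (fun t => weighted_sum 1 n xi t) @^-1` `]-oo, K%:R[%classic).
  by apply: mv => //; exact: measurable_itv.
rewrite setTI; apply/seteqP; split=> t; rewrite /= in_itv/= /weighted_sum mul1r.
  by move=> h; rewrite -natr_sum ltr_nat.
by rewrite -natr_sum ltr_nat.
Qed.

(** Induction on the number l of remaining steps, splitting according to the next state. The
    subtraction is truncated: when the trajectory already has K visits the sum is empty, and the
    event is empty too. *)
Lemma pr_history_visits n l k x K : (k + l)%N = n ->
  pr (history xi x k `&` [set t | (visits n t < K)%N]) =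
  pr (history xi x k) *
  psum (visits_gf p q pb qb l (x k)) (K - \sum_(1 <= j < k.+1) x j).
Proof.
elim: l k x => [|l ih] k x kn.
  rewrite addn0 in kn; rewrite -{n}kn /=.
  have vis t : history xi x k t -> visits k t = (\sum_(1 <= j < k.+1) x j)%N.
    by move=> h; rewrite /visits; apply: eq_big_nat => j /andP[_ jk]; rewrite h.
  set s := (\sum_(1 <= j < k.+1) x j)%N in vis *.
  case: (ltnP s K) => sK.
    rewrite (_ : _ `&` _ = history xi x k).
      rewrite -[LHS]mulr1; congr (_ * _); rewrite -(prednK (_ : 0 < K - s)%N) ?subn_gt0//.
      by rewrite /psum big_ord_recl/= big1 ?addr0.
    by apply/seteqP; split=> t /=; [case|move=> h; split=> //; rewrite vis].
  rewrite (_ : _ `&` _ = set0).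
    by rewrite measure0/= (eqP (sK : (K - s == 0)%N))// psum0 mulr0.
  by apply/seteqP; split=> t //= [h]; rewrite vis// ltnNge sK.
have kln : (k.+1 + l)%N = n by rewrite addSnnS.
have stepx b : history_step x k b k.+1 = b by rewrite /history_step eqxx.
have sum_step b : (\sum_(1 <= j < k.+2) history_step x k b j)%N =
    (\sum_(1 <= j < k.+1) x j + b)%N.
  rewrite big_nat_recr//= stepx; congr (_ + _)%N.
  by apply: eq_big_nat => j /andP[_ jk]; rewrite /history_step ltn_eqF.
have h b := ih k.+1 (history_step x k b) kln.
rewrite (_ : history xi x k `&` _ =
  (history xi (history_step x k false) k.+1 `&` [set t | (visits n t < K)%N]) `|`
  (history xi (history_step x k true) k.+1 `&` [set t | (visits n t < K)%N])).
  rewrite measureU; first last.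
  - rewrite !history_stepE; apply/seteqP; split=> t //=.
    by move=> [[[_ e1] _] [[_]]]; rewrite e1.
  - by apply: measurableI => //; exact: measurable_history.
  - by apply: measurableI => //; exact: measurable_history.
  rewrite fineD ?fin_num_measure//; try by apply: measurableI => //; exact: measurable_history.
  rewrite !h !stepx !sum_step !pr_history_step addn0 addn1 /=.
  by rewrite psumD !psumZ psum_XM subnS; ring.
rewrite !history_stepE; apply/seteqP; split=> t /=.
  by move=> [h1 h2]; case e : (xi k.+1 t); [right|left].
by move=> [] [[h1 _] h2].
Qed.

Lemma lattice_charge_markov (w : R) n : 0 < w ->
  lattice_charge (markov_binomial_law w n xi) w (visits_gf p q pb qb n false).
Proof.
move=> w0 x.
have -> : scdf (markov_binomial_law w n xi) x =
  pr [set t | (visits n t < lattice_count w x)%N].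
  rewrite /scdf /= /pushforward; congr (fine (P _)).
  apply/seteqP; split=> t; rewrite /= in_itv/= /weighted_sum -natr_sum lattice_countP//.
have := @pr_history_visits n n 0%N (fun=> false) (lattice_count w x) (add0n n).
rewrite (_ : history xi (fun=> false) 0 = setT).
  by rewrite setTI probability_setT mul1r big_nil subn0.
apply/seteqP; split=> t //= _ j; rewrite leqn0 => /eqP ->.
exact: hxi.1.
Qed.

End markov_binomial_gf.

(** * Products of lattice charges *)

Section lattice_operators.
Context (R : realType) (I : eqType) (w : I -> R) (K : nat).
Hypothesis w0 : forall i, 0 < w i.
Implicit Types (a b : I -> fps R) (f : R -> R) (r s : seq I).

(** Convolution by a charge on the lattice of step v, cut after K terms and acting on functions.
    Operators for incommensurable steps still commute, which replaces multiplication of series. *)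
Definition lconv (v : R) (a : fps R) f (z : R) : R :=
  \sum_(k < K) fcoef a k * f (z - v * k%:R).
Definition lconvs r a f := foldr (fun i => lconv (w i) (a i)) f r.
Definition lshift (v : R) f (z : R) : R := f (z - v) - f z.

Lemma lconvC v v' (a b : fps R) f :
  lconv v a (lconv v' b f) = lconv v' b (lconv v a f).
Proof.
apply/funext => z; rewrite /lconv.
under eq_bigr do rewrite mulr_sumr.
rewrite exchange_big/=; apply: eq_bigr => i _; rewrite mulr_sumr.
by apply: eq_bigr => j _; rewrite mulrCA addrAC.
Qed.

Lemma lconvs_lconv r a v (b : fps R) f :
  lconvs r a (lconv v b f) = lconv v b (lconvs r a f).
Proof. by elim: r => //= i r ->; exact: lconvC. Qed.

Lemma lconvs_rem r a i f : i \in r ->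
  lconvs r a f = lconvs (rem i r) a (lconv (w i) (a i) f).
Proof.
elim: r => //= j r ih; rewrite inE eq_sym; case: eqVneq => [<- _|_ /= ir].
  by rewrite lconvs_lconv.
by rewrite ih.
Qed.

Lemma lconvs_cat r s a f : lconvs (r ++ s) a f = lconvs r a (lconvs s a f).
Proof. by rewrite /lconvs foldr_cat. Qed.

Lemma lconvB v (a b : fps R) f z : lconv v (a - b) f z = lconv v a f z - lconv v b f z.
Proof. by rewrite /lconv -sumrB; apply: eq_bigr => k _; rewrite fcoefB mulrBl. Qed.

Lemma lconvBr v (a : fps R) f g z :
  lconv v a (fun z => f z - g z) z = lconv v a f z - lconv v a g z.
Proof. by rewrite /lconv -sumrB; apply: eq_bigr => k _; rewrite mulrBr. Qed.

Lemma lconvsBr r a f g z :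
  lconvs r a (fun z => f z - g z) z = lconvs r a f z - lconvs r a g z.
Proof.
elim: r z => //= i r ih z; rewrite -lconvBr; congr (lconv _ _ _ z).
by apply/funext => z'; exact: ih.
Qed.

Lemma lconv_lshift v v' (a : fps R) f :
  lshift v (lconv v' a f) = lconv v' a (lshift v f).
Proof.
apply/funext => z; rewrite /lshift /lconv -sumrB; apply: eq_bigr => k _.
by rewrite mulrBr addrAC.
Qed.

Lemma lconvs_lshift r a v f : lshift v (lconvs r a f) = lconvs r a (lshift v f).
Proof. by elim: r => //= i r <-; exact: lconv_lshift. Qed.

Lemma lconv_neg v (a : fps R) f : 0 < v -> (forall z, z < 0 -> f z = 0) ->
  forall z, z < 0 -> lconv v a f z = 0.
Proof.
move=> v0 hf z z0; rewrite /lconv big1// => k _; rewrite hf ?mulr0//.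
by rewrite subr_lt0 (lt_le_trans z0)// mulr_ge0// ltW.
Qed.

Lemma lconvs_neg r a f : (forall z, z < 0 -> f z = 0) ->
  forall z, z < 0 -> lconvs r a f z = 0.
Proof. by move=> hf; elim: r => //= i r ih; exact: lconv_neg. Qed.

Lemma lconv_bound v (a : fps R) f B z0 : 0 < v ->
  (forall z, z <= z0 -> `|f z| <= B) ->
  forall z, z <= z0 -> `|lconv v a f z| <= fnorm K a * B.
Proof.
move=> v0 fB z zz0; apply: (le_trans (ler_norm_sum _ _ _)).
rewrite /fnorm mulr_suml; apply: ler_sum => k _; rewrite normrM ler_wpM2l// fB//.
by rewrite (le_trans _ zz0)// gerBl mulr_ge0// ltW.
Qed.

Lemma lconvs_bound r a f B z0 (C : R) : 1 <= C -> (forall i, fnorm K (a i) <= C) ->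
  0 <= B -> (forall z, z <= z0 -> `|f z| <= B) ->
  forall z, z <= z0 -> `|lconvs r a f z| <= C ^+ size r * B.
Proof.
move=> C1 aC B0 fB; elim: r => [|i r ih] z zz0 /=; first by rewrite expr0 mul1r fB.
apply: (le_trans (lconv_bound _ (w0 i) ih zz0)); rewrite exprS -mulrA.
by rewrite ler_wpM2r// mulr_ge0// exprn_ge0// (le_trans ler01).
Qed.

(** Summation by parts. Truncation leaves one boundary term, where the argument of f is negative
    because K is at least the lattice count of z. *)
Lemma lconv_X1M v (a : fps R) f z : 0 < v -> (lattice_count v z <= K)%N ->
  (forall z, z < 0 -> f z = 0) ->
  lconv v ((fps_X - 1) * a) f z = lconv v a (lshift v f) z.
Proof.
move=> v0 zK hf; rewrite mulrBl mul1r lconvB.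
have -> : lconv v a (lshift v f) z =
    lconv v a (fun z => f (z - v)) z - lconv v a f z by rewrite -lconvBr.
congr (_ - _); rewrite /lconv; move: zK; case: K => [|n] zn; first by rewrite !big_ord0.
rewrite big_ord_recl fcoefXM mul0r add0r [RHS]big_ord_recr.
rewrite [f (_ - _ * (ord_max : 'I__)%:R - _)]hf ?mulr0; last first.
  have : (n.+1 < lattice_count v z)%N = false by rewrite ltnNge zn.
  rewrite lattice_countP// => /negbT; rewrite -ltNge => h.
  by rewrite -addrA -opprD subr_lt0 -[X in _ + X]mulr1 -mulrDr natr1.
rewrite [RHS]addr0; apply: eq_bigr => i _.
rewrite (fcoefXM a) lift0 /=; congr (_ * f _).
by rewrite -natr1 mulrDr mulr1 opprD addrA.
Qed.

Definition heaviside (z : R) : R := (0 <= z)%R%:R.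

Lemma lconv_heaviside v (a : fps R) z : 0 < v ->
  lconv v a heaviside z = psum a (minn K (lattice_count v z)).
Proof.
move=> v0; rewrite /lconv /psum; elim: K => [|n ih]; first by rewrite min0n !big_ord0.
rewrite big_ord_recr/= ih /heaviside subr_ge0 -lattice_countP//.
have [h|] := boolP (n < _)%N.
  by rewrite (minn_idPl (ltnW h)) (minn_idPl h) big_ord_recr/= mulr1.
by rewrite -leqNgt => h; rewrite mulr0 addr0 (minn_idPr h) (minn_idPr (leqW h)).
Qed.

Lemma psum_sub_le (a : fps R) B i j : (i <= j <= K)%N ->
  (forall k, (k < K)%N -> `|fcoef a k| <= B) ->
  `|psum a i - psum a j| <= (j - i)%:R * B.
Proof.
move=> /andP[ij jK] aB; rewrite distrC -(subnKC ij) /psum big_split_ord/=.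
rewrite addrAC subrr add0r addKn; apply: (le_trans (ler_norm_sum _ _ _)).
rewrite mulr_natl -[X in _ *+ X]card_ord -sumr_const.
apply: ler_sum => k _; apply: aB; apply: leq_trans jK.
by rewrite -ltn_subRL ltn_ord.
Qed.

Lemma psum_X1M (a : fps R) n : psum ((fps_X - 1) * a) n.+1 = - fcoef a n.
Proof.
elim: n => [|n ih]; rewrite psumS ?ih ?psum0 mulrBl mul1r fcoefB fcoefXM /=; ring.
Qed.

(** A coefficient of a is, up to sign, a partial sum of (X - 1) a; smoothing bounds thus limit the
    largest point mass. *)
Lemma fcoef_le_X1M (a : fps R) k : (k < K)%N -> `|fcoef a k| <= fnorm K ((fps_X - 1) * a).
Proof.
move=> kK; rewrite -normrN -psum_X1M; apply: (le_trans (psum_le_fnorm _ _)).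
exact: fnorm_mono.
Qed.

Lemma lshift_heaviside v v' (a : fps R) z : 0 < v -> 0 < v' ->
  `|lshift v' (lconv v a heaviside) z| <= (v' / v + 1) * fnorm K ((fps_X - 1) * a).
Proof.
move=> v0 v'0; rewrite /lshift !lconv_heaviside//.
set n := lattice_count v z; set n' := lattice_count v (z - v').
have n'n : (n' <= n)%N by apply: le_lattice_count => //; rewrite gerBl ltW.
have mm : (minn K n' <= minn K n <= K)%N by rewrite geq_minl andbT leq_min geq_minl geq_min n'n orbT.
apply: (le_trans (psum_sub_le mm (fun k => @fcoef_le_X1M a k))).
rewrite ler_wpM2r ?fnorm_ge0//.
have [nn|nn] := leqP n n'.
  have -> : n = n' by apply/eqP; rewrite eqn_leq nn.
  by rewrite subnn addr_ge0// divr_ge0// ltW.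
apply: (@le_trans _ _ (n - n')%:R).
  by rewrite ler_nat leq_subLR addn_minl subnKC ?(ltnW nn)// leq_min geq_min leq_addr geq_minr.
rewrite -lerBlDr ler_pdivlMr//.
have h1 : v * n.-1%:R <= z by rewrite -lattice_countP// -/n prednK// (leq_trans _ nn).
have h2 : z - v' < v * n'%:R by rewrite ltNge -lattice_countP// -/n' ltnn.
have -> : (n - n')%:R - 1 = n.-1%:R - n'%:R :> R.
  rewrite natrB ?(ltnW nn)// -[in LHS](prednK (_ : 0 < n)%N) ?(leq_trans _ nn)//.
  by rewrite -natr1; ring.
by rewrite mulrBl mulrC [X in _ - X]mulrC; lra.
Qed.

(** The prefix [s] records the factors already passed, so that the induction goes through: to the
    left of the differing factor stand the [a], to its right the [b]. *)
Lemma lconvs_telescope a b f z (beta : I -> R) r s :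
  (forall s' i r', s ++ r = s' ++ i :: r' ->
    `|lconvs s' a (lconv (w i) (a i - b i) (lconvs r' b f)) z| <= beta i) ->
  `|lconvs s a (lconvs r a f) z - lconvs s a (lconvs r b f) z| <= \sum_(i <- r) beta i.
Proof.
elim: r s => [|i r ih] s h; first by rewrite subrr normr0 big_nil.
rewrite big_cons/=.
have e1 g : lconvs s a (lconv (w i) (a i) g) = lconvs (rcons s i) a g.
  by rewrite -cats1 lconvs_cat.
have -> : lconvs s a (lconv (w i) (a i) (lconvs r a f)) z -
    lconvs s a (lconv (w i) (b i) (lconvs r b f)) z =
  lconvs s a (lconv (w i) (a i - b i) (lconvs r b f)) z +
  (lconvs (rcons s i) a (lconvs r a f) z - lconvs (rcons s i) a (lconvs r b f) z).
  rewrite (_ : lconv (w i) (a i - b i) (lconvs r b f) = fun z =>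
    lconv (w i) (a i) (lconvs r b f) z - lconv (w i) (b i) (lconvs r b f) z); last first.
    by apply/funext => z'; rewrite lconvB.
  by rewrite lconvsBr !e1; ring.
apply: (le_trans (ler_normD _ _)); apply: lerD; first exact: h.
by apply: ih => s' j r' e; apply: h; rewrite -e cat_rcons.
Qed.

Lemma scdf_prod (M : I -> smeasure R) a r x :
  (forall i, lattice_charge (M i) (w i) (a i)) ->
  (forall i, (lattice_count (w i) x <= K)%N) ->
  scdf (\big[@sconv R/unit_mass R]_(i <- r) M i) x = lconvs r a heaviside x.
Proof.
move=> hM; elim: r x => [|i r ih] x xK; first by rewrite big_nil scdf_unit.
rewrite big_cons/= (scdf_sconv (w0 i) (hM i) _ (xK i)); last first.
  move=> z z0; rewrite ih => [|j]; last by rewrite /lattice_count z0.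
  by apply: lconvs_neg z0 => z' z'0; rewrite /heaviside leNgt z'0.
apply: eq_bigr => k _; rewrite ih// => j; apply: leq_trans (xK j).
by apply: le_lattice_count => //; rewrite gerBl mulr_ge0// ltW.
Qed.

(** * Bounds for the terms of the telescoped product *)

Section mixed_terms.
Variables (a b : I -> fps R) (C : R).
Hypothesis C1 : 1 <= C.
Hypothesis aC : forall i, fnorm K (a i) <= C.
Hypothesis bC : forall i, fnorm K (b i) <= C.

Let C0 : 0 <= C. Proof. exact: le_trans ler01 C1. Qed.

(** The shift produced by X - 1 commutes with the operators of [r] and is moved onto f. The
    operators only look to the left, so bounds up to [z0] suffice, and there the truncation at K is
    harmless. *)
Lemma lconvs_diff_bound s i r f (V : fps R) E delta z0 :
  a i - b i = (fps_X - 1) * V -> fnorm K V <= E -> 0 <= E ->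
  (forall z, z < 0 -> f z = 0) -> 0 <= delta ->
  (forall z, `|lshift (w i) f z| <= delta) -> (lattice_count (w i) z0 <= K)%N ->
  `|lconvs s a (lconv (w i) (a i - b i) (lconvs r b f)) z0| <=
  C ^+ (size s + size r) * (E * delta).
Proof.
move=> -> VE E0 fneg d0 fd z0K.
have h z : z <= z0 ->
    `|lconv (w i) ((fps_X - 1) * V) (lconvs r b f) z| <= E * (C ^+ size r * delta).
  move=> zz0; rewrite lconv_X1M//; first last.
  - by move=> u; apply: lconvs_neg.
  - exact: leq_trans (le_lattice_count (w0 i) zz0) z0K.
  rewrite lconvs_lshift.
  have fd' u : u <= z0 -> `|lshift (w i) f u| <= delta by move=> _; exact: fd.
  apply: (le_trans (lconv_bound V (w0 i) (lconvs_bound r C1 bC d0 fd') zz0)).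
  by rewrite ler_wpM2r// mulr_ge0// exprn_ge0.
have Ed : 0 <= E * (C ^+ size r * delta) by rewrite !mulr_ge0// exprn_ge0.
apply: (le_trans (lconvs_bound s C1 aC Ed h (lexx z0))).
by rewrite exprD -mulrA [E * (_ * _)]mulrCA.
Qed.

Lemma heaviside_neg z : z < 0 -> heaviside z = 0.
Proof. by rewrite /heaviside ltNge => /negbTE ->. Qed.

(* The shift by [w i] hidden in [X - 1] is moved onto the factor [k]. *)
Lemma mixed_term_bound s i r k (V : fps R) E delta z :
  a i - b i = (fps_X - 1) * V -> fnorm K V <= E -> 0 <= E -> 0 <= delta ->
  (forall z, `|lshift (w i) (lconv (w k) (a k) heaviside) z| <= delta) ->
  (forall z, `|lshift (w i) (lconv (w k) (b k) heaviside) z| <= delta) ->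
  (k \in s) || (k \in r) -> (lattice_count (w i) z <= K)%N ->
  `|lconvs s a (lconv (w i) (a i - b i) (lconvs r b heaviside)) z| <=
  C ^+ (size s + size r) * (E * delta).
Proof.
move=> hV VE E0 d0 da db; have Ed : 0 <= E * delta by rewrite mulr_ge0.
have hneg c := @lconv_neg (w k) c heaviside (w0 k) heaviside_neg.
have [ks _ zK|_ /= kr zK] := boolP (k \in s).
  rewrite (lconvs_rem _ _ ks) lconvC -lconvs_lconv.
  apply: (le_trans (lconvs_diff_bound (rem k s) r hV VE E0 (hneg (a k)) d0 da zK)).
  by rewrite ler_wpM2r// ler_weXn2l// leq_add2r size_rem// leq_pred.
rewrite (lconvs_rem _ _ kr).
apply: (le_trans (lconvs_diff_bound s (rem k r) hV VE E0 (hneg (b k)) d0 db zK)).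
by rewrite ler_wpM2r// ler_weXn2l// leq_add2l size_rem// leq_pred.
Qed.

(** For the term where the differing factor is the smoothing factor itself: nothing else is left to
    absorb X - 1, so the norm of the whole difference, which already contains the gain, is used. *)
Lemma diagonal_term_bound s i r E z : fnorm K (a i - b i) <= E ->
  `|lconvs s a (lconv (w i) (a i - b i) (lconvs r b heaviside)) z| <=
  C ^+ (size s + size r) * E.
Proof.
move=> dE; have E0 := le_trans (fnorm_ge0 _ _) dE.
have h1 u : u <= z -> `|heaviside u| <= 1.
  by move=> _; rewrite /heaviside; case: (0 <= u); rewrite ?normr1 ?normr0.
have h u : u <= z -> `|lconv (w i) (a i - b i) (lconvs r b heaviside) u| <=
    E * C ^+ size r.
  move=> uz; have := lconv_bound (a i - b i) (w0 i) (lconvs_bound r C1 bC ler01 h1) uz.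
  by rewrite mulr1 => /le_trans; apply; rewrite ler_wpM2r// exprn_ge0.
have EC : 0 <= E * C ^+ size r by rewrite mulr_ge0// exprn_ge0.
have := lconvs_bound s C1 aC EC h (lexx z).
by rewrite exprD -mulrA [C ^+ size r * E]mulrC.
Qed.

End mixed_terms.

End lattice_operators.

(** * Choice of the smoothing factor and conclusion *)

Lemma chain_weights (R : realType) N (w : 'I_N -> R) i : (forall j, 0 < w j) ->
  [/\ 0 < minw w, minw w <= w i & w i <= maxw w].
Proof.
move=> w0; split; last exact: le_bigmax; last exact: bigmin_le.
by apply: lt_bigmin => [|j _]; [apply: (lt_le_trans (w0 i)); exact: le_bigmax|exact: w0].
Qed.

(** At the index with the largest s, max(s, 1) is at least the N-th part of the sum; the factor
    sqrt(N) comes from here. *)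
Lemma max_decay_le (R : realType) N (s : 'I_N -> R) : (0 < N)%N ->
  exists k, forall i, decay (s k) <= decay (s i) /\
    decay (s k) <= Num.sqrt N%:R * (Num.sqrt (\sum_(j < N) Num.max (s j) 1))^-1.
Proof.
move=> N0; pose i0 := Ordinal N0.
have [k hk] : exists k, forall i, Num.max 1 (s i) <= Num.max 1 (s k).
  exists [arg max_(k > i0) Num.max 1 (s k)]%O.
  by case: arg_maxP => // k _ hk i; exact: hk.
exists k => i; split.
  rewrite lef_pV2 ?posrE ?sqrtr_gt0 ?lt_max ?ltr01//.
  exact: ler_wsqrtr.
have m0 : 0 < Num.max 1 (s k) by rewrite lt_max ltr01.
have S0 : 0 < \sum_(j < N) Num.max (s j) 1.
  rewrite (bigD1 i0)//= ltr_pwDl ?lt_max ?ltr01 ?orbT// sumr_ge0// => j _.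
  by rewrite le_max ler01 orbT.
rewrite ler_pdivlMr ?sqrtr_gt0// mulrC ler_pdivrMr ?sqrtr_gt0//.
rewrite -sqrtrM ?ler0n//; apply: ler_wsqrtr.
rewrite mulr_natl -[X in _ *+ X]card_ord -sumr_const.
by apply: ler_sum => j _; rewrite maxC.
Qed.

Local Open Scope complex_scope.

Theorem theorem3p1 (R : realType) (N k0 : nat) (hN : (1 <= N)%N)
    (hk0 : (2 <= k0)%N) :
  exists2 C : R, 0 < C &
  forall (d : measure_display) (T : measurableType d) (P : probability T R)
    (n : 'I_N -> nat) (w p q pb qb : 'I_N -> R)
    (xi : 'I_N -> nat -> {RV P >-> bool}) (Y : 'I_N -> smeasure R),
    (forall i, (1 <= n i)%N) ->
    (forall i, 0 < w i) ->
    (forall i, p i + q i = 1) ->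
    (forall i, qb i + pb i = 1) ->
    (forall i, 0 < p i < 1) ->
    (forall i, 0 < qb i < 1) ->
    (forall i, 1 / (n i)%:R ^+ k0 <= qb i) ->
    (forall i, p i <= 1 / 2%:R) ->
    (forall i, qb i <= 1 / 30%:R) ->
    (forall i, markov_chain01 (p i) (q i) (pb i) (qb i) (xi i)) ->
    (forall i t, fourier_stieltjes (Y i) t =
       (q i)%:C * expi (w i * t) / (1 - (p i)%:C * expi (w i * t)) - 1) ->
    (kolmogorov_norm
       (ssub (sprod (fun i => markov_binomial_law (w i) (n i) (xi i)))
             (sprod (fun i => cpoisson (p i) (q i) (qb i) (n i) (Y i))))
     <= (C * (maxw w / minw w) *
         ((\sum_(i < N) qb i * (p i + qb i)) /
          Num.sqrt (\sum_(k < N) Num.max ((n k)%:R * qb k) 1)))%:E)%E.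
Proof.
have [K0 K01 HK] := chain_estimates R.
have K00 : 0 < K0 by exact: lt_le_trans ltr01 K01.
have NR : 0 < Num.sqrt (N%:R : R) by rewrite sqrtr_gt0 ltr0n.
(* [K0 ^+ N] bounds the other factors, the next [K0] the cofactor of X - 1, and [2 * K0] the shifted
   smoothing factor, as w_i/w_k + 1 is at most twice the ratio of extreme weights. *)
exists (K0 ^+ N * (K0 * (2 * K0)) * Num.sqrt N%:R).
  by rewrite !mulr_gt0// exprn_gt0.
move=> d T P n w p q pb qb xi Y n1 w0 pq qpb p01 qb01 _ p2 qb30 hxi hY.
have hq : q = fun i => 1 - p i by apply/funext => i; rewrite -(pq i) addrC addKr.
have hpb : pb = fun i => 1 - qb i by apply/funext => i; rewrite -(qpb i) addrC addKr.
subst q pb.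
have p0 i : 0 <= p i by case/andP: (p01 i) => /ltW.
have qb0 i : 0 < qb i by case/andP: (qb01 i).
pose h i := visits_gf (p i) (1 - p i) (1 - qb i) (qb i).
pose A i := h i (n i) false.
pose B i := fexp (fps_const (gam (1 - p i) (qb i) * (qb i - p i) / (1 - p i + qb i) +
    (n i)%:R * gam (1 - p i) (qb i)) * (geom_gf (p i) - 1)
  - fps_const ((n i)%:R * ((1 - p i) * qb i ^+ 2 / (1 - p i + qb i) ^+ 2 *
    (p i + (1 - p i) / (1 - p i + qb i)) + gam (1 - p i) (qb i) ^+ 2 / 2)) *
    (geom_gf (p i) - 1) ^+ 2).
pose e i := qb i * (p i + qb i).
pose t i := decay ((n i)%:R * qb i).
have est i m : exists V, [/\ A i - B i = (fps_X - 1) * V, fnorm m V <= K0 * e i,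
    fnorm m (A i - B i) <= K0 * e i * t i,
    fnorm m (A i) <= K0 /\ fnorm m (B i) <= K0
    & fnorm m ((fps_X - 1) * A i) <= K0 * t i /\
      fnorm m ((fps_X - 1) * B i) <= K0 * t i].
  apply: (HK (p i) (qb i) (n i) m (fun k => h i k false)) => //.
    by rewrite /h /=; ring.
  by move=> k; exact: visits_gf_rec.
have hA i : lattice_charge (markov_binomial_law (w i) (n i) (xi i)) (w i) (A i).
  by apply: (lattice_charge_markov (hxi i)).
have hB i : lattice_charge (cpoisson (p i) (1 - p i) (qb i) (n i) (Y i)) (w i) (B i).
  apply: lattice_charge_cpoisson => //.
  exact: (lattice_charge_geometric (p01 i) (pq i) (w0 i) (hY i)).
have [k hk] := max_decay_le (fun i => (n i)%:R * qb i) hN.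
pose rho := maxw w / minw w.
have [mw0 mwk wkm] := chain_weights k w0.
have rho1 : 1 <= rho by rewrite ler_pdivlMr// mul1r (le_trans mwk).
have wrho i j : w i / w j + 1 <= 2 * rho.
  have [_ _ wi] := chain_weights i w0; have [_ wj _] := chain_weights j w0.
  have : w i / w j <= rho.
    apply: ler_pM => //; [exact: ltW|by rewrite invr_ge0 ltW|].
    by rewrite lef_pV2 ?posrE.
  by lra.
have e0 i : 0 <= e i by rewrite mulr_ge0 ?addr_ge0// ltW.
have tk0 : 0 < t k by exact: decay_gt0.
pose beta i := K0 ^+ N * (K0 * e i * (2 * rho * (K0 * t k))).
apply: (@le_trans _ _ (\sum_(i < N) beta i)%:E).
  apply: ge_ereal_sup => _ [x _ <-].
  rewrite -(@fineK _ (ssub _ _ _)) ?fin_charge// lee_fin -/(scdf _ _) scdf_ssub.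
  (* The truncation degree depends on x; the constants of [chain_estimates] do not. *)
  pose K := \max_(i < N) lattice_count (w i) x.
  have xK i : (lattice_count (w i) x <= K)%N by exact: leq_bigmax.
  rewrite /sprod (scdf_prod w0 _ hA xK) (scdf_prod w0 _ hB xK).
  apply: (lconvs_telescope (s := [::])) => s i r; rewrite cat0s => es.
  have sN : (size s + size r <= N)%N.
    have sz : size (index_enum 'I_N) = N by rewrite /index_enum unlock -enumT size_enum_ord.
    by rewrite -[leqRHS]sz es size_cat/= addnS leqnSn.
  have aC j : fnorm K (A j) <= K0 by have [V [_ _ _ []]] := est j K.
  have bC j : fnorm K (B j) <= K0 by have [V [_ _ _ []]] := est j K.
  have KN0 : K0 ^+ (size s + size r) <= K0 ^+ N by rewrite ler_weXn2l.
  have [V [hV VE dE _ [sA sB]]] := est i K.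
  have Ke0 : 0 <= K0 * e i by rewrite mulr_ge0// ltW.
  have Kt0 : 0 <= K0 * t k by rewrite mulr_ge0// ltW.
  have rK0 : 0 <= 2 * rho * (K0 * t k) by rewrite mulr_ge0//; lra.
  have [ik|ik] := eqVneq k i.
    apply: (le_trans (diagonal_term_bound w0 K01 aC bC s r x dE)).
    rewrite /beta -ik; apply: ler_pM => //; first by rewrite exprn_ge0// ltW.
      by rewrite -ik in Ke0 *; rewrite mulr_ge0// ltW.
    rewrite ik in Ke0 *; rewrite -ik; apply: ler_wpM2l; first by rewrite ik.
    have : 1 <= 2 * rho * K0.
      by apply: (@le_trans _ _ (2 * 1 * 1)); [lra|apply: ler_pM => //; lra].
    by move=> h1; rewrite mulrA ler_peMl// ltW.
  have kin : (k \in s) || (k \in r).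
    have : k \in index_enum 'I_N by rewrite mem_index_enum.
    by rewrite es mem_cat inE (negbTE ik).
  have sh c : fnorm K ((fps_X - 1) * c) <= K0 * t k ->
      forall z, `|lshift (w i) (lconv K (w k) c (@heaviside R)) z| <= 2 * rho * (K0 * t k).
    move=> cK z; apply: (le_trans (lshift_heaviside _ _ _ (w0 k) (w0 i))).
    by apply: ler_pM => //; [rewrite addr_ge0// divr_ge0// ltW|exact: fnorm_ge0].
  have [_ [_ _ _ _ [sAk sBk]]] := est k K.
  apply: (le_trans (mixed_term_bound w0 K01 aC bC hV VE Ke0 rK0 (sh _ sAk) (sh _ sBk) kin (xK i))).
  by apply: ler_wpM2r => //; rewrite mulr_ge0.
rewrite lee_fin /beta -mulr_sumr.
rewrite (_ : \sum_(i < N) _ = (\sum_(i < N) e i) * (K0 * (2 * rho * (K0 * t k)))); last first.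
  by rewrite mulr_suml; apply: eq_bigr => i _; ring.
have [_ tk] := hk k; rewrite -/(t k) in tk.
set S := \sum_(i < N) e i; set Q := (Num.sqrt _)^-1 in tk *.
have S0 : 0 <= S by exact: sumr_ge0.
have KN : 0 <= K0 ^+ N by rewrite exprn_ge0// ltW.
have Kr : 0 <= K0 * (2 * rho * K0) :=
  mulr_ge0 (ltW K00) (mulr_ge0 (mulr_ge0 (ler0n _ 2) (le_trans ler01 rho1)) (ltW K00)).
have := ler_wpM2l (mulr_ge0 KN (mulr_ge0 Kr S0)) tk.
rewrite -/rho -/S; congr (_ <= _); ring.
Qed.
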